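(* Let $\mathfrak{Q}_0\subset\mathbb{C}$ be an open set containing $0$, let $E\colon \mathfrak{Q}_0\times S^1\to\mathbb{R}$ and $B\colon\mathfrak{Q}_0\to\mathbb{R}$ be smooth, and let $A=A_1dq_1+A_2dq_2$ be a one-form on $\mathfrak{Q}_0$ with $dA=B\,dq_1\wedge dq_2$. Consider the ODE $$\ddot q=-B(q)\,i\dot q-\frac{q}{|q|^3}-\nabla E_t(q)\qquad (\ast)$$ and the functional $\mathcal{F}\colon\mathfrak{L}^*\mathfrak{Z}_0\cup\mathfrak{L}^*_-\mathfrak{Z}_0\to\mathbb{R}$ defined in the context, which is invariant under the involution $I(z)=-z$. Then: 1. There is a one-to-one correspondence, induced by $\Sigma\colon z\mapsto q_z$, between $\mathrm{crit}(\mathcal{F})/I$ and collisional periodic solutions of $(\ast)$. 2. Untwisted critical points (those in $\mathfrak{L}^*\mathfrak{Z}_0$) correspond to collisional solutions of even winding number, and twisted critical points (those in $\mathfrak{L}^*_-\mathfrak{Z}_0$) correspond to collisional solutions of odd winding number. 3. Critical points $z$ of $\mathcal{F}$ (twisted or untwisted) are solutions of the second order delay equation $$z''(\tau)=-\frac{\varepsilon(z)(\tau)}{2\|z\|^4}-\frac{|z(\tau)|^2B(z(\tau)^2)}{\|z\|^2}\,i z'(\tau)+\left(\frac{\|z'\|^2}{\|z\|^2}+\frac{\mathcal{E}(z)+\mathcal{E}^1(z)}{2\|z\|^4}-\frac{1}{2\|z\|^6}\right)z(\tau),\qquad \tau\in[0,1).$$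
   Context: Notation. $S^1=\mathbb{R}/\mathbb{Z}$; $E_t(q)=E(q,t)$; $\dot E_t=\partial E/\partial t$; $\nabla E_t=\partial_{q_1}E_t+i\,\partial_{q_2}E_t\in\mathbb{C}$ is the spatial gradient, where $q=q_1+iq_2$. Let $\varsigma(z)=z^2$ and $\mathfrak{Z}_0=\varsigma^{-1}(\mathfrak{Q}_0)\subset\mathbb{C}$. Loop spaces. For functions $\xi,\eta\colon[0,1]\to\mathbb{C}$ put $\langle\xi,\eta\rangle=\int_0^1\mathrm{Re}(\xi\bar\eta)\,d\tau$ and $\|\xi\|=\sqrt{\langle\xi,\xi\rangle}$. The blown-up untwisted loop space is $$\mathfrak{L}^*\mathfrak{Z}_0=\{z\in C^\infty(\mathbb{R},\mathfrak{Z}_0): z(\tau+1)=z(\tau)\ \forall\tau,\ \|z\|\ne0\},$$ and the blown-up twisted loop space is $$\mathfrak{L}^*_-\mathfrak{Z}_0=\{z\in C^\infty(\mathbb{R},\mathfrak{Z}_0): z(\tau+1)=-z(\tau)\ \forall\tau,\ \|z\|\neq 0\},$$ with norms computed over $[0,1]$. Both spaces are invariant under $I\colon z\mapsto -z$. Functional. For $z$ in either space define $$t_z(\tau)=\frac{1}{\|z\|^2}\int_0^\tau|z(s)|^2ds,\qquad \tau\in[0,1],$$ $$\mathcal{E}(z)=\frac{1}{\|z\|^2}\int_0^1E_{t_z(\tau)}(z(\tau)^2)\,|z(\tau)|^2\,d\tau,$$ $$\mathcal{F}(z)=2\|z\|^2\|z'\|^2-\int_{[0,1]}z^*\varsigma^*A+\frac{1}{\|z\|^2}-\mathcal{E}(z).$$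 A critical point of $\mathcal{F}$ is a $z$ such that $d\mathcal{F}(z)\zeta=0$ for all smooth $\zeta\colon\mathbb{R}\to\mathbb{C}$ with $\zeta(\tau+1)=\zeta(\tau)$ if $z$ is untwisted, respectively $\zeta(\tau+1)=-\zeta(\tau)$ if $z$ is twisted. The set of all critical points, twisted and untwisted, is denoted $\mathrm{crit}(\mathcal{F})$. Terms of the delay equation. Set $$\mathcal{E}^1(z)=\frac{1}{\|z\|^4}\int_0^1\Big(\int_0^\sigma|z(s)|^2ds\Big)\dot E_{t_z(\sigma)}(z(\sigma)^2)\,|z(\sigma)|^2\,d\sigma,$$ and $\varepsilon(z)=\varepsilon_1(z)+\varepsilon_2(z)+\varepsilon_3(z)$ with, for $\tau\in[0,1)$, $$\varepsilon_1(z)(\tau)=\frac{1}{\|z\|^2}\Big(\int_\tau^1\dot E_{t_z(\sigma)}(z(\sigma)^2)|z(\sigma)|^2d\sigma\Big)z(\tau),$$ $$\varepsilon_2(z)(\tau)=|z(\tau)|^2\,\nabla E_{t_z(\tau)}(z(\tau)^2)\,\bar z(\tau),\qquad \varepsilon_3(z)(\tau)=E_{t_z(\tau)}(z(\tau)^2)\,z(\tau).$$ The map $\Sigma\colon z\mapsto q_z$. A critical point $z$ of $\mathcal{F}$ has only finitely many zeros in $[0,1]$, so $t_z\colon[0,1]\to[0,1]$ is a homeomorphism; let $\tau_z$ be its inverse and put $q_z(t)=\Sigma(z)(t)=z(\tau_z(t))^2$. This is a continuous loop $q_z\colon S^1\to\mathfrak{Q}_0$, smooth away from its zeros (the collision times).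 Note $q_{-z}=q_z$. Collisional periodic solutions. A collisional periodic solution of $(\ast)$ is a continuous loop $q\colon S^1\to\mathfrak{Q}_0$ with finitely many zeros (the collisions; possibly none) which is smooth and satisfies $(\ast)$ at every $t\in S^1$ with $q(t)\neq0$; at collisions $q$ is merely continuous and its derivative explodes. Winding number modulo 2. A collisional periodic solution is said to have even winding number if it corresponds under $\Sigma$ to a critical point of $\mathcal{F}$ in $\mathfrak{L}^*\mathfrak{Z}_0$, and odd winding number if it corresponds under $\Sigma$ to a critical point of $\mathcal{F}$ in $\mathfrak{L}^*_-\mathfrak{Z}_0$. (For solutions without zeros this is the parity of the usual winding number around $0$.)
   Formalization: The relation between A and B is corrected to dA = −B dq1∧dq2, and collisional periodic solutions are also required to have, at each collision, two-sided finite limits of q/|q| and of |q̇|²/2 − 1/|q|; without these changes items 1 and 3 fail. *)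

(* Defs.v *)
From Stdlib Require Export Reals List ZArith ClassicalEpsilon.
From Coquelicot Require Export Coquelicot.
Open Scope R_scope.

(* Functions on an open set U of C, possibly depending on time, are total
   functions C -> R -> R of which only the values over U are ever constrained.
   The circle is R/Z: functions of time are 1-periodic functions on R. *)

Definition d_1 (f : C -> R -> R) : C -> R -> R :=
  fun q t => Derive (fun x => f (x, Im q) t) (Re q).
Definition d_2 (f : C -> R -> R) : C -> R -> R :=
  fun q t => Derive (fun y => f (Re q, y) t) (Im q).
Definition d_t (f : C -> R -> R) : C -> R -> R :=
  fun q t => Derive (fun s => f q s) t.

Definition continuous_over (U : C -> Prop) (f : C -> R -> R) : Prop :=
  forall q t, U q -> continuous (fun p : C * R => f (fst p) (snd p)) (q, t).

Fixpoint Ck_over (n : nat) (U : C -> Prop) (f : C -> R -> R) : Prop :=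
  continuous_over U f /\
  match n with
  | O => True
  | S m =>
      (forall q t, U q ->
         ex_derive (fun x => f (x, Im q) t) (Re q) /\
         ex_derive (fun y => f (Re q, y) t) (Im q) /\
         ex_derive (fun s => f q s) t) /\
      Ck_over m U (d_1 f) /\ Ck_over m U (d_2 f) /\ Ck_over m U (d_t f)
  end.

Definition smooth_over (U : C -> Prop) (f : C -> R -> R) : Prop :=
  forall n, Ck_over n U f.

Definition static (g : C -> R) : C -> R -> R := fun q _ => g q.

Definition grad (f : C -> R -> R) (q : C) (t : R) : C := (d_1 f q t, d_2 f q t).

(** * Curves in C *)

Definition Cderive (z : R -> C) : R -> C :=
  fun t => (Derive (fun s => Re (z s)) t, Derive (fun s => Im (z s)) t).

Definition smooth_at (z : R -> C) (t : R) : Prop :=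
  forall n, ex_derive_n (fun s => Re (z s)) n t /\ ex_derive_n (fun s => Im (z s)) n t.

Definition smooth (z : R -> C) : Prop := forall t, smooth_at z t.

Definition periodic (z : R -> C) : Prop := forall t, z (t + 1) = z t.
Definition antiperiodic (z : R -> C) : Prop := forall t, z (t + 1) = Copp (z t).

Definition inner (xi eta : R -> C) : R :=
  RInt (fun tau => Re (xi tau * Cconj (eta tau))%C) 0 1.
Definition L2norm (xi : R -> C) : R := sqrt (inner xi xi).

Definition sq (z : R -> C) : R -> C := fun tau => (z tau ^ 2)%C.

Definition neg (z : R -> C) : R -> C := fun tau => (- z tau)%C.

(* The integral over [0,1] of the pullback of A_1 dq_1 + A_2 dq_2 along w. *)
Definition line_integral (A1 A2 : C -> R) (w : R -> C) : R :=
  RInt (fun tau => A1 (w tau) * Re (Cderive w tau) + A2 (w tau) * Im (Cderive w tau)) 0 1.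

(** * Blown-up loop spaces *)

Definition loop (Q0 : C -> Prop) (z : R -> C) : Prop :=
  smooth z /\ (forall tau, Q0 (sq z tau)) /\ L2norm z <> 0.

Definition untwisted_loop (Q0 : C -> Prop) (z : R -> C) : Prop :=
  loop Q0 z /\ periodic z.
Definition twisted_loop (Q0 : C -> Prop) (z : R -> C) : Prop :=
  loop Q0 z /\ antiperiodic z.

(** * The functional *)

Definition t_ (z : R -> C) (tau : R) : R :=
  / L2norm z ^ 2 * RInt (fun s => Cmod (z s) ^ 2) 0 tau.

Definition calE (E : C -> R -> R) (z : R -> C) : R :=
  / L2norm z ^ 2 *
  RInt (fun tau => E (sq z tau) (t_ z tau) * Cmod (z tau) ^ 2) 0 1.

Definition calF (E : C -> R -> R) (A1 A2 : C -> R) (z : R -> C) : R :=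
  2 * L2norm z ^ 2 * L2norm (Cderive z) ^ 2
  - line_integral A1 A2 (sq z) + / L2norm z ^ 2 - calE E z.

(* dF(z) zeta = l *)
Definition is_differential (F : (R -> C) -> R) (z zeta : R -> C) (l : R) : Prop :=
  is_derive (fun s : R => F (fun tau => z tau + s * zeta tau)%C) 0 l.

Definition crit_untwisted Q0 E A1 A2 (z : R -> C) : Prop :=
  untwisted_loop Q0 z /\
  forall zeta, smooth zeta -> periodic zeta ->
    is_differential (calF E A1 A2) z zeta 0.

Definition crit_twisted Q0 E A1 A2 (z : R -> C) : Prop :=
  twisted_loop Q0 z /\
  forall zeta, smooth zeta -> antiperiodic zeta ->
    is_differential (calF E A1 A2) z zeta 0.

Definition crit Q0 E A1 A2 (z : R -> C) : Prop :=
  crit_untwisted Q0 E A1 A2 z \/ crit_twisted Q0 E A1 A2 z.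

(** * Terms of the delay equation *)

Definition calE1 (E : C -> R -> R) (z : R -> C) : R :=
  / L2norm z ^ 4 *
  RInt (fun sigma => RInt (fun s => Cmod (z s) ^ 2) 0 sigma
                     * d_t E (sq z sigma) (t_ z sigma) * Cmod (z sigma) ^ 2) 0 1.

Definition eps1 (E : C -> R -> R) (z : R -> C) (tau : R) : C :=
  (RtoC (/ L2norm z ^ 2 *
         RInt (fun sigma => (d_t E (sq z sigma) (t_ z sigma) * Cmod (z sigma) ^ 2)%R) tau 1)
   * z tau)%C.

Definition eps2 (E : C -> R -> R) (z : R -> C) (tau : R) : C :=
  (RtoC (Cmod (z tau) ^ 2) * grad E (sq z tau) (t_ z tau) * Cconj (z tau))%C.

Definition eps3 (E : C -> R -> R) (z : R -> C) (tau : R) : C :=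
  (RtoC (E (sq z tau) (t_ z tau)) * z tau)%C.

Definition eps (E : C -> R -> R) (z : R -> C) (tau : R) : C :=
  (eps1 E z tau + eps2 E z tau + eps3 E z tau)%C.

Definition delay_equation (E : C -> R -> R) (B : C -> R) (z : R -> C) (tau : R) : Prop :=
  Cderive (Cderive z) tau =
  (- (eps E z tau / RtoC (2 * L2norm z ^ 4))
   - RtoC (Cmod (z tau) ^ 2 * B (sq z tau) / L2norm z ^ 2) * Ci * Cderive z tau
   + RtoC (L2norm (Cderive z) ^ 2 / L2norm z ^ 2
           + (calE E z + calE1 E z) / (2 * L2norm z ^ 4)
           - / (2 * L2norm z ^ 6)) * z tau)%C.

(** * The map Sigma *)

(* When t_ z is a bijection of [0,1], as for a critical point, this is its
   inverse; otherwise it is an arbitrary section. *)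
Definition tau_ (z : R -> C) (t : R) : R :=
  epsilon (inhabits 0) (fun tau => 0 <= tau <= 1 /\ t_ z tau = t).

(* frac_part selects the representative in [0,1) of a point of R/Z *)
Definition Sigma (z : R -> C) : R -> C := fun t => sq z (tau_ z (frac_part t)).

(** * Collisional periodic solutions *)

Definition newton (E : C -> R -> R) (B : C -> R) (q : R -> C) (t : R) : Prop :=
  Cderive (Cderive q) t =
  (- (RtoC (B (q t)) * Ci * Cderive q t) - q t / RtoC (Cmod (q t) ^ 3)
   - grad E (q t) t)%C.

(* The last three clauses describe a collision: the velocity explodes, and the
   solution continues through the collision as in the generalized solutions of
   Barutello, Ortega and Verzini, i.e. the direction q/|q| and the Kepler energy
   have a limit, the same from both sides.  Without the last two clauses
   unrelated arcs ending in 0 could be glued together; such a loop is not in the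
   image of Sigma. *)
Record collisional_solution (Q0 : C -> Prop) (E : C -> R -> R) (B : C -> R)
    (q : R -> C) : Prop := {
  cs_periodic : periodic q;
  cs_range : forall t, Q0 (q t);
  cs_continuous : forall t : R, continuous q t;
  cs_finite : exists l : list R, forall t, 0 <= t < 1 -> q t = 0 -> In t l;
  cs_smooth : forall t, q t <> 0 -> smooth_at q t;
  cs_newton : forall t, q t <> 0 -> newton E B q t;
  cs_explode : forall t : R, q t = 0 ->
    filterlim (fun s => Cmod (Cderive q s)) (locally' t) (Rbar_locally p_infty);
  cs_direction : forall t : R, q t = 0 -> exists l : C,
    filterlim (fun s => (q s / RtoC (Cmod (q s)))%C) (locally' t) (locally l);
  cs_energy : forall t : R, q t = 0 -> exists h : R,
    filterlim (fun s => Cmod (Cderive q s) ^ 2 / 2 - / Cmod (q s))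
      (locally' t) (locally h)
}.

Definition even_solution Q0 E B A1 A2 (q : R -> C) : Prop :=
  collisional_solution Q0 E B q /\
  exists z, crit_untwisted Q0 E A1 A2 z /\ Sigma z = q.

Definition odd_solution Q0 E B A1 A2 (q : R -> C) : Prop :=
  collisional_solution Q0 E B q /\
  exists z, crit_twisted Q0 E A1 A2 z /\ Sigma z = q.

Definition winding_number (q : R -> C) (k : Z) : Prop :=
  exists theta : R -> R,
    (forall t, continuous theta t) /\
    (forall t, q t = (RtoC (Cmod (q t)) * (cos (theta t), sin (theta t)))%C) /\
    (forall t, theta (t + 1) = theta t + 2 * PI * IZR k).

(* S is invariant under I : z |-> -z, and f induces a bijection S/I -> T. *)
Definition induces_bijection_mod_I (f : (R -> C) -> (R -> C))
    (S T : (R -> C) -> Prop) : Prop :=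
  (forall z, S z -> S (neg z) /\ f (neg z) = f z) /\
  (forall z, S z -> T (f z)) /\
  (forall z w, S z -> S w -> f z = f w -> w = z \/ w = neg z) /\
  (forall q, T q -> exists z, S z /\ f z = q).

(* Main.v *)
Require Import Defs.
From Stdlib Require Import Lra Lia Psatz Ranalysis5.

(* Put z(tau)^2 = q(t_z(tau)), so that dt/dtau = |z|^2 / N with N = ||z||^2. The first variation of F is the L^2
   pairing with the defect of the delay equation, hence critical points are exactly the (anti)periodic solutions of that
   equation. Along such a z the integral of the energy defect 2 N^2 |z'|^2 - 1 - |z|^2 k vanishes, which makes k the
   Kepler energy |q'|^2 / 2 - 1 / |q| of q, forces z' <> 0 at the zeros of z, and turns the delay equation into the
   Levi-Civita regularized equation LC; comparing tau = 0 and tau = 1 shows that the integral of (dE/dt) |z|^2 is 0,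
   so LC holds on the whole line. Newton's equation for q then follows by the chain rule.

   Conversely let q be collisional. Since (<q, q'>)' = 1 / |q| + (a function continuous across collisions),
   <q, q'> minus a primitive of that function is a primitive of 1 / |q|: this gives the regularized time. The square
   root z of q is explicit near each time, with a change of sign at a collision; the limit direction and the limit
   energy show that it is C^2 there. Two square roots z, w differ by a sign because Re (z conj w) + Re (z' conj w')
   never vanishes; this glues the local roots to a global z with z(tau + 1) = z(tau) or - z(tau), shows that z
   is unique up to sign, and relates the two cases to the parity of the winding number. *)

(** * Continuity and derivatives of real functions *)

(** Two points carry the difficulty. Forward, the delay equation is known on one period only, and
    its tail integral J of (dE/dt) |z|^2 is not periodic: J(tau + 1) = J(tau) - J(0). Beyond tau = 1
    the defect therefore acquires a multiple of J(0) z. As the defect and its derivative vanish at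
    both ends of [0,1], J(0) z(0) = 0 and J(0) z'(0) = 0; the energy law forbids z(0) = z'(0) = 0,
    so J(0) = 0. Backward, nothing is known in advance about z' at a collision. But with v = z^2 the
    product |z|^2 z' in the equation equals v' conj z / 2, which has no denominator. So z'' extends
    continuously and z' has a limit from each side. The energy law fixes the modulus of this limit,
    the limit direction of v fixes its square, and the half-plane containing the chosen branch of
    the root fixes its sign; hence the two limits coincide. *)

Section Cont.
Context {T : UniformSpace}.
Implicit Types f g : T -> R.

Lemma cont_plus f g p : continuous f p -> continuous g p -> continuous (fun p => f p + g p) p.
Proof. intros; now apply (continuous_plus f g). Qed.
Lemma cont_opp f p : continuous f p -> continuous (fun p => - f p) p.
Proof. intros; now apply (continuous_opp f). Qed.
Lemma cont_minus f g p : continuous f p -> continuous g p -> continuous (fun p => f p - g p) p.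
Proof. intros; now apply (continuous_minus f g). Qed.
Lemma cont_mult f g p : continuous f p -> continuous g p -> continuous (fun p => f p * g p) p.
Proof. intros; now apply (continuous_mult f g). Qed.
Lemma cont_const (c : R) (p : T) : continuous (fun _ : T => c) p.
Proof. apply continuous_const. Qed.
Lemma cont_pow f n p : continuous f p -> continuous (fun p => f p ^ n) p.
Proof. intros H; induction n; simpl; [apply cont_const | now apply cont_mult]. Qed.
Lemma cont_inv f p : continuous f p -> f p <> 0 -> continuous (fun p => / f p) p.
Proof.
  intros H H'. apply (continuous_comp f Rinv); [exact H|].
  now apply continuous_Rinv.
Qed.
Lemma cont_div f g p : continuous f p -> continuous g p -> g p <> 0 -> continuous (fun p => f p / g p) p.
Proof. intros; apply cont_mult; [assumption | now apply cont_inv]. Qed.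
Lemma cont_sqrt f p : continuous f p -> continuous (fun p => sqrt (f p)) p.
Proof. intros H. apply (continuous_comp f sqrt); [exact H | apply continuous_sqrt]. Qed.
Lemma cont_abs f p : continuous f p -> continuous (fun p => Rabs (f p)) p.
Proof. intros H. apply (continuous_comp f Rabs); [exact H | apply continuous_Rabs]. Qed.
Lemma cont_pair f g p : continuous f p -> continuous g p -> continuous (fun p => (f p, g p) : C) p.
Proof.
  intros Hf Hg. unfold continuous.
  change (filterlim (fun p => (f p, g p)) (locally p)
    (@locally (prod_UniformSpace R_UniformSpace R_UniformSpace) (f p, g p))).
  intros P [e He]. destruct (Hf (fun u => ball (f p) e u)) as [d1 Hd1]; [now exists e|].
  destruct (Hg (fun u => ball (g p) e u)) as [d2 Hd2]; [now exists e|].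
  assert (Hd : 0 < Rmin d1 d2) by (apply Rmin_pos; apply cond_pos).
  exists (mkposreal _ Hd). intros u Hu. apply He. split; simpl.
  - apply Hd1. eapply ball_le; [|exact Hu]. apply Rmin_l.
  - apply Hd2. eapply ball_le; [|exact Hu]. apply Rmin_r.
Qed.
Lemma cont_Re (w : T -> C) p : continuous w p -> continuous (fun p => Re (w p)) p.
Proof. intros H. apply (continuous_comp w fst); [exact H | apply continuous_fst]. Qed.
Lemma cont_Im (w : T -> C) p : continuous w p -> continuous (fun p => Im (w p)) p.
Proof. intros H. apply (continuous_comp w snd); [exact H | apply continuous_snd]. Qed.
Lemma cont_over (U : C -> Prop) (h : C -> R -> R) (w : T -> C) (s : T -> R) p :
  continuous_over U h -> U (w p) -> continuous w p -> continuous s p ->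
  continuous (fun p => h (w p) (s p)) p.
Proof.
  intros Hh HU Hw Hs.
  apply (continuous_comp_2 w s h); auto.
Qed.
End Cont.

Lemma is_derive_eq [f : R -> R] [x l l' : R] : is_derive f x l -> l = l' -> is_derive f x l'.
Proof. now intros H <-. Qed.
Lemma der_plus [f g : R -> R] [x a b : R] : is_derive f x a -> is_derive g x b ->
  is_derive (fun u => f u + g u) x (a + b).
Proof. intros; now apply (is_derive_plus f g). Qed.
Lemma der_minus [f g : R -> R] [x a b : R] : is_derive f x a -> is_derive g x b ->
  is_derive (fun u => f u - g u) x (a - b).
Proof. intros; now apply (is_derive_minus f g). Qed.
Lemma der_opp [f : R -> R] [x a : R] : is_derive f x a -> is_derive (fun u => - f u) x (- a).
Proof. intros; now apply (is_derive_opp f). Qed.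
Lemma der_mult [f g : R -> R] [x a b : R] : is_derive f x a -> is_derive g x b ->
  is_derive (fun u => f u * g u) x (a * g x + f x * b).
Proof. intros; apply (is_derive_mult f g); auto. intros; apply Rmult_comm. Qed.
Lemma der_const (c x : R) : is_derive (fun _ : R => c) x 0.
Proof. apply (is_derive_const c x). Qed.
Lemma der_id (x : R) : is_derive (fun u : R => u) x 1.
Proof. apply (is_derive_id x). Qed.
Lemma der_inv [f : R -> R] [x a : R] : is_derive f x a -> f x <> 0 -> is_derive (fun u => / f u) x (- a / f x ^ 2).
Proof. apply is_derive_inv. Qed.
Lemma der_div [f g : R -> R] [x a b : R] : is_derive f x a -> is_derive g x b -> g x <> 0 ->
  is_derive (fun u => f u / g u) x (a * / g x + f x * (- b / g x ^ 2)).
Proof. intros H H0 H1. unfold Rdiv at 1. apply (der_mult (g := fun u => / g u) H). now apply der_inv. Qed.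
Lemma der_pow2 [f : R -> R] [x a : R] : is_derive f x a -> is_derive (fun u => f u ^ 2) x (2 * f x * a).
Proof.
  intros H. eapply is_derive_eq.
  - eapply is_derive_ext; [|apply (der_mult H H)]. intros; simpl; ring.
  - simpl; ring.
Qed.
Lemma der_sqrt (f : R -> R) (x a : R) : is_derive f x a -> 0 < f x ->
  is_derive (fun u => sqrt (f u)) x (a * / (2 * sqrt (f x))).
Proof.
  intros H H0. eapply is_derive_eq.
  - apply (is_derive_comp sqrt f); [|exact H]. apply is_derive_Reals. now apply derivable_pt_lim_sqrt.
  - reflexivity.
Qed.
Lemma der_comp (f g : R -> R) (x a b : R) : is_derive f (g x) a -> is_derive g x b ->
  is_derive (fun u => f (g u)) x (a * b).
Proof. intros. eapply is_derive_eq; [now apply (is_derive_comp f g); eauto|].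
unfold scal; simpl; unfold mult; simpl; ring. Qed.
Lemma der_cont [f : R -> R] [x l : R] : is_derive f x l -> continuous f x.
Proof. intros H. apply (ex_derive_continuous f x). now exists l. Qed.

(** [der] computes a derivative by the rules and leaves the equation between the computed and the
    stated value. The clauses with a bare [Rmult ?c], [Rplus ?c] or [Ropp] catch functions that
    unification has eta-contracted. *)
Ltac der1 := match goal with
  | |- is_derive (fun _ => ?c) _ _ => apply der_const
  | |- is_derive (fun u => u) _ _ => apply der_id
  | |- is_derive (Rmult ?c) _ _ => apply (@der_mult (fun _ => c) (fun u => u))
  | |- is_derive (Rplus ?c) _ _ => apply (@der_plus (fun _ => c) (fun u => u))
  | |- is_derive (Rminus ?c) _ _ => apply (@der_minus (fun _ => c) (fun u => u))
  | |- is_derive Ropp _ _ => apply (der_opp (fun u => u))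
  | |- is_derive (fun _ => _ + _) _ _ => apply der_plus
  | |- is_derive (fun _ => _ - _) _ _ => apply der_minus
  | |- is_derive (fun _ => - _) _ _ => apply der_opp
  | |- is_derive (fun _ => _ * _) _ _ => apply der_mult
  | |- is_derive (fun _ => _ / _) _ _ => apply der_div
  | |- is_derive (fun _ => / _) _ _ => apply der_inv
  | |- is_derive (fun _ => _ ^ 2) _ _ => apply der_pow2
  | |- is_derive (fun _ => sqrt _) _ _ => apply der_sqrt
  end.
Ltac der := eapply is_derive_eq; [repeat der1; eauto 2 | cbv beta].

Ltac cont1 := match goal with
  | |- continuous (fun _ => ?c) _ => apply cont_const
  | |- continuous (fun u => u) _ => apply continuous_id
  | |- continuous (Rmult ?c) _ => apply (cont_mult (fun _ => c) (fun u => u))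
  | |- continuous (Rplus ?c) _ => apply (cont_plus (fun _ => c) (fun u => u))
  | |- continuous (fun _ => _ + _) _ => apply cont_plus
  | |- continuous (fun _ => _ - _) _ => apply cont_minus
  | |- continuous (fun _ => - _) _ => apply cont_opp
  | |- continuous (fun _ => _ * _) _ => apply cont_mult
  | |- continuous (fun _ => _ / _) _ => apply cont_div
  | |- continuous (fun _ => / _) _ => apply cont_inv
  | |- continuous (fun _ => _ ^ _) _ => apply cont_pow
  | |- continuous (fun _ => sqrt _) _ => apply cont_sqrt
  | |- continuous (fun _ => Rabs _) _ => apply cont_abs
  | |- continuous (fun _ => (_, _)) _ => apply cont_pair
  end.
Ltac cont := repeat cont1; auto.

Lemma locally_R (x : R) (P : R -> Prop) : locally x P <-> exists d, 0 < d /\ forall u, Rabs (u - x) < d -> P u.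
Proof.
  split.
  - intros [d H]. exists d. split; [apply cond_pos|]. intros u Hu. now apply H.
  - intros [d [Hd H]]. exists (mkposreal d Hd). intros u Hu. now apply H.
Qed.
Lemma locally'_R (x : R) (P : R -> Prop) : locally' x P <-> exists d, 0 < d /\ forall u, Rabs (u - x) < d ->
  u <> x -> P u.
Proof. unfold locally', within. rewrite locally_R. tauto. Qed.
Lemma continuous_R (f : R -> R) (x : R) : continuous f x <-> forall e, 0 < e -> exists d, 0 < d /\
  forall u, Rabs (u - x) < d -> Rabs (f u - f x) < e.
Proof.
  split.
  - intros H e He. apply (locally_R x (fun u => Rabs (f u - f x) < e)). apply (H (fun w => Rabs (w - f x) < e)).
    exists (mkposreal e He). now intros u Hu.
  - intros H P [e HP]. destruct (H e (cond_pos e)) as [d [Hd H1]]. apply locally_R. exists d. split; auto.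
    intros u Hu. apply HP. now apply H1.
Qed.
Lemma filterlim'_R (f : R -> R) (x l : R) : filterlim f (locally' x) (locally l) <-> forall e, 0 < e ->
  exists d, 0 < d /\ forall u, Rabs (u - x) < d -> u <> x -> Rabs (f u - l) < e.
Proof.
  split.
  - intros H e He. apply (locally'_R x (fun u => Rabs (f u - l) < e)). apply (H (fun w => Rabs (w - l) < e)).
    exists (mkposreal e He). now intros u Hu.
  - intros H P [e HP]. destruct (H e (cond_pos e)) as [d [Hd H1]]. apply locally'_R. exists d. split; auto.
    intros u Hu Hne. apply HP. now apply H1.
Qed.
Lemma is_derive_R (f : R -> R) (x l : R) : is_derive f x l <-> forall e, 0 < e -> exists d, 0 < d /\
  forall u, Rabs (u - x) < d -> Rabs (f u - f x - l * (u - x)) <= e * Rabs (u - x).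
Proof.
  rewrite is_derive_Reals. split.
  - intros H e He. destruct (H e He) as [d Hd]. exists d. split; [apply cond_pos|]. intros u Hu.
    destruct (Req_dec u x) as [->|Hne].
    { rewrite !Rminus_diag, Rmult_0_r, Rminus_diag, Rabs_R0. lra. }
    specialize (Hd (u - x) ltac:(lra) Hu). replace (x + (u - x)) with u in Hd by ring.
    replace (f u - f x - l * (u - x)) with (((f u - f x) / (u - x) - l) * (u - x)) by (field; lra).
    rewrite Rabs_mult. apply Rmult_le_compat_r; [apply Rabs_pos | lra].
  - intros H e He. destruct (H (e / 2) ltac:(lra)) as [d [Hd H1]]. exists (mkposreal d Hd). intros h Hh0 Hh.
    simpl in Hh.
    specialize (H1 (x + h)). replace (x + h - x) with h in H1 by ring. specialize (H1 Hh).
    replace ((f (x + h) - f x) / h - l) with ((f (x + h) - f x - l * h) / h) by (field; auto).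
    unfold Rdiv at 1. rewrite Rabs_mult, Rabs_inv. assert (0 < Rabs h) by now apply Rabs_pos_lt.
    apply Rle_lt_trans with (e / 2 * Rabs h * / Rabs h).
    + apply Rmult_le_compat_r; auto. left. now apply Rinv_0_lt_compat.
    + rewrite Rmult_assoc, Rinv_r by lra. lra.
Qed.

Lemma continuous_continuity_pt (f : R -> R) x : continuous f x <-> continuity_pt f x.
Proof. split; intros H; apply continuity_pt_filterlim; exact H. Qed.

Lemma mvt (f df : R -> R) (a b : R) : a < b ->
  (forall x, a < x < b -> is_derive f x (df x)) -> (forall x, a <= x <= b -> continuous f x) ->
  exists c, a < c < b /\ f b - f a = df c * (b - a).
Proof.
  intros Hab Hd Hc.
  assert (pr : forall c, a < c < b -> derivable_pt f c).
  { intros c Hc'. exists (df c). apply is_derive_Reals. now apply Hd. }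
  assert (prid : forall c, a < c < b -> derivable_pt id c) by (intros; apply derivable_pt_id).
  destruct (MVT f id a b pr prid Hab) as [c [Pc H]].
  - intros c Hc'. apply continuous_continuity_pt. now apply Hc.
  - intros c _. apply derivable_continuous_pt. apply derivable_pt_id.
  - exists c. split; auto.
    assert (E1 : derive_pt f c (pr c Pc) = df c) by (apply derive_pt_eq; apply is_derive_Reals; now apply Hd).
    assert (E2 : derive_pt id c (prid c Pc) = 1) by (apply derive_pt_eq; apply derivable_pt_lim_id).
    rewrite E1, E2 in H. unfold id in H. lra.
Qed.

(** The mean value theorem on each side of x. This is how derivatives at collision times are
    obtained, where only the derivatives at nearby times can be computed. *)
Lemma derive_of_limit (f df : R -> R) (x : R) :
  continuous f x -> locally' x (fun s => is_derive f s (df s)) ->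
  filterlim df (locally' x) (locally (df x)) -> is_derive f x (df x).
Proof.
  intros Hc Hd Hl. apply is_derive_R. intros e He.
  apply locally'_R in Hd. destruct Hd as [d1 [Hd1 Hd]].
  destruct (proj1 (filterlim'_R df x (df x)) Hl e He) as [d2 [Hd2 H2]].
  exists (Rmin d1 d2). split; [now apply Rmin_pos|]. intros u Hu.
  assert (Hu1 : Rabs (u - x) < d1) by (eapply Rlt_le_trans; [exact Hu | apply Rmin_l]).
  assert (Hu2 : Rabs (u - x) < d2) by (eapply Rlt_le_trans; [exact Hu | apply Rmin_r]).
  assert (Hcont : forall w, Rabs (w - x) < d1 -> continuous f w).
  { intros w Hw. destruct (Req_dec w x) as [->|Hne]; auto. eapply der_cont. apply Hd; auto. }
  destruct (Rtotal_order u x) as [Hlt | [-> | Hgt]].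
  - rewrite Rabs_left in Hu1, Hu2 by lra.
    destruct (mvt f df u x Hlt) as [c [Pc Hc']].
    + intros w Hw. apply Hd; [|lra]. rewrite Rabs_left; lra.
    + intros w Hw. apply Hcont. rewrite Rabs_left1; lra.
    + replace (f u - f x - df x * (u - x)) with ((df c - df x) * (u - x)) by lra.
      rewrite Rabs_mult. apply Rmult_le_compat_r; [apply Rabs_pos|]. left. apply H2; [|lra]. rewrite Rabs_left; lra.
  - replace (f x - f x - df x * (x - x)) with 0 by ring. rewrite Rminus_diag, Rabs_R0. lra.
  - rewrite Rabs_right in Hu1, Hu2 by lra.
    destruct (mvt f df x u Hgt) as [c [Pc Hc']].
    + intros w Hw. apply Hd; [|lra]. rewrite Rabs_right; lra.
    + intros w Hw. apply Hcont. rewrite Rabs_right; lra.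
    + replace (f u - f x - df x * (u - x)) with ((df c - df x) * (u - x)) by lra.
      rewrite Rabs_mult. apply Rmult_le_compat_r; [apply Rabs_pos|]. left. apply H2; [|lra]. rewrite Rabs_right; lra.
Qed.

Lemma continuous_filterlim' (f : R -> R) (x : R) : continuous f x <-> filterlim f (locally' x) (locally (f x)).
Proof.
  rewrite continuous_R, filterlim'_R. split; intros H e He; destruct (H e He) as [d [Hd H1]]; exists d; split; auto.
  intros u Hu. destruct (Req_dec u x) as [->|]; auto. rewrite Rminus_diag, Rabs_R0. lra.
Qed.

Lemma derive_of_cont (f df : R -> R) (x : R) :
  continuous f x -> locally' x (fun s => is_derive f s (df s)) -> continuous df x -> is_derive f x (df x).
Proof. intros. apply derive_of_limit; auto. now apply continuous_filterlim'. Qed.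

Lemma derive_zero_const (f : R -> R) (a b : R) : (forall x, is_derive f x 0) -> f a = f b.
Proof.
  intros H. destruct (Rtotal_order a b) as [Hlt|[->|Hgt]]; auto.
  - destruct (mvt f (fun _ => 0) a b Hlt) as [c [_ Hc]]; auto. intros; eapply der_cont; apply H. lra.
  - destruct (mvt f (fun _ => 0) b a Hgt) as [c [_ Hc]]; auto. intros; eapply der_cont; apply H. lra.
Qed.

(** The derivative may vanish or fail to exist at isolated points, as happens at collisions for the
    two time changes. The mean value theorem gives strict increase just to the right of every point,
    and this is enough. *)
Lemma strict_incr_of_pos (f : R -> R) :
  (forall x, continuous f x) -> (forall x, locally' x (fun s => exists l, 0 < l /\ is_derive f s l)) ->
  forall a b, a < b -> f a < f b.
Proof.
  intros Hc Hd.
  assert (Hr : forall x, exists d, 0 < d /\ forall u, x < u < x + d -> f x < f u).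
  { intros x. destruct (proj1 (locally'_R _ _) (Hd x)) as [d [Hd0 H]]. exists d; split; auto. intros u Hu.
    destruct (mvt f (Derive f) x u) as [c [Pc Hc']]; try lra; auto.
    - intros w Hw. destruct (H w) as [l [_ Hl]]; [rewrite Rabs_right; lra|lra|]. apply Derive_correct. now exists l.
    - destruct (H c) as [l [Hl0 Hl]]; [rewrite Rabs_right; lra|lra|].
      rewrite (is_derive_unique _ _ _ Hl) in Hc'. assert (0 < l * (u - x)) by (apply Rmult_lt_0_compat; lra). lra. }
  assert (Hle : forall a b, a <= b -> f a <= f b).
  (* A maximum point on [a,b] other than b would be exceeded just to its right. *)
  { intros a b Hab. destruct (continuity_ab_maj f a b Hab) as [m [Hm1 Hm2]].
    { intros c _. apply continuous_continuity_pt. apply Hc. }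
    destruct (Req_dec m b) as [->|Hne]; [apply Hm1; lra|].
    exfalso. destruct (Hr m) as [d [Hd0 H]].
    assert (Hmin : 0 < Rmin d (b - m)) by (apply Rmin_pos; lra).
    pose proof (Rmin_l d (b - m)). pose proof (Rmin_r d (b - m)).
    specialize (H (m + Rmin d (b - m) / 2)). specialize (Hm1 (m + Rmin d (b - m) / 2)). lra. }
  intros a b Hab. destruct (Hr a) as [d [Hd0 H]].
  assert (Hmin : 0 < Rmin d (b - a)) by (apply Rmin_pos; lra).
  pose proof (Rmin_l d (b - a)). pose proof (Rmin_r d (b - a)).
  apply Rlt_le_trans with (f (a + Rmin d (b - a) / 2)); [apply H; lra | apply Hle; lra].
Qed.

Lemma incr_inverse (f : R -> R) :
  (forall x, continuous f x) -> (forall a b, a < b -> f a < f b) -> (forall y, exists x, f x = y) ->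
  exists g : R -> R, (forall x, g (f x) = x) /\ (forall y, f (g y) = y) /\ (forall a b, a < b -> g a < g b) /\
    (forall y, continuous g y).
Proof.
  intros Hc Hi Hs.
  pose (g := fun y => epsilon (inhabits 0) (fun x => f x = y)).
  assert (Hfg : forall y, f (g y) = y). { intros y. unfold g. apply epsilon_spec. apply Hs. }
  assert (Hinj : forall a b, f a < f b -> a < b).
  { intros a b Hab. destruct (Rlt_le_dec a b) as [|[Hlt| ->]]; auto; [specialize (Hi _ _ Hlt)|]; lra. }
  assert (Hgf : forall x, g (f x) = x).
  { intros x. destruct (Rtotal_order (g (f x)) x) as [H|[H|H]]; auto; apply Hi in H; rewrite Hfg in H; lra. }
  exists g. split; [|split; [|split]]; auto.
  - intros a b Hab. apply Hinj. now rewrite !Hfg.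
  - intros y. apply continuous_R. intros e He.
    pose proof (Hi (g y - e) (g y) ltac:(lra)) as H1. pose proof (Hi (g y) (g y + e) ltac:(lra)) as H2.
    rewrite Hfg in H1, H2.
    exists (Rmin (y - f (g y - e)) (f (g y + e) - y)). split; [apply Rmin_pos; lra|].
    intros u Hu.
    pose proof (Rmin_l (y - f (g y - e)) (f (g y + e) - y)). pose proof (Rmin_r (y - f (g y - e)) (f (g y + e) - y)).
    apply Rabs_def2 in Hu. apply Rabs_def1.
    + assert (g u < g y + e); [|lra]. apply Hinj. rewrite Hfg. lra.
    + assert (g y - e < g u); [|lra]. apply Hinj. rewrite Hfg. lra.
Qed.

Lemma inverse_derive (f g : R -> R) (y l : R) :
  continuous g y -> (forall u, f (g u) = u) -> (forall u, g (f u) = u) -> is_derive f (g y) l -> l <> 0 ->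
    is_derive g y (/ l).
Proof.
  intros Hg Hfg Hgf Hf Hl. apply is_derive_R. intros e He.
  assert (Hl' : 0 < Rabs l) by now apply Rabs_pos_lt.
  (* The first bound gives |l| |g u - g y| <= 2 |u - y|; with it, the second makes the error of f at
     most e |u - y| after division by |l|. *)
  pose (e1 := Rmin (Rabs l / 2) (e * Rabs l * Rabs l / 2)).
  assert (He1 : 0 < e1).
  { apply Rmin_pos; [lra|]. assert (0 < e * Rabs l * Rabs l) by (repeat apply Rmult_lt_0_compat; auto). lra. }
  destruct (proj1 (is_derive_R _ _ _) Hf e1 He1) as [d1 [Hd1 H1]].
  destruct (proj1 (continuous_R _ _) Hg d1 Hd1) as [d [Hd H]].
  exists d. split; auto. intros u Hu. specialize (H1 (g u) (H u Hu)). rewrite !Hfg in H1.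
  assert (A : Rabs (l * (g u - g y)) <= 2 * Rabs (u - y)).
  { pose proof (Rmin_l (Rabs l / 2) (e * Rabs l * Rabs l / 2)). fold e1 in H0.
    assert (Rabs (l * (g u - g y)) <= Rabs (u - y) + Rabs (u - y - l * (g u - g y))).
    { replace (l * (g u - g y)) with ((u - y) - (u - y - l * (g u - g y))) at 1 by ring.
      eapply Rle_trans; [apply Rabs_triang|]. rewrite Rabs_Ropp. lra. }
    assert (e1 * Rabs (g u - g y) <= Rabs (l * (g u - g y)) / 2).
    { rewrite Rabs_mult. pose proof (Rabs_pos (g u - g y)). nra. }
    lra. }
  rewrite Rabs_mult in A.
  replace (g u - g y - / l * (u - y)) with (- (/ l * (u - y - l * (g u - g y)))) by (field; auto).
  rewrite Rabs_Ropp, Rabs_mult, Rabs_inv.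
  apply Rmult_le_reg_l with (Rabs l); auto. rewrite <- Rmult_assoc, Rinv_r, Rmult_1_l by lra.
  eapply Rle_trans; [exact H1|].
  assert (e1 <= e * Rabs l * Rabs l / 2) by apply Rmin_r.
  pose proof (Rabs_pos (g u - g y)). pose proof (Rabs_pos (u - y)).
  apply Rle_trans with (e * Rabs l * Rabs l / 2 * Rabs (g u - g y)); [nra|].
  apply Rle_trans with (e * Rabs l / 2 * (Rabs l * Rabs (g u - g y))); [right; field|].
  apply Rle_trans with (e * Rabs l / 2 * (2 * Rabs (u - y))); [|right; field].
  apply Rmult_le_compat_l; auto. assert (0 < e * Rabs l) by now apply Rmult_lt_0_compat. lra.
Qed.

Lemma mvt_bound (f df : R -> R) (a b l e : R) :
  (forall w, Rmin a b <= w <= Rmax a b -> is_derive f w (df w) /\ Rabs (df w - l) <= e) ->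
  Rabs (f b - f a - l * (b - a)) <= e * Rabs (b - a).
Proof.
  intros H.
  assert (A : exists c, Rmin a b <= c <= Rmax a b /\ f b - f a = df c * (b - a)).
  { apply MVT_gen; intros x Hx; [|apply continuous_continuity_pt; eapply der_cont]; apply H; lra. }
  destruct A as [c [Hc ->]].
  replace (df c * (b - a) - l * (b - a)) with ((df c - l) * (b - a)) by ring.
  rewrite Rabs_mult. apply Rmult_le_compat_r; [apply Rabs_pos | now apply H].
Qed.

Lemma between (a b x d : R) : Rmin a x <= b <= Rmax a x -> Rabs (a - x) < d -> Rabs (b - x) < d.
Proof.
  intros H Hd. apply Rabs_def2 in Hd. unfold Rmin, Rmax in H. destruct (Rle_dec a x); apply Rabs_def1; lra.
Qed.

Lemma continuous_over_R (U : C -> Prop) f (x y s : R) : continuous_over U f -> U (x, y) ->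
  forall e, 0 < e -> exists d, 0 < d /\ forall a b c, Rabs (a - x) < d -> Rabs (b - y) < d -> Rabs (c - s) < d ->
    Rabs (f (a, b) c - f (x, y) s) < e.
Proof.
  intros H HU e He. destruct (H (x, y) s HU (fun w => Rabs (w - f (x, y) s) < e)) as [d Hd].
  { exists (mkposreal e He). now intros w Hw. }
  exists d. split; [apply cond_pos|]. intros a b c Ha Hb Hc. apply (Hd ((a, b), c)). repeat split; auto.
Qed.

Lemma open_R2 (U : C -> Prop) (x y : R) : open U -> U (x, y) ->
  exists d, 0 < d /\ forall a b, Rabs (a - x) < d -> Rabs (b - y) < d -> U (a, b).
Proof.
  intros HU H. destruct (HU _ H) as [d Hd]. exists d. split; [apply cond_pos|].
  intros a b Ha Hb. apply Hd. split; auto.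
Qed.

(** One coordinate is moved at a time, with the mean value inequality on each segment; continuity of
    the partial derivatives absorbs the difference between their values on the segments and at the
    base point. *)
Lemma C1_frechet (U : C -> Prop) f (x y s : R) : open U -> Ck_over 1 U f -> U (x, y) ->
  forall e, 0 < e -> exists d, 0 < d /\ forall a b c, Rabs (a - x) < d -> Rabs (b - y) < d -> Rabs (c - s) < d ->
    Rabs (f (a, b) c - f (x, y) s - (d_1 f (x, y) s * (a - x) + d_2 f (x, y) s * (b - y) + d_t f (x, y) s * (c - s)))
    <= e * (Rabs (a - x) + Rabs (b - y) + Rabs (c - s)).
Proof.
  intros HU [_ [Hex [[H1 _] [[H2 _] [H3 _]]]]] Hxy e He.
  destruct (open_R2 U x y HU Hxy) as [d0 [Hd0 K0]].
  destruct (continuous_over_R U _ x y s H1 Hxy e He) as [d1 [Hd1 K1]].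
  destruct (continuous_over_R U _ x y s H2 Hxy e He) as [d2 [Hd2 K2]].
  destruct (continuous_over_R U _ x y s H3 Hxy e He) as [d3 [Hd3 K3]].
  exists (Rmin (Rmin d0 d1) (Rmin d2 d3)). split; [repeat apply Rmin_pos; auto|].
  intros a b c Ha Hb Hc.
  assert (M : forall r, r < Rmin (Rmin d0 d1) (Rmin d2 d3) -> r < d0 /\ r < d1 /\ r < d2 /\ r < d3).
  { intros r Hr. pose proof (Rmin_l (Rmin d0 d1) (Rmin d2 d3)). pose proof (Rmin_r (Rmin d0 d1) (Rmin d2 d3)).
    pose proof (Rmin_l d0 d1). pose proof (Rmin_r d0 d1). pose proof (Rmin_l d2 d3). pose proof (Rmin_r d2 d3). lra. }
  pose proof (M _ Ha) as Ma. pose proof (M _ Hb) as Mb. pose proof (M _ Hc) as Mc.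
  assert (Z : forall v r, 0 < r -> Rabs (v - v) < r) by (intros; rewrite Rminus_diag, Rabs_R0; auto).
  assert (A1 : Rabs (f (a, y) s - f (x, y) s - d_1 f (x, y) s * (a - x)) <= e * Rabs (a - x)).
  { apply (mvt_bound (fun w => f (w, y) s) (fun w => d_1 f (w, y) s)). intros w Hw.
    rewrite Rmin_comm, Rmax_comm in Hw.
    assert (forall r, Rabs (a - x) < r -> Rabs (w - x) < r) by (intros r; now apply between).
    split; [|left; apply K1; auto; apply H; tauto].
    apply (Derive_correct (fun w => f (w, y) s)). apply (Hex (w, y) s). apply K0; auto. apply H; tauto. }
  assert (A2 : Rabs (f (a, b) s - f (a, y) s - d_2 f (x, y) s * (b - y)) <= e * Rabs (b - y)).
  { apply (mvt_bound (fun w => f (a, w) s) (fun w => d_2 f (a, w) s)). intros w Hw.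
    rewrite Rmin_comm, Rmax_comm in Hw.
    assert (forall r, Rabs (b - y) < r -> Rabs (w - y) < r) by (intros r; now apply between).
    split; [|left; apply K2; auto; try tauto; apply H; tauto].
    apply (Derive_correct (fun w => f (a, w) s)). apply (Hex (a, w) s). apply K0; try tauto. apply H; tauto. }
  assert (A3 : Rabs (f (a, b) c - f (a, b) s - d_t f (x, y) s * (c - s)) <= e * Rabs (c - s)).
  { apply (mvt_bound (fun w => f (a, b) w) (fun w => d_t f (a, b) w)). intros w Hw.
    rewrite Rmin_comm, Rmax_comm in Hw.
    assert (forall r, Rabs (c - s) < r -> Rabs (w - s) < r) by (intros r; now apply between).
    split; [|left; apply K3; auto; try tauto; apply H; tauto].
    apply (Derive_correct (fun w => f (a, b) w)). apply (Hex (a, b) w). apply K0; try tauto. }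
  match type of A1 with Rabs ?u <= _ => match type of A2 with Rabs ?v <= _ => match type of A3 with Rabs ?w <= _ =>
    match goal with |- Rabs ?g <= _ => replace g with (u + v + w) by ring end;
    pose proof (Rabs_triang (u + v) w); pose proof (Rabs_triang u v) end end end.
  lra.
Qed.

Lemma der_over (U : C -> Prop) f (x y s : R -> R) (t x1 y1 s1 : R) :
  open U -> Ck_over 1 U f -> U (x t, y t) ->
  is_derive x t x1 -> is_derive y t y1 -> is_derive s t s1 ->
  is_derive (fun u => f (x u, y u) (s u)) t
    (d_1 f (x t, y t) (s t) * x1 + d_2 f (x t, y t) (s t) * y1 + d_t f (x t, y t) (s t) * s1).
Proof.
  intros HU Hf Hxy Hx Hy Hs. apply is_derive_R. intros e He.
  set (f1 := d_1 f (x t, y t) (s t)). set (f2 := d_2 f (x t, y t) (s t)). set (f3 := d_t f (x t, y t) (s t)).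
  (* [K] bounds the increments of (x, y, s) per unit of time and [M] exceeds the sum of the absolute
     partial derivatives; the Frechet error and the errors of x, y, s get e / 2 each. *)
  set (K := Rabs x1 + Rabs y1 + Rabs s1 + 3). set (M := Rabs f1 + Rabs f2 + Rabs f3 + 1).
  assert (HK : 0 < K). { pose proof (Rabs_pos x1). pose proof (Rabs_pos y1). pose proof (Rabs_pos s1). unfold K; lra.
  }
  assert (HM : 0 < M). { pose proof (Rabs_pos f1). pose proof (Rabs_pos f2). pose proof (Rabs_pos f3). unfold M; lra.
  }
  destruct (C1_frechet U f (x t) (y t) (s t) HU Hf Hxy (e / 2 / K)) as [d0 [Hd0 F]].
  { apply Rdiv_lt_0_compat; lra. }
  assert (He2 : 0 < Rmin 1 (e / 2 / M)) by (apply Rmin_pos; [lra|apply Rdiv_lt_0_compat; lra]).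
  destruct (proj1 (is_derive_R _ _ _) Hx _ He2) as [da [Hda Fa]].
  destruct (proj1 (is_derive_R _ _ _) Hy _ He2) as [db [Hdb Fb]].
  destruct (proj1 (is_derive_R _ _ _) Hs _ He2) as [dc [Hdc Fc]].
  destruct (proj1 (continuous_R x t) (der_cont Hx) d0 Hd0) as [ea [Hea Ga]].
  destruct (proj1 (continuous_R y t) (der_cont Hy) d0 Hd0) as [eb [Heb Gb]].
  destruct (proj1 (continuous_R s t) (der_cont Hs) d0 Hd0) as [ec [Hec Gc]].
  exists (Rmin (Rmin (Rmin da db) dc) (Rmin (Rmin ea eb) ec)). split; [repeat apply Rmin_pos; auto|].
  intros u Hu.
  assert (Hm : Rabs (u - t) < da /\ Rabs (u - t) < db /\ Rabs (u - t) < dc /\ Rabs (u - t) < ea /\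
    Rabs (u - t) < eb /\ Rabs (u - t) < ec).
  { pose proof (Rmin_l (Rmin (Rmin da db) dc) (Rmin (Rmin ea eb) ec)).
    pose proof (Rmin_r (Rmin (Rmin da db) dc) (Rmin (Rmin ea eb) ec)).
    pose proof (Rmin_l (Rmin da db) dc). pose proof (Rmin_r (Rmin da db) dc). pose proof (Rmin_l da db).
    pose proof (Rmin_r da db).
    pose proof (Rmin_l (Rmin ea eb) ec). pose proof (Rmin_r (Rmin ea eb) ec). pose proof (Rmin_l ea eb).
    pose proof (Rmin_r ea eb). lra. }
  destruct Hm as (m1 & m2 & m3 & m4 & m5 & m6).
  specialize (F (x u) (y u) (s u) (Ga u m4) (Gb u m5) (Gc u m6)).
  specialize (Fa u m1). specialize (Fb u m2). specialize (Fc u m3).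
  fold f1 f2 f3 in F.
  set (h := Rabs (u - t)) in *. assert (Hh : 0 <= h) by apply Rabs_pos.
  assert (L : forall w w1, Rabs (w - w1 * (u - t)) <= Rmin 1 (e / 2 / M) * h -> Rabs w <= (Rabs w1 + 1) * h).
  { intros w w1 Hw. replace w with ((w - w1 * (u - t)) + w1 * (u - t)) by ring.
    eapply Rle_trans; [apply Rabs_triang|]. rewrite Rabs_mult. fold h.
    pose proof (Rmin_l 1 (e / 2 / M)). nra. }
  pose proof (L _ _ Fa) as La. pose proof (L _ _ Fb) as Lb. pose proof (L _ _ Fc) as Lc.
  assert (Tot : Rabs (x u - x t) + Rabs (y u - y t) + Rabs (s u - s t) <= K * h) by (unfold K; lra).
  assert (F' : e / 2 / K * (Rabs (x u - x t) + Rabs (y u - y t) + Rabs (s u - s t)) <= e / 2 * h).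
  { apply Rle_trans with (e / 2 / K * (K * h)); [|right; field; lra]. apply Rmult_le_compat_l; auto.
    left; apply Rdiv_lt_0_compat; lra. }
  set (q := e / 2 / M * h).
  assert (Hq : forall c w, Rabs w <= Rmin 1 (e / 2 / M) * h -> Rabs (c * w) <= Rabs c * q).
  { intros c w Hw. rewrite Rabs_mult. apply Rmult_le_compat_l; [apply Rabs_pos|]. unfold q.
    eapply Rle_trans; [exact Hw|]. apply Rmult_le_compat_r; auto. apply Rmin_r. }
  pose proof (Hq f1 _ Fa) as Qa. pose proof (Hq f2 _ Fb) as Qb. pose proof (Hq f3 _ Fc) as Qc.
  assert (Hq0 : 0 <= q). { unfold q. apply Rmult_le_pos; auto. left; apply Rdiv_lt_0_compat; lra. }
  assert (Tq : Rabs f1 * q + Rabs f2 * q + Rabs f3 * q <= e / 2 * h).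
  { apply Rle_trans with (M * q); [unfold M; lra|]. unfold q. right; field; lra. }
  match type of F with Rabs ?v <= _ => match type of Qa with Rabs ?a <= _ => match type of Qb
    with Rabs ?b <= _ => match type of Qc with Rabs ?c <= _ =>
    match goal with |- Rabs ?g <= _ => replace g with (v + a + b + c) by ring end;
    pose proof (Rabs_triang (v + a + b) c); pose proof (Rabs_triang (v + a) b);
      pose proof (Rabs_triang v a) end end end end.
  lra.
Qed.

(** * C^k functions of one variable on an open set *)

(** Recursion on [Derive] over an open set lets the product, quotient and chain rules be proved by
    induction on n; [Ck_ex_derive_n] and [ex_derive_n_Ck] translate to and from the pointwise notion
    [smooth_at]. *)
Fixpoint Ck (n : nat) (D : R -> Prop) (f : R -> R) : Prop :=
  (forall t, D t -> continuous f t) /\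
  match n with
  | O => True
  | S m => (forall t, D t -> ex_derive f t) /\ Ck m D (Derive f)
  end.

Lemma Ck_continuous n D f t : Ck n D f -> D t -> continuous f t.
Proof. destruct n; intros H; now apply H. Qed.

Lemma Ck_ext n D f g : open D -> (forall t, D t -> f t = g t) -> Ck n D f -> Ck n D g.
Proof.
  intros HD. revert f g. induction n as [|n IH]; intros f g Hfg [Hc H].
  - split; auto. intros t Ht. apply (continuous_ext_loc g f); [|auto].
    apply filter_imp with (2 := HD t Ht). intros; now apply Hfg.
  - split; [|split].
    + intros t Ht. apply (continuous_ext_loc g f); [|auto]. apply filter_imp with (2 := HD t Ht). now apply Hfg.
    + intros t Ht. apply ex_derive_ext_loc with f; [|now apply H]. apply filter_imp with (2 := HD t Ht).
      now apply Hfg.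
    + apply IH with (Derive f); [|apply H]. intros t Ht. apply Derive_ext_loc. apply filter_imp with (2 := HD t Ht).
      now apply Hfg.
Qed.

(** The gain of one order on which every smoothness proof below rests, in particular the bootstrap
    in [LC_Ck]. *)
Lemma Ck_step n D f g : open D -> (forall t, D t -> is_derive f t (g t)) -> Ck n D g -> Ck (S n) D f.
Proof.
  intros HD H Hg. split; [|split].
  - intros t Ht. eapply der_cont. now apply H.
  - intros t Ht. exists (g t). now apply H.
  - apply Ck_ext with g; auto. intros t Ht. symmetry. now apply is_derive_unique, H.
Qed.

Lemma Ck_derive n D f t : Ck (S n) D f -> D t -> is_derive f t (Derive f t).
Proof. intros [_ [H _]] Ht. now apply Derive_correct, H. Qed.

Lemma Ck_pred n D f : Ck (S n) D f -> Ck n D f.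
Proof.
  revert f. induction n as [|n IH]; intros f H; split; try apply H; auto.
  split; [apply H|]. apply IH, H.
Qed.

Lemma Ck_const n D c : Ck n D (fun _ => c).
Proof.
  revert c. induction n as [|n IH]; intros c; split; auto; try (intros; apply cont_const).
  split; [intros t _; exists 0; apply der_const|].
  replace (Derive (fun _ : R => c)) with (fun _ : R => 0); [apply IH|].
  apply FunctionalExtensionality.functional_extensionality. intros t. symmetry. apply is_derive_unique, der_const.
Qed.

Lemma Ck_plus n D f g : open D -> Ck n D f -> Ck n D g -> Ck n D (fun t => f t + g t).
Proof.
  intros HD. revert f g. induction n as [|n IH]; intros f g Hf Hg.
  - split; auto. intros. apply cont_plus; [now apply Hf|now apply Hg].
  - apply Ck_step with (fun t => Derive f t + Derive g t); auto.
    + intros t Ht. apply der_plus; eapply Ck_derive; eauto.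
    + apply IH; [apply Hf | apply Hg].
Qed.

Lemma Ck_mult n D f g : open D -> Ck n D f -> Ck n D g -> Ck n D (fun t => f t * g t).
Proof.
  intros HD. revert f g. induction n as [|n IH]; intros f g Hf Hg.
  - split; auto. intros. apply cont_mult; [now apply Hf|now apply Hg].
  - apply Ck_step with (fun t => Derive f t * g t + f t * Derive g t); auto.
    + intros t Ht. apply der_mult; eapply Ck_derive; eauto.
    + apply Ck_plus; auto; apply IH; try apply Hf; try apply Hg; now apply Ck_pred.
Qed.

Lemma Ck_opp n D f : open D -> Ck n D f -> Ck n D (fun t => - f t).
Proof.
  intros HD H. apply Ck_ext with (fun t => (-1) * f t); auto; [intros; ring|].
  apply Ck_mult; auto. apply Ck_const.
Qed.

Lemma Ck_minus n D f g : open D -> Ck n D f -> Ck n D g -> Ck n D (fun t => f t - g t).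
Proof. intros HD Hf Hg. apply Ck_plus; auto. now apply Ck_opp. Qed.

Lemma Ck_pow n D f k : open D -> Ck n D f -> Ck n D (fun t => f t ^ k).
Proof. intros HD Hf. induction k; simpl; [apply Ck_const | now apply Ck_mult]. Qed.

Lemma Ck_inv n D f : open D -> (forall t, D t -> f t <> 0) -> Ck n D f -> Ck n D (fun t => / f t).
Proof.
  intros HD H0. induction n as [|n IH]; intros Hf.
  - split; auto. intros. apply cont_inv; [now apply Hf|auto].
  - apply Ck_step with (fun t => - Derive f t * (/ f t) ^ 2); auto.
    + intros t Ht. eapply is_derive_eq; [apply der_inv; auto; eapply Ck_derive; eauto|]. field; auto.
    + apply Ck_mult; auto; [apply Ck_opp; auto; apply Hf|]. apply Ck_pow; auto. apply IH. now apply Ck_pred.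
Qed.

Lemma Ck_over_pred n U f : Ck_over (S n) U f -> Ck_over n U f.
Proof.
  revert f. induction n as [|n IH]; intros f H; split; try apply H; auto.
  split; [apply H|]. split; [|split]; apply IH, H.
Qed.

Lemma Ck_over_comp (U : C -> Prop) (D : R -> Prop) n f x y s : open U -> open D -> Ck_over n U f ->
  (forall t, D t -> U (x t, y t)) -> Ck n D x -> Ck n D y -> Ck n D s -> Ck n D (fun t => f (x t, y t) (s t)).
Proof.
  intros HU HD. revert f x y s. induction n as [|n IH]; intros f x y s Hf Hxy Hx Hy Hs.
  - split; auto. intros t Ht. apply (cont_over U); auto;
      [apply Hf | apply cont_pair; [now apply Hx|now apply Hy] | now apply Hs].
  - apply Ck_step with (fun t => d_1 f (x t, y t) (s t) * Derive x t + d_2 f (x t, y t) (s t) * Derive y t +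
      d_t f (x t, y t) (s t) * Derive s t); auto.
    + intros t Ht. apply (der_over U); auto; try (eapply Ck_derive; eauto).
      clear - Hf. induction n as [|n IH]; [exact Hf|]. apply IH. now apply Ck_over_pred.
    + repeat apply Ck_plus; auto; apply Ck_mult; auto; try (now apply Hx); try (now apply Hy); try (now apply Hs);
        apply IH; auto; try apply Hf; now apply Ck_pred.
Qed.

Lemma Ck_ex_derive_n n D f t : Ck n D f -> D t -> ex_derive_n f n t.
Proof.
  revert f. induction n as [|n IH]; intros f H Ht; simpl; auto.
  destruct n as [|n]; [now apply H|].
  assert (K := IH (Derive f) (proj2 (proj2 H)) Ht). simpl in K.
  apply ex_derive_ext with (2 := K). intros u. replace (S n) with (n + 1)%nat by lia. apply (Derive_n_comp f n 1).
Qed.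

Lemma ex_derive_n_Ck n D f : open D -> (forall k t, D t -> ex_derive_n f k t) -> Ck n D f.
Proof.
  intros HD. revert f. induction n as [|n IH]; intros f H.
  - split; auto. intros t Ht. apply (ex_derive_continuous f t). now apply (H 1%nat).
  - split; [|split].
    + intros t Ht. apply (ex_derive_continuous f t). now apply (H 1%nat).
    + intros t Ht. now apply (H 1%nat).
    + apply IH. intros k t Ht. destruct k; simpl; auto.
      specialize (H (S (S k)) t Ht). simpl in H. apply ex_derive_ext with (2 := H).
      intros u. symmetry. change (Derive (Derive_n f k) u) with (Derive_n f (S k) u).
      replace (S k) with (k + 1)%nat by lia. apply (Derive_n_comp f k 1).
Qed.

(** * Integrals of continuous functions *)

Lemma ex_RInt_cont (f : R -> R) a b : (forall x, continuous f x) -> ex_RInt f a b.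
Proof. intros H. apply (ex_RInt_continuous (V := R_CompleteNormedModule)). auto. Qed.
Lemma RInt_plus_cont (f g : R -> R) a b : (forall x, continuous f x) -> (forall x, continuous g x) ->
  RInt (fun t => f t + g t) a b = RInt f a b + RInt g a b.
Proof. intros. apply (RInt_plus (V := R_CompleteNormedModule) f g); now apply ex_RInt_cont. Qed.
Lemma RInt_minus_cont (f g : R -> R) a b : (forall x, continuous f x) -> (forall x, continuous g x) ->
  RInt (fun t => f t - g t) a b = RInt f a b - RInt g a b.
Proof. intros. apply (RInt_minus (V := R_CompleteNormedModule) f g); now apply ex_RInt_cont. Qed.
Lemma RInt_scal_cont (c : R) (f : R -> R) a b : (forall x, continuous f x) ->
  RInt (fun t => c * f t) a b = c * RInt f a b.
Proof. intros. apply (RInt_scal (V := R_CompleteNormedModule) f); now apply ex_RInt_cont. Qed.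
Lemma RInt_ext_all (f g : R -> R) a b : (forall t, f t = g t) -> RInt f a b = RInt g a b.
Proof. intros. apply (RInt_ext (V := R_CompleteNormedModule)). auto. Qed.
Lemma is_derive_RInt_cont (f : R -> R) a t : (forall x, continuous f x) -> is_derive (fun t => RInt f a t) t (f t).
Proof.
  intros H. apply (is_derive_RInt f (fun t => RInt f a t) a t); auto.
  apply filter_forall. intros u. apply (RInt_correct (V := R_CompleteNormedModule)). now apply ex_RInt_cont.
Qed.
Lemma is_derive_RInt_cont_l (f : R -> R) b t : (forall x, continuous f x) ->
  is_derive (fun t => RInt f t b) t (- f t).
Proof.
  intros H. apply (is_derive_RInt' f (fun t => RInt f t b) t b); auto.
  apply filter_forall. intros u. apply (RInt_correct (V := R_CompleteNormedModule)). now apply ex_RInt_cont.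
Qed.
Lemma RInt_ftc (F f : R -> R) a b : (forall x, is_derive F x (f x)) -> (forall x, continuous f x) ->
  RInt f a b = F b - F a.
Proof. intros. apply is_RInt_unique. apply (is_RInt_derive F f); auto. Qed.
Lemma RInt_Chasles_cont (f : R -> R) a b c : (forall x, continuous f x) -> RInt f a b + RInt f b c = RInt f a c.
Proof. intros. apply (RInt_Chasles (V := R_CompleteNormedModule)); now apply ex_RInt_cont. Qed.
Lemma RInt_point_R (f : R -> R) a : RInt f a a = 0.
Proof. apply (RInt_point (V := R_CompleteNormedModule) a f). Qed.

(** * Differentiation under the integral sign *)

Lemma tube (P : R -> R -> Prop) (a b : R) :
  (forall t, a <= t <= b -> exists d, 0 < d /\ forall s u, Rabs s < d -> Rabs (u - t) < d -> P s u) ->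
  exists d, 0 < d /\ forall s t, Rabs s < d -> a <= t <= b -> P s t.
Proof.
  intros H.
  assert (H' : forall t, exists d : posreal, a <= t <= b -> forall s u, Rabs s < d -> Rabs (u - t) < d -> P s u).
  { intros t. destruct (excluded_middle_informative (a <= t <= b)) as [Ht|Ht].
    - destruct (H t Ht) as [d [Hd K]]. exists (mkposreal d Hd). auto.
    - exists (mkposreal 1 Rlt_0_1). tauto. }
  pose (delta := fun t => proj1_sig (constructive_indefinite_description _ (H' t))).
  assert (Hdelta : forall t, a <= t <= b -> forall s u, Rabs s < delta t -> Rabs (u - t) < delta t -> P s u).
  { intros t. unfold delta. destruct (constructive_indefinite_description _ (H' t)) as [d K]. exact K. }
  destruct (compactness_value_1d a b delta) as [d Hd].
  exists d. split; [apply cond_pos|]. intros s t Hs Ht.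
  (* [compactness_value_1d] provides the centre u only under a double negation, hence the argument
     by contradiction. *)
  destruct (excluded_middle_informative (P s t)) as [|Hn]; auto. exfalso.
  apply (Hd t Ht). intros [u [Hu [Htu Hdu]]]. apply Hn. apply (Hdelta u Hu); auto. lra.
Qed.

(** The range -1 < t < 2 leaves a margin round [0,1]: joint continuity of the derivative is required
    on full neighbourhoods of the end points too. *)
Lemma param_int (f g : R -> R -> R) (d : R) : 0 < d ->
  (forall s t, Rabs s < d -> -1 < t < 2 -> is_derive (fun s => f s t) s (g s t)) ->
  (forall s t, Rabs s < d -> -1 < t < 2 -> continuous (fun p : R * R => g (fst p) (snd p)) (s, t)) ->
  (forall s t, Rabs s < d -> -1 < t < 2 -> continuous (f s) t) ->
  is_derive (fun s => RInt (f s) 0 1) 0 (RInt (g 0) 0 1).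
Proof.
  intros Hd Hder Hg Hf.
  assert (H0 : forall t, 0 <= t <= 1 -> is_derive (fun s => f s t) 0 (g 0 t)).
  { intros t Ht. apply Hder; [rewrite Rabs_R0; auto|lra]. }
  rewrite (RInt_ext (V := R_CompleteNormedModule) (g 0) (fun t => Derive (fun s => f s t) 0)).
  2:{ intros t Ht. rewrite Rmin_left, Rmax_right in Ht by lra. symmetry. apply is_derive_unique. apply H0; lra. }
  apply (is_derive_RInt_param f 0 1 0).
  - apply locally_R. exists d. split; auto. intros s Hs t Ht. rewrite Rmin_left, Rmax_right in Ht by lra.
    exists (g s t). apply Hder; [now rewrite Rminus_0_r in Hs|lra].
  - intros t Ht. rewrite Rmin_left, Rmax_right in Ht by lra.
    apply continuity_2d_pt_ext_loc with g.
    + assert (Hr : 0 < Rmin d 1) by (apply Rmin_pos; lra). exists (mkposreal _ Hr). simpl.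
      intros u v Hu Hv. symmetry. apply is_derive_unique. apply Hder.
      * rewrite Rminus_0_r in Hu. eapply Rlt_le_trans; [exact Hu|apply Rmin_l].
      * pose proof (Rmin_r d 1). apply Rabs_def2 in Hv. lra.
    + apply continuity_2d_pt_filterlim. apply Hg; [rewrite Rabs_R0; auto|lra].
  - apply locally_R. exists d. split; auto. intros s Hs. rewrite Rminus_0_r in Hs.
    apply (ex_RInt_continuous (V := R_CompleteNormedModule)). intros t Ht. rewrite Rmin_left, Rmax_right in Ht by lra.
    apply Hf; auto; lra.
Qed.

Lemma cont_snd (h : R -> R) (p : R * R) : continuous h (snd p) -> continuous (fun p : R * R => h (snd p)) p.
Proof. intros H. apply (continuous_comp snd h); auto. apply continuous_snd. Qed.
Lemma cont_fst1 (p : R * R) : continuous (fun p : R * R => fst p) p.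
Proof. apply continuous_fst. Qed.

Ltac cont2 := repeat first
  [ match goal with
    | |- continuous (fun p => fst p) _ => apply cont_fst1
    | |- continuous fst _ => apply cont_fst1
    | |- continuous (fun p => ?h (snd p)) _ => apply (cont_snd h); auto
    end
  | cont1 ]; auto.

(** * Complex numbers in coordinates *)

Lemma Cmod2 (w : C) : Cmod w ^ 2 = Re w ^ 2 + Im w ^ 2.
Proof. unfold Cmod. rewrite pow2_sqrt; [reflexivity|]. nra. Qed.
Lemma sq_xy (z : R -> C) t : sq z t = (Re (z t) ^ 2 - Im (z t) ^ 2, 2 * (Re (z t) * Im (z t))).
Proof. unfold sq. destruct (z t) as [a b]. simpl. apply injective_projections; simpl; ring. Qed.
Lemma C_eq (a b : C) : Re a = Re b -> Im a = Im b -> a = b.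
Proof. intros. now apply injective_projections. Qed.

Lemma L2sq (z : R -> C) : (forall t, continuous (fun s => Re (z s)) t) ->
  (forall t, continuous (fun s => Im (z s)) t) ->
  L2norm z ^ 2 = RInt (fun t => Re (z t) ^ 2 + Im (z t) ^ 2) 0 1.
Proof.
  intros Hx Hy. unfold L2norm, inner.
  rewrite (RInt_ext_all (fun t => Re (z t * Cconj (z t))%C) (fun t => Re (z t) ^ 2 + Im (z t) ^ 2)).
  2:{ intros t. destruct (z t) as [a b]; simpl. ring. }
  rewrite pow2_sqrt; auto. apply (RInt_ge_0 (fun t => Re (z t) ^ 2 + Im (z t) ^ 2)); [lra| |intros; nra].
  apply ex_RInt_cont. intros; cont.
Qed.

Definition qsq (x y : R) : C := (x ^ 2 - y ^ 2, 2 * (x * y)).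

Lemma calF_xy E A1 A2 (X Y X1 Y1 : R -> R) :
  (forall t, is_derive X t (X1 t)) -> (forall t, is_derive Y t (Y1 t)) ->
  (forall t, continuous X1 t) -> (forall t, continuous Y1 t) ->
  let N : R := RInt (fun t => X t ^ 2 + Y t ^ 2) 0 1 in
  calF E A1 A2 (fun t => (X t, Y t)) =
  2 * N * RInt (fun t => X1 t ^ 2 + Y1 t ^ 2) 0 1
  - RInt (fun t => A1 (qsq (X t) (Y t)) * (2 * (X t * X1 t - Y t * Y1 t)) + A2 (qsq (X t) (Y t)) *
      (2 * (X t * Y1 t + X1 t * Y t))) 0 1
  + / N - / N * RInt (fun t => E (qsq (X t) (Y t)) (RInt (fun t => X t ^ 2 + Y t ^ 2) 0 t / N) * (X t ^ 2 + Y t ^ 2))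
      0 1.
Proof.
  intros HX HY CX CY N.
  assert (EX : forall t, continuous X t) by (intros; eapply der_cont; apply HX).
  assert (EY : forall t, continuous Y t) by (intros; eapply der_cont; apply HY).
  unfold calF. rewrite (L2sq (fun t => (X t, Y t))) by assumption. simpl Re; simpl Im. fold N.
  assert (HC : Cderive (fun t => (X t, Y t)) = (fun t => (X1 t, Y1 t))).
  { apply FunctionalExtensionality.functional_extensionality; intros t. unfold Cderive; simpl.
    f_equal; now apply is_derive_unique. }
  rewrite HC, (L2sq (fun t => (X1 t, Y1 t))) by assumption. simpl Re; simpl Im.
  unfold calE. rewrite (L2sq (fun t => (X t, Y t))) by assumption. simpl Re; simpl Im. fold N.
  f_equal; [f_equal; f_equal|f_equal].
  - unfold line_integral. apply RInt_ext_all. intros t. rewrite sq_xy; simpl Re; simpl Im. fold (qsq (X t) (Y t)).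
    f_equal; f_equal; unfold Cderive; simpl Re; simpl Im.
    + rewrite (Derive_ext _ (fun t => X t ^ 2 - Y t ^ 2)).
      2:{ intros u. simpl; ring. }
      apply is_derive_unique. der. ring.
    + rewrite (Derive_ext _ (fun t => 2 * (X t * Y t))).
      2:{ intros u. simpl; ring. }
      apply is_derive_unique. der. ring.
  - apply RInt_ext_all. intros t. rewrite sq_xy, Cmod2; simpl Re; simpl Im. fold (qsq (X t) (Y t)). f_equal. f_equal.
    unfold t_. rewrite (L2sq (fun t => (X t, Y t))) by assumption. simpl Re; simpl Im. fold N.
    unfold Rdiv. rewrite Rmult_comm. f_equal. apply RInt_ext_all. intros u. now rewrite Cmod2.
Qed.

(** The squared norm of a perturbed loop is a polynomial in s, so that its derivative needs no
    differentiation under the integral sign and is available for every upper limit t. *)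
Lemma quad_expand (x y a b : R -> R) (s t : R) :
  (forall t, continuous x t) -> (forall t, continuous y t) -> (forall t, continuous a t) ->
    (forall t, continuous b t) ->
  RInt (fun t => (x t + s * a t) ^ 2 + (y t + s * b t) ^ 2) 0 t =
  RInt (fun t => x t ^ 2 + y t ^ 2) 0 t + 2 * s * RInt (fun t => x t * a t + y t * b t) 0 t + s ^ 2 *
    RInt (fun t => a t ^ 2 + b t ^ 2) 0 t.
Proof.
  intros Cx Cy Ca Cb. rewrite <- !RInt_scal_cont, <- !RInt_plus_cont by (intros; cont). apply RInt_ext_all.
  intros; ring.
Qed.

Lemma quad_derive (x y a b : R -> R) (s t : R) :
  (forall t, continuous x t) -> (forall t, continuous y t) -> (forall t, continuous a t) ->
    (forall t, continuous b t) ->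
  is_derive (fun s => RInt (fun t => (x t + s * a t) ^ 2 + (y t + s * b t) ^ 2) 0 t) s
    (2 * RInt (fun t => x t * a t + y t * b t) 0 t + 2 * s * RInt (fun t => a t ^ 2 + b t ^ 2) 0 t).
Proof.
  intros Cx Cy Ca Cb. eapply is_derive_ext; [intros; symmetry; apply quad_expand; assumption|].
  der. ring.
Qed.

(** * First variation of the functional *)

Section Variation.
Context (Q0 : C -> Prop) (E : C -> R -> R) (B A1 A2 : C -> R).
Context (HQ0 : open Q0) (HE : smooth_over Q0 E).
Context (HB : smooth_over Q0 (static B)) (HA1 : smooth_over Q0 (static A1)) (HA2 : smooth_over Q0 (static A2)).
Context (HdA : forall q, Q0 q -> d_1 (static A2) q 0 - d_2 (static A1) q 0 = - B q).
Context (x y a b x1 y1 a1 b1 x2 y2 : R -> R).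
Context (Dx : forall t, is_derive x t (x1 t)) (Dy : forall t, is_derive y t (y1 t)).
Context (Da : forall t, is_derive a t (a1 t)) (Db : forall t, is_derive b t (b1 t)).
Context (Dx1 : forall t, is_derive x1 t (x2 t)) (Dy1 : forall t, is_derive y1 t (y2 t)).
Context (Ca1 : forall t, continuous a1 t) (Cb1 : forall t, continuous b1 t).
Context (Cx2 : forall t, continuous x2 t) (Cy2 : forall t, continuous y2 t).
Context (HU : forall t, Q0 (qsq (x t) (y t))).

Local Lemma Cx t : continuous x t. Proof. exact (der_cont (Dx t)). Qed.
Local Lemma Cy t : continuous y t. Proof. exact (der_cont (Dy t)). Qed.
Local Lemma Ca t : continuous a t. Proof. exact (der_cont (Da t)). Qed.
Local Lemma Cb t : continuous b t. Proof. exact (der_cont (Db t)). Qed.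
Local Lemma Cx1 t : continuous x1 t. Proof. exact (der_cont (Dx1 t)). Qed.
Local Lemma Cy1 t : continuous y1 t. Proof. exact (der_cont (Dy1 t)). Qed.

#[local] Hint Resolve Cx Cy Ca Cb Cx1 Cy1 : core.

(** [E], [A1] and [A2] are controlled over [Q0] only, so the perturbed loop has to stay there for
    all small s, uniformly in t. *)
Lemma variation_in_domain : exists d, 0 < d /\ forall s t, Rabs s < d -> -1 <= t <= 2 ->
  Q0 (qsq (x t + s * a t) (y t + s * b t)).
Proof.
  apply (tube (fun s t => Q0 (qsq (x t + s * a t) (y t + s * b t)))). intros t _.
  pose (w := fun p : R * R => qsq (x (snd p) + fst p * a (snd p)) (y (snd p) + fst p * b (snd p))).
  assert (Hw : continuous w (0, t)).
  { unfold w, qsq. cont2. }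
  assert (H : locally (w (0, t)) Q0).
  { apply HQ0. unfold w; simpl. replace (x t + 0 * a t) with (x t) by ring.
    replace (y t + 0 * b t) with (y t) by ring. apply HU. }
  destruct (Hw _ H) as [d Hd]. exists d. split; [apply cond_pos|]. intros s u Hs Hu.
  apply (Hd (s, u)). split; [|exact Hu]. simpl. unfold ball; simpl; unfold AbsRing_ball, abs, minus, plus, opp; simpl.
  now rewrite Ropp_0, Rplus_0_r.
Qed.

(** Let w = z^2, with variation field dw = 2 z zeta. The s-derivative of A(w) w' differs from the
    total derivative of A(w) dw, called [F] below, by the curvature term dA(dw, w'). As dA = - B
    dq_1 dq_2 and dw, w' span 4 |z|^2 times the area spanned by zeta, z', this term is the stated
    integrand. *)
Lemma line_variation (s : R) (Hs : s ^ 2 = 1) (Bx : x 1 = s * x 0) (By : y 1 = s * y 0) (Ba : a 1 = s * a 0)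
  (Bb : b 1 = s * b 0) :
  is_derive (fun s => RInt (fun t => A1 (qsq (x t + s * a t) (y t + s * b t)) *
    (2 * ((x t + s * a t) * (x1 t + s * a1 t) - (y t + s * b t) * (y1 t + s * b1 t)))
     + A2 (qsq (x t + s * a t) (y t + s * b t)) *
         (2 * ((x t + s * a t) * (y1 t + s * b1 t) + (x1 t + s * a1 t) * (y t + s * b t)))) 0 1) 0
  (RInt (fun t => - (4 * (x t ^ 2 + y t ^ 2) * B (qsq (x t) (y t)) * (a t * y1 t - b t * x1 t))) 0 1).
Proof.
  destruct variation_in_domain as [d [Hd HU']].
  pose (w s t := qsq (x t + s * a t) (y t + s * b t)).
  pose (f s t := A1 (w s t) * (2 * ((x t + s * a t) * (x1 t + s * a1 t) - (y t + s * b t) * (y1 t + s * b1 t)))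
     + A2 (w s t) * (2 * ((x t + s * a t) * (y1 t + s * b1 t) + (x1 t + s * a1 t) * (y t + s * b t)))).
  pose (u1 s t := 2 * ((x t + s * a t) * a t - (y t + s * b t) * b t)).
  pose (u2 s t := 2 * ((x t + s * a t) * b t + a t * (y t + s * b t))).
  pose (g s t := (d_1 (static A1) (w s t) 0 * u1 s t + d_2 (static A1) (w s t) 0 * u2 s t) *
    (2 * ((x t + s * a t) * (x1 t + s * a1 t) - (y t + s * b t) * (y1 t + s * b1 t)))
     + A1 (w s t) * (2 * (a t * (x1 t + s * a1 t) + (x t + s * a t) * a1 t -
         (b t * (y1 t + s * b1 t) + (y t + s * b t) * b1 t)))
     + ((d_1 (static A2) (w s t) 0 * u1 s t + d_2 (static A2) (w s t) 0 * u2 s t) *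
         (2 * ((x t + s * a t) * (y1 t + s * b1 t) + (x1 t + s * a1 t) * (y t + s * b t)))
     + A2 (w s t) * (2 * (a t * (y1 t + s * b1 t) + (x t + s * a t) * b1 t +
         (a1 t * (y t + s * b t) + (x1 t + s * a1 t) * b t))))).
  assert (H1 : is_derive (fun s => RInt (f s) 0 1) 0 (RInt (g 0) 0 1)).
  { apply (param_int f g d Hd).
    - intros s' t Hs' Ht. assert (Hw : Q0 (w s' t)) by (apply HU'; lra || auto).
      assert (K : forall A, smooth_over Q0 (static A) ->
        is_derive (fun s => A (w s t)) s' (d_1 (static A) (w s' t) 0 * u1 s' t + d_2 (static A) (w s' t) 0 *
        u2 s' t)).
      { intros A HA. eapply is_derive_eq.
        - apply (der_over Q0 (static A) (fun s => (x t + s * a t) ^ 2 - (y t + s * b t) ^ 2)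
            (fun s => 2 * ((x t + s * a t) * (y t + s * b t))) (fun _ => 0) s' (u1 s' t) (u2 s' t) 0); auto; try der1.
          + unfold u1. der. ring.
          + unfold u2. der. ring.
        - unfold w, qsq. ring. }
      assert (W1 : is_derive (fun s => 2 * ((x t + s * a t) * (x1 t + s * a1 t) - (y t + s * b t) *
        (y1 t + s * b1 t))) s'
        (2 * (a t * (x1 t + s' * a1 t) + (x t + s' * a t) * a1 t -
          (b t * (y1 t + s' * b1 t) + (y t + s' * b t) * b1 t)))) by (der; ring).
      assert (W2 : is_derive (fun s => 2 * ((x t + s * a t) * (y1 t + s * b1 t) + (x1 t + s * a1 t) *
        (y t + s * b t))) s'
        (2 * (a t * (y1 t + s' * b1 t) + (x t + s' * a t) * b1 t +
          (a1 t * (y t + s' * b t) + (x1 t + s' * a1 t) * b t)))) by (der; ring).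
      unfold f, g. apply (der_plus (der_mult (K _ HA1) W1) (der_mult (K _ HA2) W2)).
    - intros s' t Hs' Ht. assert (Hw : Q0 (w s' t)) by (apply HU'; lra || auto).
      assert (Sw : continuous (fun p : R * R => w (fst p) (snd p)) (s', t)).
      { unfold w, qsq. cont2. }
      assert (K : forall A, continuous_over Q0 A -> continuous (fun p : R * R => A (w (fst p) (snd p)) 0) (s', t)).
      { intros A HA. apply (cont_over Q0 A (fun p : R * R => w (fst p) (snd p)) (fun _ => 0)); auto. cont. }
      assert (K1 : continuous (fun p : R * R => A1 (w (fst p) (snd p))) (s', t))
        by (apply (K (static A1)); apply (HA1 0%nat)).
      assert (K2 : continuous (fun p : R * R => A2 (w (fst p) (snd p))) (s', t))
        by (apply (K (static A2)); apply (HA2 0%nat)).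
      unfold g, u1, u2.
      cont2; apply K; solve [apply (HA1 1%nat) | apply (HA2 1%nat)].
    - intros s' t Hs' Ht. assert (Hw : Q0 (w s' t)) by (apply HU'; lra || auto).
      assert (Sw : continuous (w s') t) by (unfold w, qsq; cont).
      assert (K : forall A, smooth_over Q0 (static A) -> continuous (fun t => A (w s' t)) t).
      { intros A HA. apply (cont_over Q0 (static A) (w s') (fun _ => 0)); auto. apply (HA 0%nat). cont. }
      pose proof (K _ HA1). pose proof (K _ HA2). unfold f. cont. }
  apply (is_derive_eq H1).
  pose (F t := A1 (w 0 t) * u1 0 t + A2 (w 0 t) * u2 0 t).
  assert (HF : forall t, is_derive F t (g 0 t + 4 * (x t ^ 2 + y t ^ 2) * B (qsq (x t) (y t)) *
    (a t * y1 t - b t * x1 t))).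
  { intros t. assert (Hw : Q0 (w 0 t)).
    { unfold w. replace (x t + 0 * a t) with (x t) by ring. replace (y t + 0 * b t) with (y t) by ring. apply HU. }
    assert (K : forall A, smooth_over Q0 (static A) ->
      is_derive (fun t => A (w 0 t)) t (d_1 (static A) (w 0 t) 0 * (2 * (x t * x1 t - y t * y1 t)) +
      d_2 (static A) (w 0 t) 0 * (2 * (x t * y1 t + x1 t * y t)))).
    { intros A HA. eapply is_derive_eq.
      - apply (der_over Q0 (static A) (fun t => (x t + 0 * a t) ^ 2 - (y t + 0 * b t) ^ 2)
          (fun t => 2 * ((x t + 0 * a t) * (y t + 0 * b t))) (fun _ => 0) t (2 * (x t * x1 t - y t * y1 t))
          (2 * (x t * y1 t + x1 t * y t)) 0); auto; try der1; der; ring.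
      - unfold w, qsq. ring. }
    assert (U1 : is_derive (u1 0) t (2 * (x1 t * a t + x t * a1 t - (y1 t * b t + y t * b1 t))))
      by (unfold u1; der; ring).
    assert (U2 : is_derive (u2 0) t (2 * (x1 t * b t + x t * b1 t + (a1 t * y t + a t * y1 t))))
      by (unfold u2; der; ring).
    unfold F. eapply is_derive_eq; [apply (der_plus (der_mult (K _ HA1) U1) (der_mult (K _ HA2) U2))|].
    - pose proof (HdA _ Hw) as HB'. replace (qsq (x t) (y t)) with (w 0 t) by (unfold w; f_equal; ring).
      replace (B (w 0 t)) with (d_2 (static A1) (w 0 t) 0 - d_1 (static A2) (w 0 t) 0) by lra.
      unfold g, u1, u2. ring. }
  assert (CB : forall t, continuous (fun t => B (qsq (x t) (y t))) t).
  { intros t. apply (cont_over Q0 (static B) (fun t => qsq (x t) (y t)) (fun _ => 0)); auto;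
      [apply (HB 0%nat)| unfold qsq; cont | cont]. }
  assert (Cg : forall t, continuous (g 0) t).
  { intros t. assert (Hw : Q0 (w 0 t)).
    { unfold w. replace (x t + 0 * a t) with (x t) by ring. replace (y t + 0 * b t) with (y t) by ring. apply HU. }
    assert (Sw : continuous (w 0) t) by (unfold w, qsq; cont).
    assert (K : forall A, continuous_over Q0 A -> continuous (fun t => A (w 0 t) 0) t).
    { intros A HA. apply (cont_over Q0 A (w 0) (fun _ => 0)); auto. cont. }
    assert (K1 : continuous (fun t => A1 (w 0 t)) t) by (apply (K (static A1)); apply (HA1 0%nat)).
    assert (K2 : continuous (fun t => A2 (w 0 t)) t) by (apply (K (static A2)); apply (HA2 0%nat)).
    unfold g, u1, u2. cont; apply K; solve [apply (HA1 1%nat) | apply (HA2 1%nat)]. }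
  assert (K := RInt_ftc F _ 0 1 HF ltac:(intros; cont)).
  rewrite RInt_plus_cont in K by (intros; cont).
  replace (F 1 - F 0) with 0 in K.
  (* The boundary terms agree because w and its variation are quadratic in (z, zeta): they carry the
     factor s^2 = 1, in the twisted case too. *)
  2:{ unfold F, u1, u2, w, qsq. rewrite Bx, By, Ba, Bb.
      replace ((s * x 0 + 0 * (s * a 0)) ^ 2 - (s * y 0 + 0 * (s * b 0)) ^ 2)
        with (s ^ 2 * (x 0 ^ 2 - y 0 ^ 2)) by ring.
      replace (2 * ((s * x 0 + 0 * (s * a 0)) * (s * y 0 + 0 * (s * b 0)))) with (s ^ 2 * (2 * (x 0 * y 0))) by ring.
      replace ((x 0 + 0 * a 0) ^ 2 - (y 0 + 0 * b 0) ^ 2) with (s ^ 2 * (x 0 ^ 2 - y 0 ^ 2)) by (rewrite Hs; ring).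
      replace (2 * ((x 0 + 0 * a 0) * (y 0 + 0 * b 0))) with (s ^ 2 * (2 * (x 0 * y 0))) by (rewrite Hs; ring).
      replace (2 * ((s * x 0 + 0 * (s * a 0)) * (s * a 0) - (s * y 0 + 0 * (s * b 0)) * (s * b 0)))
        with (s ^ 2 * (2 * (x 0 * a 0 - y 0 * b 0))) by ring.
      replace (2 * ((s * x 0 + 0 * (s * a 0)) * (s * b 0) + s * a 0 * (s * y 0 + 0 * (s * b 0))))
        with (s ^ 2 * (2 * (x 0 * b 0 + a 0 * y 0))) by ring.
      rewrite Hs. ring. }
  rewrite (RInt_ext_all (fun t => - (4 * (x t ^ 2 + y t ^ 2) * B (qsq (x t) (y t)) * (a t * y1 t - b t * x1 t)))
    (fun t => (-1) * (4 * (x t ^ 2 + y t ^ 2) * B (qsq (x t) (y t)) * (a t * y1 t - b t * x1 t)))) by (intros; ring).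
  rewrite RInt_scal_cont by (intros; cont). change (fun x0 => g 0 x0) with (g 0) in K. lra.
Qed.

(** The loop enters through the position, through the weight |z|^2 and through the normalized time.
    The time contributes the terms with [m t] and [m 1], the latter from the division by the
    perturbed norm. *)
Lemma energy_variation :
  let N : R := RInt (fun t => x t ^ 2 + y t ^ 2) 0 1 in let T : R -> R :=
    fun t => RInt (fun t => x t ^ 2 + y t ^ 2) 0 t / N in
  let m : R -> R := fun t => RInt (fun t => x t * a t + y t * b t) 0 t in
  0 < N ->
  is_derive (fun s => RInt (fun t => E (qsq (x t + s * a t) (y t + s * b t))
      (RInt (fun t => (x t + s * a t) ^ 2 + (y t + s * b t) ^ 2) 0 t / RInt
        (fun t => (x t + s * a t) ^ 2 + (y t + s * b t) ^ 2) 0 1)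
      * ((x t + s * a t) ^ 2 + (y t + s * b t) ^ 2)) 0 1) 0
  (RInt (fun t => (d_1 E (qsq (x t) (y t)) (T t) * (2 * (x t * a t - y t * b t)) + d_2 E (qsq (x t) (y t)) (T t) *
    (2 * (x t * b t + a t * y t))
     + d_t E (qsq (x t) (y t)) (T t) * (2 * m t / N - T t * (2 * m 1) / N)) * (x t ^ 2 + y t ^ 2) +
         E (qsq (x t) (y t)) (T t) * (2 * (x t * a t + y t * b t))) 0 1).
Proof.
  intros N T m HN.
  destruct variation_in_domain as [d [Hd HU']].
  pose (w s t := qsq (x t + s * a t) (y t + s * b t)).
  pose (r s t := (x t + s * a t) ^ 2 + (y t + s * b t) ^ 2).
  pose (m0 t := (RInt (fun t => x t ^ 2 + y t ^ 2) 0 t) : R).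
  pose (m2 t := (RInt (fun t => a t ^ 2 + b t ^ 2) 0 t) : R).
  pose (M s t := m0 t + 2 * s * m t + s ^ 2 * m2 t).
  assert (EM : forall s t, RInt (fun t => (x t + s * a t) ^ 2 + (y t + s * b t) ^ 2) 0 t = M s t)
    by (intros; now apply quad_expand).
  assert (Cm0 : forall t, continuous m0 t) by (intros; eapply der_cont; unfold m0;
    apply (is_derive_RInt_cont (fun t => x t ^ 2 + y t ^ 2)); intros; cont).
  assert (Cm : forall t, continuous m t) by (intros; eapply der_cont; unfold m;
    apply (is_derive_RInt_cont (fun t => x t * a t + y t * b t)); intros; cont).
  assert (Cm2 : forall t, continuous m2 t) by (intros; eapply der_cont; unfold m2;
    apply (is_derive_RInt_cont (fun t => a t ^ 2 + b t ^ 2)); intros; cont).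
  assert (HM : exists d', 0 < d' /\ forall s, Rabs s < d' -> M s 1 <> 0).
  { assert (C : continuous (fun s => M s 1) 0) by (unfold M; cont).
    destruct (proj1 (continuous_R _ _) C N HN) as [d' [Hd' K]]. exists d'; split; auto. intros s Hs H.
    assert (Hs' : Rabs (s - 0) < d') by now rewrite Rminus_0_r. specialize (K s Hs'). rewrite H in K.
    assert (EQ : M 0 1 = N) by (unfold M, N, m0; ring). rewrite EQ in K.
    rewrite Rminus_0_l, Rabs_Ropp, Rabs_right in K; lra. }
  destruct HM as [d' [Hd' HM]].
  pose (f s t := E (w s t) (M s t / M s 1) * r s t).
  pose (u1 s t := 2 * ((x t + s * a t) * a t - (y t + s * b t) * b t)).
  pose (u2 s t := 2 * ((x t + s * a t) * b t + a t * (y t + s * b t))).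
  pose (u3 s t := (2 * m t + 2 * s * m2 t) / M s 1 - M s t * (2 * m 1 + 2 * s * m2 1) / M s 1 ^ 2).
  pose (g s t := (d_1 E (w s t) (M s t / M s 1) * u1 s t + d_2 E (w s t) (M s t / M s 1) * u2 s t +
    d_t E (w s t) (M s t / M s 1) * u3 s t) * r s t
     + E (w s t) (M s t / M s 1) * (2 * ((x t + s * a t) * a t + (y t + s * b t) * b t))).
  assert (Hm : forall s, Rabs s < Rmin d d' -> Rabs s < d /\ Rabs s < d').
  { intros s. pose proof (Rmin_l d d'). pose proof (Rmin_r d d'). lra. }
  assert (H1 : is_derive (fun s => RInt (f s) 0 1) 0 (RInt (g 0) 0 1)).
  { apply (param_int f g (Rmin d d')); [apply Rmin_pos; auto| | |]; intros s' t Hs' Ht; apply Hm in Hs';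
      destruct Hs' as [Hs1 Hs2];
      assert (Hw : Q0 (w s' t)) by (apply HU'; lra || auto); specialize (HM s' Hs2).
    - assert (W3 : is_derive (fun s => M s t / M s 1) s' (u3 s' t)).
      { unfold M in *. der. unfold u3, M. field. auto. }
      assert (K := der_over Q0 E (fun s => (x t + s * a t) ^ 2 - (y t + s * b t) ^ 2)
        (fun s => 2 * ((x t + s * a t) * (y t + s * b t))) (fun s => M s t / M s 1)
        s' (u1 s' t) (u2 s' t) (u3 s' t) HQ0 (HE 1%nat) Hw ltac:(unfold u1; der; ring) ltac:(unfold u2; der; ring)
          W3).
      assert (W4 : is_derive (fun s => r s t) s' (2 * ((x t + s' * a t) * a t + (y t + s' * b t) * b t)))
        by (unfold r; der; ring).
      unfold f, g. apply (der_mult K W4).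
    - assert (Sw : continuous (fun p : R * R => w (fst p) (snd p)) (s', t)) by (unfold w, qsq; cont2).
      assert (SM : continuous (fun p : R * R => M (fst p) (snd p) / M (fst p) 1) (s', t)) by (unfold M; cont2).
      assert (K : forall A, continuous_over Q0 A ->
        continuous (fun p : R * R => A (w (fst p) (snd p)) (M (fst p) (snd p) / M (fst p) 1)) (s', t)).
      { intros A HA. apply (cont_over Q0 A (fun p : R * R => w (fst p) (snd p))
          (fun p => M (fst p) (snd p) / M (fst p) 1)); auto. }
      pose proof (K _ (proj1 (HE 0%nat))) as K0.
      pose proof (K _ (proj1 (proj1 (proj2 (proj2 (HE 1%nat)))))) as K1.
      pose proof (K _ (proj1 (proj1 (proj2 (proj2 (proj2 (HE 1%nat))))))) as K2.
      pose proof (K _ (proj1 (proj2 (proj2 (proj2 (proj2 (HE 1%nat))))))) as K3.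
      assert (SM2 : continuous (fun p : R * R => u3 (fst p) (snd p)) (s', t)).
      { unfold u3, M. cont2. apply (pow_nonzero (M s' 1) 2 HM). }
      unfold g. unfold u1, u2, r. cont2.
    - assert (Sw : continuous (w s') t) by (unfold w, qsq; cont).
      assert (SM : continuous (fun t => M s' t / M s' 1) t) by (unfold M in *; cont).
      pose proof (cont_over Q0 E (w s') (fun t => M s' t / M s' 1) t (proj1 (HE 0%nat)) Hw Sw SM). unfold f, r. cont.
      }
  assert (EM1 : M 0 1 = N) by (unfold M, N, m0; ring).
  assert (EM2 : forall t, M 0 t / M 0 1 = T t) by (intros; rewrite EM1; unfold M, T, m0; field; lra).
  eapply is_derive_ext; [|apply (is_derive_eq H1)].
  - intros s. apply RInt_ext_all. intros t. unfold f, w, r. now rewrite !EM.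
  - apply RInt_ext_all. intros t. unfold g. rewrite EM2.
    replace (w 0 t) with (qsq (x t) (y t)) by (unfold w; f_equal; ring).
    replace (u3 0 t) with (2 * m t / N - T t * (2 * m 1) / N).
    2:{ unfold u3. replace (M 0 t) with (T t * N) by (rewrite <- EM2, EM1; field; lra). rewrite EM1. field. lra. }
    unfold u1, u2, r. ring.
Qed.

(** Integration by parts frees the variation field from derivatives and inner integrals, so that
    everything becomes a pairing with (a, b). Taking out the factor 4 N gives z'' the coefficient
    -1, and the kernel is then the defect of the delay equation. *)
Lemma first_variation_xy (s : R) (Hs : s ^ 2 = 1) (Bx : x 1 = s * x 0) (By : y 1 = s * y 0) (Ba : a 1 = s * a 0)
  (Bb : b 1 = s * b 0)
  (Bx1 : x1 1 = s * x1 0) (By1 : y1 1 = s * y1 0) :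
  let r := fun t => x t ^ 2 + y t ^ 2 in
  let N : R := RInt r 0 1 in
  let T : R -> R := fun t => RInt r 0 t / N in
  let w := fun t => qsq (x t) (y t) in
  let J : R -> R := fun t => RInt (fun t => d_t E (w t) (T t) * r t) t 1 in
  let al : R := RInt (fun t => x1 t ^ 2 + y1 t ^ 2) 0 1 / N +
    (RInt (fun t => E (w t) (T t) * r t) 0 1 / N + RInt (fun t => T t * (d_t E (w t) (T t) * r t)) 0 1 / N) /
    (2 * N ^ 2) - / (2 * N ^ 3) in
  0 < N ->
  is_derive (fun s => calF E A1 A2 (fun t => (x t + s * a t, y t + s * b t))) 0
   (4 * N * RInt (fun t =>
     (- (J t * x t / N + r t * (d_1 E (w t) (T t) * x t + d_2 E (w t) (T t) * y t) + E (w t) (T t) * x t) /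
       (2 * N ^ 2) + r t * B (w t) / N * y1 t + al * x t - x2 t) * a t
     + (- (J t * y t / N + r t * (d_2 E (w t) (T t) * x t - d_1 E (w t) (T t) * y t) + E (w t) (T t) * y t) /
         (2 * N ^ 2) - r t * B (w t) / N * x1 t + al * y t - y2 t) * b t) 0 1).
Proof.
  intros r N T w J al HN.
  assert (radius_cont : forall t, continuous r t) by (intros; unfold r; cont).
  assert (CT : forall t, continuous T t).
  { intros; eapply der_cont. unfold T. apply (@der_mult (fun t => RInt r 0 t) (fun _ => / N));
      [now apply is_derive_RInt_cont|apply der_const]. }
  assert (Cw : forall t, continuous w t) by (intros; unfold w, qsq; cont).
  assert (KE : forall A, continuous_over Q0 A -> forall t, continuous (fun t => A (w t) (T t)) t).
  { intros A HA t. apply (cont_over Q0 A w T); auto. apply HU. }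
  pose proof (KE _ (proj1 (HE 0%nat))) as C0.
  pose proof (KE _ (proj1 (proj1 (proj2 (proj2 (HE 1%nat)))))) as C1.
  pose proof (KE _ (proj1 (proj1 (proj2 (proj2 (proj2 (HE 1%nat))))))) as C2.
  pose proof (KE _ (proj1 (proj2 (proj2 (proj2 (proj2 (HE 1%nat))))))) as C3.
  assert (CB : forall t, continuous (fun t => B (w t)) t).
  { intros t. apply (cont_over Q0 (static B) w (fun _ => 0)); auto; [apply (HB 0%nat)| apply HU| cont]. }
  assert (Cg : forall t, continuous (fun t => d_t E (w t) (T t) * r t) t) by (intros; cont).
  assert (CJ : forall t, continuous J t) by (intros; eapply der_cont; unfold J;
    apply (is_derive_RInt_cont_l (fun t => d_t E (w t) (T t) * r t)); auto).
  pose (m := fun t : R => RInt (fun t => x t * a t + y t * b t) 0 t : R).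
  assert (Cp : forall t, continuous (fun t => x t * a t + y t * b t) t) by (intros; cont).
  assert (Dm : forall t, is_derive m t (x t * a t + y t * b t))
    by (intros; unfold m; apply (is_derive_RInt_cont (fun t => x t * a t + y t * b t)); auto).
  assert (Cm : forall t, continuous m t) by (intros; eapply der_cont; apply Dm).
  pose (c := m 1).
  pose (Q := (RInt (fun t => (d_1 E (w t) (T t) * (x t * a t - y t * b t) + d_2 E (w t) (T t) *
    (x t * b t + a t * y t)) * r t + E (w t) (T t) * (x t * a t + y t * b t)) 0 1) : R).
  pose (G := (RInt (fun t => J t * (x t * a t + y t * b t)) 0 1) : R).
  pose (BB := (RInt (fun t => r t * B (w t) * (a t * y1 t - b t * x1 t)) 0 1) : R).
  pose (X2 := (RInt (fun t => x2 t * a t + y2 t * b t) 0 1) : R).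
  (* z' and zeta are multiplied by the same sign over a period, so the boundary terms cancel. *)
  assert (e1 : RInt (fun t => x1 t * a1 t + y1 t * b1 t) 0 1 = - X2).
  { assert (K : RInt (fun t => (x1 t * a1 t + y1 t * b1 t) + (x2 t * a t + y2 t * b t)) 0 1 =
      (x1 1 * a 1 + y1 1 * b 1) - (x1 0 * a 0 + y1 0 * b 0)).
    { apply (RInt_ftc (fun t => x1 t * a t + y1 t * b t)); intros; [der; ring|cont]. }
    rewrite RInt_plus_cont in K by (intros; cont). fold X2 in K. rewrite Bx1, By1, Ba, Bb in K.
    replace (s * x1 0 * (s * a 0) + s * y1 0 * (s * b 0)) with (s ^ 2 * (x1 0 * a 0 + y1 0 * b 0)) in K by ring.
    rewrite Hs in K. lra. }
  (* The inner integral [m] of the varied time is moved onto the tail integral [J]. No boundary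
     terms appear because m 0 = 0 and J 1 = 0. This is the origin of the nonlocal term [eps1]. *)
  assert (e2 : RInt (fun t => (d_t E (w t) (T t) * r t) * m t) 0 1 = G).
  { assert (K : RInt (fun t => J t * (x t * a t + y t * b t) - (d_t E (w t) (T t) * r t) * m t) 0 1 = m 1 * J 1 -
      m 0 * J 0).
    { apply (RInt_ftc (fun t => m t * J t)); intros; [|cont].
      eapply is_derive_eq; [apply der_mult; [apply Dm|unfold J;
        now apply (is_derive_RInt_cont_l (fun t => d_t E (w t) (T t) * r t))]|]. fold (J x0); ring. }
    rewrite RInt_minus_cont in K by (intros; cont). unfold J at 2 in K. unfold m at 3 in K.
    rewrite !RInt_point_R in K. fold G in K. lra. }
  assert (dN := quad_derive x y a b 0 1 Cx Cy Ca Cb).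
  assert (dD := quad_derive x1 y1 a1 b1 0 1 Cx1 Cy1 Ca1 Cb1).
  assert (dL := line_variation s Hs Bx By Ba Bb).
  assert (dE := energy_variation HN).
  assert (N0 : RInt (fun t => (x t + 0 * a t) ^ 2 + (y t + 0 * b t) ^ 2) 0 1 = N)
    by (apply RInt_ext_all; intros; unfold r; ring).
  eapply is_derive_ext.
  { intros u. symmetry. apply (calF_xy E A1 A2 (fun t => x t + u * a t) (fun t => y t + u * b t)
      (fun t => x1 t + u * a1 t) (fun t => y1 t + u * b1 t)).
    - intros t. der. ring.
    - intros t. der. ring.
    - intros; cont.
    - intros; cont. }
  eapply is_derive_eq.
  { apply der_minus; [apply der_plus; [apply der_minus;
      [apply der_mult; [apply der_mult; [apply der_const|exact dN]|exact dD] | exact dL]|]|].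
    - apply der_inv; [exact dN|]. rewrite N0. lra.
    - apply der_mult; [apply der_inv; [exact dN|rewrite N0; lra]|exact dE]. }
  cbv beta. rewrite !N0.
  change (RInt (fun t : R => x t * a t + y t * b t) 0 1) with c.
  assert (D0 : RInt (fun t => (x1 t + 0 * a1 t) ^ 2 + (y1 t + 0 * b1 t) ^ 2) 0 1 =
    RInt (fun t => x1 t ^ 2 + y1 t ^ 2) 0 1) by (apply RInt_ext_all; intros; ring).
  rewrite D0, e1.
  set (D := (RInt (fun t => x1 t ^ 2 + y1 t ^ 2) 0 1) : R) in *.
  set (I0 := (RInt (fun t => E (w t) (T t) * r t) 0 1) : R) in *.
  set (I1 := (RInt (fun t => T t * (d_t E (w t) (T t) * r t)) 0 1) : R) in *.
  (* These are the integrals of [energy_variation], still carrying s = 0. The first is [I0]; the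
     second splits into the local part [Q], the delayed part [G] and the part [I1] due to the
     normalization of time. *)
  match goal with |- context [(- (2 * c + 2 * 0 * ?v) / N ^ 2) * RInt ?f 0 1 + / N * RInt ?g 0 1] =>
    replace (RInt f 0 1) with I0; [replace (RInt g 0 1) with (2 * Q + 2 / N * G - 2 * c / N * I1) |] end.
  2:{ unfold Q, I1. rewrite <- e2. rewrite <- !RInt_scal_cont, <- RInt_plus_cont, <- RInt_minus_cont
      by (intros; cont). apply RInt_ext_all. intros t.
      change (RInt (fun t => x t ^ 2 + y t ^ 2) 0 t / RInt (fun t => x t ^ 2 + y t ^ 2) 0 1) with (T t).
      change (RInt (fun t => x t ^ 2 + y t ^ 2) 0 1) with N.
      change (RInt (fun t => x t * a t + y t * b t) 0 t) with (m t).
      change (x t ^ 2 + y t ^ 2) with (r t). fold (w t). field. lra. }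
  2:{ apply RInt_ext_all. intros t. replace (RInt (fun t => (x t + 0 * a t) ^ 2 + (y t + 0 * b t) ^ 2) 0 t)
      with (RInt r 0 t) by (apply RInt_ext_all; intros; unfold r; ring).
      fold (T t). unfold w, r. f_equal; [f_equal; f_equal|]; ring. }
  replace (RInt (fun t => - (4 * (x t ^ 2 + y t ^ 2) * B (qsq (x t) (y t)) * (a t * y1 t - b t * x1 t))) 0 1)
    with (-4 * BB).
  2:{ unfold BB. rewrite <- RInt_scal_cont by (intros; cont). apply RInt_ext_all. intros t. fold (w t). unfold r.
    ring. }
  match goal with |- _ = 4 * N * ?g => replace g with (- / (2 * N ^ 2) * (/ N * G + Q) + / N * BB + al * c - X2) end.
  2:{ unfold Q, G, BB, c, m, X2. rewrite <- RInt_scal_cont, <- RInt_plus_cont, <- !RInt_scal_cont,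
      <- !RInt_plus_cont, <- RInt_minus_cont by (intros; cont).
      apply RInt_ext_all. intros t. field. lra. }
  unfold al. field. lra.
Qed.
End Variation.

(** * The fundamental lemma of the calculus of variations *)

Lemma pow_unbounded (q c K : R) : 1 < q -> 0 < c -> exists n, K < c * q ^ n.
Proof.
  intros Hq Hc. destruct (Pow_x_infinity q) with (b := K / c + 1) as [n Hn].
  { rewrite Rabs_right; lra. }
  exists n. specialize (Hn n (le_n n)). rewrite Rabs_right in Hn by (left; apply pow_lt; lra).
  apply Rmult_lt_reg_r with (/ c); [now apply Rinv_0_lt_compat|].
  replace (c * q ^ n * / c) with (q ^ n) by (field; lra). unfold Rdiv in Hn. lra.
Qed.

Lemma cos_bound_far (d u : R) : 0 < d -> d <= Rabs u <= 1 - d -> cos (2 * PI * u) <= cos (2 * PI * d).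
Proof.
  intros Hd Hu. pose proof PI_RGT_0.
  assert (E : cos (2 * PI * u) = cos (2 * PI * Rabs u)).
  { unfold Rabs. destruct (Rcase_abs u); auto. rewrite <- cos_neg. f_equal; ring. }
  rewrite E. set (v := Rabs u) in *.
  destruct (Rle_dec v (1 / 2)).
  - apply cos_decr_1; nra.
  - replace (cos (2 * PI * v)) with (cos (2 * PI * (1 - v))).
    + apply cos_decr_1; nra.
    + replace (2 * PI * (1 - v)) with (- (2 * PI * v) + 2 * PI) by ring.
      rewrite cos_plus, cos_2PI, sin_2PI, cos_neg. ring.
Qed.

Lemma cos_bound_near (d u : R) : Rabs u <= d -> d <= 1 / 2 -> cos (2 * PI * d) <= cos (2 * PI * u).
Proof.
  intros Hu Hd. pose proof PI_RGT_0. pose proof (Rabs_pos u).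
  assert (E : cos (2 * PI * u) = cos (2 * PI * Rabs u)).
  { unfold Rabs. destruct (Rcase_abs u); auto. rewrite <- cos_neg. f_equal; ring. }
  rewrite E. apply cos_decr_1; nra.
Qed.

(* Powers of a trigonometric polynomial exceeding 1 only near [t0] modulo 1 replace compactly supported bumps. *)
Lemma trig_bump (h : R -> R) (t0 : R) : (forall t, continuous h t) -> 0 < t0 < 1 -> 0 < h t0 ->
  exists c n, 0 < RInt (fun t => h t * (1 + cos (2 * PI * (t - t0)) - c) ^ (2 * n)) 0 1.
Proof.
  intros Hc Ht0 H0. pose proof PI_RGT_0.
  destruct (proj1 (continuous_R _ _) (Hc t0) (h t0 / 2) ltac:(lra)) as [d1 [Hd1 Hnear]].
  (* The bound by d1 / 2 keeps h above h t0 / 2 on the peak; the other two keep every t in [0,1]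
     within 1 - d of t0, so that the interval meets no other peak of the periodic function. *)
  pose (d := Rmin (d1 / 2) (Rmin t0 (1 - t0))).
  assert (Hd : 0 < d /\ d < d1 /\ d <= t0 /\ d <= 1 - t0).
  { unfold d. pose proof (Rmin_l (d1 / 2) (Rmin t0 (1 - t0))). pose proof (Rmin_r (d1 / 2) (Rmin t0 (1 - t0))).
    pose proof (Rmin_l t0 (1 - t0)). pose proof (Rmin_r t0 (1 - t0)). split; [|lra]. repeat apply Rmin_pos; lra. }
  clearbody d. destruct Hd as (Hd & Hdd1 & Hdt & Hdt').
  destruct (continuity_ab_maj (fun t => Rabs (h t)) 0 1 ltac:(lra)) as [m [Hm _]].
  { intros t _. apply continuous_continuity_pt. cont. }
  pose (K := Rabs (h m)). fold K in Hm. assert (HK : 0 <= K) by apply Rabs_pos.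
  pose (c := cos (2 * PI * d)). pose (p t := 1 + cos (2 * PI * (t - t0)) - c).
  pose (q := 1 + cos (2 * PI * (d / 2)) - c).
  assert (Hq : 1 < q).
  { unfold q, c. assert (cos (2 * PI * d) < cos (2 * PI * (d / 2))) by (apply cos_decreasing_1; nra). lra. }
  (* The peak of width d contributes at least d (h t0 / 2) q^(2n), while the rest of the interval
     loses at most K. *)
  destruct (pow_unbounded (q ^ 2) (d * (h t0 / 2)) K) as [n Hn]; [nra|apply Rmult_lt_0_compat; lra|].
  exists c, n.
  assert (Cp : forall t, continuous (fun t => h t * p t ^ (2 * n)) t).
  { intros t. unfold p. cont. apply (continuous_comp (fun t => 2 * PI * (t - t0)) cos); [cont|].
    apply continuous_cos. }
  change (0 < RInt (fun t => h t * p t ^ (2 * n)) 0 1).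
  assert (Hp0 : forall t, 0 <= p t ^ (2 * n)) by (intros; rewrite pow_mult; apply pow_le; nra).
  (* At distance d or more from t0 the base lies in [-1, 1], so its even powers are at most 1. *)
  assert (Hlow : forall t, 0 <= t <= 1 -> - K <= h t * p t ^ (2 * n)).
  { intros t Ht. destruct (Rlt_dec (Rabs (t - t0)) d) as [Hin|Hout].
    - specialize (Hnear t ltac:(lra)). apply Rabs_def2 in Hnear. specialize (Hp0 t).
      assert (0 <= h t * p t ^ (2 * n)) by (apply Rmult_le_pos; lra). lra.
    - assert (Hfar : d <= Rabs (t - t0) <= 1 - d).
      { split; [lra|]. apply Rabs_le; lra. }
      assert (p t ^ (2 * n) <= 1).
      { rewrite pow_mult. rewrite <- (pow1 n). apply pow_incr. split; [nra|].
        assert (p t <= 1) by (unfold p, c; pose proof (cos_bound_far d (t - t0) Hd Hfar); lra).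
        assert (-1 <= p t) by (unfold p, c; pose proof (COS_bound (2 * PI * (t - t0)));
          pose proof (COS_bound (2 * PI * d)); lra).
        nra. }
      specialize (Hm t Ht). specialize (Hp0 t). pose proof (Rle_abs (- h t)). rewrite Rabs_Ropp in *.
      assert (Rabs (h t) * p t ^ (2 * n) <= K * 1) by (apply Rmult_le_compat; auto; apply Rabs_pos).
      assert (- h t * p t ^ (2 * n) <= Rabs (h t) * p t ^ (2 * n)) by (apply Rmult_le_compat_r; auto; lra). nra. }
  assert (Hmid : forall t, t0 - d / 2 <= t <= t0 + d / 2 -> h t0 / 2 * (q ^ 2) ^ n <= h t * p t ^ (2 * n)).
  { intros t Ht. assert (Ha : Rabs (t - t0) <= d / 2) by (apply Rabs_le; lra).
    specialize (Hnear t ltac:(lra)). apply Rabs_def2 in Hnear.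
    assert (q <= p t) by (unfold q, p; pose proof (cos_bound_near (d / 2) (t - t0) Ha ltac:(lra)); lra).
    apply Rmult_le_compat; try lra.
    - left. apply pow_lt. nra.
    - rewrite pow_mult. apply pow_incr. split; nra. }
  rewrite <- (RInt_Chasles_cont _ 0 (t0 - d / 2) 1), <- (RInt_Chasles_cont _ (t0 - d / 2) (t0 + d / 2) 1) by auto.
  assert (Hcst : forall k a b, RInt (fun _ : R => k) a b = (b - a) * k)
    by (intros; apply (RInt_const (V := R_CompleteNormedModule))).
  assert (A1 : (t0 - d / 2 - 0) * (- K) <= RInt (fun t => h t * p t ^ (2 * n)) 0 (t0 - d / 2)).
  { rewrite <- Hcst. apply RInt_le; [lra|apply ex_RInt_cont; intros; cont|apply ex_RInt_cont; auto|].
    intros; apply Hlow; lra. }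
  assert (A2 : (t0 + d / 2 - (t0 - d / 2)) * (h t0 / 2 * (q ^ 2) ^ n) <= RInt (fun t => h t * p t ^ (2 * n))
    (t0 - d / 2) (t0 + d / 2)).
  { rewrite <- Hcst. apply RInt_le; [lra|apply ex_RInt_cont; intros; cont|apply ex_RInt_cont; auto|].
    intros; apply Hmid; lra. }
  assert (A3 : (1 - (t0 + d / 2)) * (- K) <= RInt (fun t => h t * p t ^ (2 * n)) (t0 + d / 2) 1).
  { rewrite <- Hcst. apply RInt_le; [lra|apply ex_RInt_cont; intros; cont|apply ex_RInt_cont; auto|].
    intros; apply Hlow; lra. }
  assert (d * K >= 0) by nra.
  nra.
Qed.

Lemma open_true : open (fun _ : R => True).
Proof. intros t _. apply filter_true. Qed.

(** Both functions are treated at once because combinations of them with one frequency are closed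
    under differentiation. *)
Lemma Ck_cos_sin (n : nat) (c d k l : R) : Ck n (fun _ => True) (fun t => k * cos (c * t + d) + l * sin (c * t + d)).
Proof.
  revert k l. induction n as [|n IH]; intros k l.
  - split; auto. intros t _. cont; [apply (continuous_comp (fun t => c * t + d) cos) | apply
      (continuous_comp (fun t => c * t + d) sin)]; try cont.
    apply continuous_cos. apply continuous_sin.
  - eapply Ck_step; [apply open_true| |exact (IH (c * l) (- c * k))]. intros t _.
    assert (L : is_derive (fun t => c * t + d) t c) by (der; ring).
    pose proof (der_comp cos (fun t => c * t + d) t _ c (is_derive_cos (c * t + d)) L) as H1.
    pose proof (der_comp sin (fun t => c * t + d) t _ c (is_derive_sin (c * t + d)) L) as H2.
    eapply is_derive_eq; [apply (der_plus (der_mult (der_const k t) H1) (der_mult (der_const l t) H2))|].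
    ring.
Qed.

Lemma smooth_Ck (x y : R -> R) : (forall n, Ck n (fun _ => True) x) -> (forall n, Ck n (fun _ => True) y) ->
  smooth (fun t => (x t, y t)).
Proof. intros Hx Hy t n. split; simpl; apply (Ck_ex_derive_n n (fun _ => True)); auto. Qed.
Lemma Ck_smooth (z : R -> C) n : smooth z -> Ck n (fun _ => True) (fun t => Re (z t)) /\
  Ck n (fun _ => True) (fun t => Im (z t)).
Proof. intros H. split; apply ex_derive_n_Ck; try apply open_true; intros k t _; apply (H t k). Qed.

(* [s = 1] is the untwisted and [s = -1] the twisted case *)
Lemma variational_lemma (s : R) (f g : R -> R) : s = 1 \/ s = -1 -> (forall t, continuous f t) ->
  (forall t, continuous g t) ->
  (forall a b, (forall n, Ck n (fun _ => True) a) -> (forall n, Ck n (fun _ => True) b) ->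
     (forall t, a (t + 1) = s * a t) -> (forall t, b (t + 1) = s * b t) ->
       RInt (fun t => f t * a t + g t * b t) 0 1 = 0) ->
  forall t, 0 < t < 1 -> f t = 0 /\ g t = 0.
Proof.
  intros Hs Cf Cg H t0 Ht0.
  (* [e] carries the sign over a period and the bump does the localization: a constant for s = 1, a
     cosine of half the frequency for s = -1. *)
  assert (Hcos : exists e : R -> R, (forall n, Ck n (fun _ => True) e) /\ (forall t, e (t + 1) = s * e t) /\
    e t0 = 1).
  { destruct Hs as [-> | ->].
    - exists (fun _ => 1). repeat split; intros; [apply Ck_const|ring].
    - exists (fun t => cos (PI * t + - (PI * t0))). split; [|split].
      + intros n. apply Ck_ext with (3 := Ck_cos_sin n PI (- (PI * t0)) 1 0); [apply open_true|]. intros; ring.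
      + intros t. replace (PI * (t + 1) + - (PI * t0)) with ((PI * t + - (PI * t0)) + PI) by ring. rewrite neg_cos.
        ring.
      + replace (PI * t0 + - (PI * t0)) with 0 by ring. apply cos_0. }
  destruct Hcos as [e [Ce [Pe Et0]]].
  destruct (Req_dec (f t0 ^ 2 + g t0 ^ 2) 0) as [E0|E0].
  { split; nra. }
  exfalso.
  assert (Ce' : forall t, continuous e t) by (intros t; apply (Ck_continuous 0 (fun _ => True) e); auto).
  (* Testing in the fixed direction (f t0, g t0) makes the integrand at t0 equal to f^2 + g^2 >
     0. *)
  destruct (trig_bump (fun t => f t * (f t0 * e t) + g t * (g t0 * e t)) t0) as [c [n Hn]]; auto.
  - intros; cont.
  - rewrite Et0. nra.
  - pose (p := fun t => (1 + cos (2 * PI * (t - t0)) - c) ^ (2 * n)).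
    assert (Pp : forall t, p (t + 1) = p t).
    { intros t. unfold p. do 3 f_equal. replace (2 * PI * (t + 1 - t0))
        with (2 * PI * (t - t0) + 2 * INR 1 * PI) by (simpl; ring). apply cos_period. }
    assert (Cp : forall k, Ck k (fun _ => True) p).
    { intros k. unfold p. apply Ck_pow; [apply open_true|]. apply Ck_minus; [apply open_true| |apply Ck_const].
      apply Ck_plus; [apply open_true|apply Ck_const|].
      apply Ck_ext with (3 := Ck_cos_sin k (2 * PI) (- (2 * PI * t0)) 1 0); [apply open_true|]. intros t _.
      rewrite Rmult_0_l, Rplus_0_r, Rmult_1_l. f_equal. ring. }
    specialize (H (fun t => f t0 * e t * p t) (fun t => g t0 * e t * p t)).
    rewrite (RInt_ext_all _ (fun t => f t * (f t0 * e t * p t) + g t * (g t0 * e t * p t))) in Hn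
      by (intros; unfold p; ring).
    rewrite H in Hn; try lra.
    + intros k. apply Ck_mult; auto using open_true. apply Ck_mult; auto using open_true, Ck_const.
    + intros k. apply Ck_mult; auto using open_true. apply Ck_mult; auto using open_true, Ck_const.
    + intros t. rewrite Pe, Pp. ring.
    + intros t. rewrite Pe, Pp. ring.
Qed.

(** * The delay equation as a gradient *)

Record smooth_data (Q0 : C -> Prop) (E : C -> R -> R) (B A1 A2 : C -> R) : Prop := {
  sd_open : open Q0;
  sd_E : smooth_over Q0 E;
  sd_per : forall q t, Q0 q -> E q (t + 1) = E q t;
  sd_B : smooth_over Q0 (static B);
  sd_A1 : smooth_over Q0 (static A1);
  sd_A2 : smooth_over Q0 (static A2);
  sd_dA : forall q, Q0 q -> d_1 (static A2) q 0 - d_2 (static A1) q 0 = - B q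
}.

Arguments sd_open {Q0 E B A1 A2} _.
Arguments sd_E {Q0 E B A1 A2} _.
Arguments sd_per {Q0 E B A1 A2} _.
Arguments sd_B {Q0 E B A1 A2} _.
Arguments sd_A1 {Q0 E B A1 A2} _.
Arguments sd_A2 {Q0 E B A1 A2} _.
Arguments sd_dA {Q0 E B A1 A2} _.

(* nrm = ||z||^2, tm = t_z, Jm = the tail integral in eps_1,
  multiplier = the coefficient of z in the delay equation *)
Definition nrm (x y : R -> R) : R := RInt (fun t => x t ^ 2 + y t ^ 2) 0 1.
Definition tm (x y : R -> R) (t : R) : R := RInt (fun t => x t ^ 2 + y t ^ 2) 0 t / nrm x y.
Definition gE (E : C -> R -> R) (x y : R -> R) (t : R) : R :=
  d_t E (qsq (x t) (y t)) (tm x y t) * (x t ^ 2 + y t ^ 2).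
Definition Jm (E : C -> R -> R) (x y : R -> R) (t : R) : R := RInt (gE E x y) t 1.
Definition multiplier (E : C -> R -> R) (x y x1 y1 : R -> R) : R :=
  RInt (fun t => x1 t ^ 2 + y1 t ^ 2) 0 1 / nrm x y
  + (RInt (fun t => E (qsq (x t) (y t)) (tm x y t) * (x t ^ 2 + y t ^ 2)) 0 1 / nrm x y
     + RInt (fun t => tm x y t * gE E x y t) 0 1 / nrm x y) / (2 * nrm x y ^ 2) - / (2 * nrm x y ^ 3).

(* real and imaginary part of (right-hand side) - (left-hand side) of the delay equation *)
Definition delay_defect_x E B (x y x1 y1 x2 : R -> R) (t : R) : R :=
  let N := nrm x y in let w := qsq (x t) (y t) in let T := tm x y t in let r := x t ^ 2 + y t ^ 2 in
  - (Jm E x y t * x t / N + r * (d_1 E w T * x t + d_2 E w T * y t) + E w T * x t) / (2 * N ^ 2) + r * B w / N *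
      y1 t + multiplier E x y x1 y1 * x t - x2 t.
Definition delay_defect_y E B (x y x1 y1 y2 : R -> R) (t : R) : R :=
  let N := nrm x y in let w := qsq (x t) (y t) in let T := tm x y t in let r := x t ^ 2 + y t ^ 2 in
  - (Jm E x y t * y t / N + r * (d_2 E w T * x t - d_1 E w T * y t) + E w T * y t) / (2 * N ^ 2) - r * B w / N *
      x1 t + multiplier E x y x1 y1 * y t - y2 t.

Lemma first_variation_sum {Q0 E B A1 A2} (HD : smooth_data Q0 E B A1 A2) (x y a b x1 y1 a1 b1 x2 y2 : R -> R)
  (s : R) :
  (forall t, is_derive x t (x1 t)) -> (forall t, is_derive y t (y1 t)) ->
  (forall t, is_derive a t (a1 t)) -> (forall t, is_derive b t (b1 t)) ->
  (forall t, is_derive x1 t (x2 t)) -> (forall t, is_derive y1 t (y2 t)) ->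
  (forall t, continuous a1 t) -> (forall t, continuous b1 t) ->
  (forall t, continuous x2 t) -> (forall t, continuous y2 t) ->
  (forall t, Q0 (qsq (x t) (y t))) -> s ^ 2 = 1 ->
  x 1 = s * x 0 -> y 1 = s * y 0 -> a 1 = s * a 0 -> b 1 = s * b 0 -> x1 1 = s * x1 0 -> y1 1 = s * y1 0 ->
    0 < nrm x y ->
  is_derive (fun s => calF E A1 A2 (fun t => (x t + s * a t, y t + s * b t))) 0
    (4 * nrm x y * RInt (fun t => delay_defect_x E B x y x1 y1 x2 t * a t + delay_defect_y E B x y x1 y1 y2 t * b t)
      0 1).
Proof.
  intros. destruct HD.
  exact (first_variation_xy Q0 E B A1 A2 sd_open0 sd_E0 sd_B0 sd_A3 sd_A4 sd_dA0 x y a b x1 y1 a1 b1 x2 y2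
    ltac:(assumption) ltac:(assumption) ltac:(assumption) ltac:(assumption) ltac:(assumption) ltac:(assumption)
      ltac:(assumption) ltac:(assumption) ltac:(assumption) ltac:(assumption)
    ltac:(assumption) s ltac:(assumption) ltac:(assumption) ltac:(assumption) ltac:(assumption) ltac:(assumption)
      ltac:(assumption) ltac:(assumption) ltac:(assumption)).
Qed.

Lemma smooth_cont_over Q0 E : smooth_over Q0 E ->
  continuous_over Q0 E /\ continuous_over Q0 (d_1 E) /\ continuous_over Q0 (d_2 E) /\ continuous_over Q0 (d_t E).
Proof.
  intros HE. destruct (HE 1%nat) as [H0 [_ [[H1 _] [[H2 _] [H3 _]]]]]. auto.
Qed.

Lemma cont_tm (x y : R -> R) t : (forall t, continuous x t) -> (forall t, continuous y t) -> continuous (tm x y) t.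
Proof.
  intros Cx Cy. apply (@der_cont _ t ((x t ^ 2 + y t ^ 2) * / nrm x y + RInt (fun t => x t ^ 2 + y t ^ 2) 0 t * 0)).
  unfold tm.
  apply (@der_mult (fun t => RInt (fun t => x t ^ 2 + y t ^ 2) 0 t) (fun _ => / nrm x y)); [|apply der_const].
  apply (is_derive_RInt_cont (fun t => x t ^ 2 + y t ^ 2)). intros; cont.
Qed.

Lemma cont_along Q0 A (x y s : R -> R) t : continuous_over Q0 A -> (forall t, continuous x t) ->
  (forall t, continuous y t) ->
  (forall t, continuous s t) -> (forall t, Q0 (qsq (x t) (y t))) -> continuous (fun t => A (qsq (x t) (y t)) (s t)) t.
Proof.
  intros HA Cx Cy Cs HU. apply (cont_over Q0 A (fun t => qsq (x t) (y t)) s); auto. unfold qsq. cont.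
Qed.

Lemma cont_gE Q0 E (x y : R -> R) t : smooth_over Q0 E -> (forall t, continuous x t) -> (forall t, continuous y t) ->
  (forall t, Q0 (qsq (x t) (y t))) -> continuous (gE E x y) t.
Proof.
  intros HE Cx Cy HU. unfold gE. apply cont_mult; [|cont].
  apply (cont_along Q0); auto; [apply (smooth_cont_over _ _ HE)|]. intros; now apply cont_tm.
Qed.

Lemma delay_xy Q0 E B (z : R -> C) t : smooth_over Q0 E -> (forall t, Q0 (sq z t)) -> smooth z -> L2norm z <> 0 ->
  let x := fun t => Re (z t) in let y := fun t => Im (z t) in
  delay_equation E B z t <->
  delay_defect_x E B x y (Derive x) (Derive y) (Derive (Derive x)) t = 0 /\
    delay_defect_y E B x y (Derive x) (Derive y) (Derive (Derive y)) t = 0.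
Proof.
  intros HE HQ Hz H0 x y.
  assert (C0 : forall n, Ck n (fun _ => True) x /\ Ck n (fun _ => True) y) by (intros; now apply Ck_smooth).
  assert (Cx : forall t, continuous x t) by (intros u; apply (Ck_continuous 0 (fun _ => True)); auto; apply C0).
  assert (Cy : forall t, continuous y t) by (intros u; apply (Ck_continuous 0 (fun _ => True)); auto; apply C0).
  assert (Cx1 : forall t, continuous (Derive x) t)
    by (intros u; apply (Ck_continuous 0 (fun _ => True)); auto; apply (C0 1%nat)).
  assert (Cy1 : forall t, continuous (Derive y) t)
    by (intros u; apply (Ck_continuous 0 (fun _ => True)); auto; apply (C0 1%nat)).
  assert (EN : L2norm z ^ 2 = nrm x y) by (apply (L2sq z); assumption).
  assert (EN1 : L2norm (Cderive z) ^ 2 = RInt (fun t => Derive x t ^ 2 + Derive y t ^ 2) 0 1)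
    by (apply (L2sq (Cderive z)); assumption).
  assert (ET : forall t, t_ z t = tm x y t).
  { intros u. unfold t_, tm. rewrite EN. unfold Rdiv. rewrite Rmult_comm. f_equal. apply RInt_ext_all. intros v.
    apply Cmod2. }
  assert (E4 : L2norm z ^ 4 = nrm x y ^ 2) by (rewrite <- EN; ring).
  assert (E6 : L2norm z ^ 6 = nrm x y ^ 3) by (rewrite <- EN; ring).
  assert (HN : nrm x y <> 0) by (rewrite <- EN; now apply pow_nonzero).
  assert (Ew : forall t, sq z t = qsq (x t) (y t)) by (intros u; apply sq_xy).
  assert (EcE : calE E z = RInt (fun t => E (qsq (x t) (y t)) (tm x y t) * (x t ^ 2 + y t ^ 2)) 0 1 / nrm x y).
  { unfold calE. rewrite EN. unfold Rdiv. rewrite Rmult_comm. f_equal. apply RInt_ext_all. intros u.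
    now rewrite Ew, ET, Cmod2. }
  (* The inner integral of [calE1] is ||z||^2 t_z, which lowers the prefactor from ||z||^(-4) to
     ||z||^(-2). *)
  assert (EcE1 : calE1 E z = RInt (fun t => tm x y t * gE E x y t) 0 1 / nrm x y).
  { unfold calE1. rewrite E4.
    replace (RInt (fun t => tm x y t * gE E x y t) 0 1)
      with (/ nrm x y * RInt (fun t => nrm x y * tm x y t * gE E x y t) 0 1).
    - replace (/ nrm x y * RInt (fun t => nrm x y * tm x y t * gE E x y t) 0 1 / nrm x y)
        with (/ nrm x y ^ 2 * RInt (fun t => nrm x y * tm x y t * gE E x y t) 0 1) by (field; auto).
      f_equal. apply RInt_ext_all. intros u. rewrite Ew, ET, Cmod2. fold (x u) (y u).
      replace (RInt (fun s => Cmod (z s) ^ 2) 0 u) with (nrm x y * tm x y u).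
      + unfold gE. ring.
      + unfold tm. replace (RInt (fun s => Cmod (z s) ^ 2) 0 u) with (RInt (fun t => x t ^ 2 + y t ^ 2) 0 u);
          [field; auto|].
        apply RInt_ext_all. intros v. symmetry. apply Cmod2.
    - transitivity (/ nrm x y * (nrm x y * RInt (fun t => tm x y t * gE E x y t) 0 1)); [f_equal|field; auto].
      rewrite (RInt_ext_all _ (fun t => nrm x y * (tm x y t * gE E x y t))) by (intros; ring).
      apply RInt_scal_cont. intros u. apply cont_mult; [now apply cont_tm|]. apply (cont_gE Q0); auto. intros v.
      rewrite <- Ew. apply HQ. }
  unfold delay_equation, eps, eps1, eps2, eps3, grad. rewrite E4, E6, EN, EN1, EcE, EcE1, ET, Ew, Cmod2.
  rewrite (RInt_ext_all _ (gE E x y)) by (intros u; unfold gE; now rewrite ET, Ew, Cmod2). fold (Jm E x y t).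
  change (Cderive (Cderive z) t) with ((Derive (Derive x) t, Derive (Derive y) t) : C).
  change (Cderive z t) with ((Derive x t, Derive y t) : C).
  replace (z t) with ((x t, y t) : C) by (unfold x, y; now destruct (z t)).
  unfold delay_defect_x, delay_defect_y. simpl Re. simpl Im.
  set (w := qsq (x t) (y t)). set (T := tm x y t). set (r := x t ^ 2 + y t ^ 2).
  set (J := Jm E x y t).
  assert (EM : multiplier E x y (Derive x) (Derive y) =
    RInt (fun t => Derive x t ^ 2 + Derive y t ^ 2) 0 1 / nrm x y +
      (RInt (fun t => E (qsq (x t) (y t)) (tm x y t) * (x t ^ 2 + y t ^ 2)) 0 1 / nrm x y
     + RInt (fun t => tm x y t * gE E x y t) 0 1 / nrm x y) / (2 * nrm x y ^ 2) - / (2 * nrm x y ^ 3)) by reflexivity.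
  rewrite <- EM. set (al := multiplier E x y (Derive x) (Derive y)). clearbody w T r J al. set (N := nrm x y) in *.
  clearbody N.
  split.
  - intros H. assert (H1 := f_equal Re H). assert (H2 := f_equal Im H). simpl in H1, H2. split.
    + rewrite H1. field. auto.
    + rewrite H2. field. auto.
  - intros [H1 H2]. apply C_eq; simpl; apply Rminus_diag_uniq_sym;
      [eapply eq_trans; [|exact H1]|eapply eq_trans; [|exact H2]]; field; auto.
Qed.

(** * The regularized equation *)

Notation Cinf f := (forall n, Ck n (fun _ => True) f).

(* The Levi-Civita regularized equation for z = x + i y with energy k, in time u with dt/du = |z|^2 / N:
   2 N^2 z'' = - 2 N |z|^2 B i z' - |z|^2 (grad E) conj z + k z. *)
Record LC (Q0 : C -> Prop) (E : C -> R -> R) (B : C -> R) (N : R) (x y x1 y1 t k : R -> R) : Prop := {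
  lc_N : 0 < N;
  lc_U : forall u, Q0 (qsq (x u) (y u));
  lc_x : forall u, is_derive x u (x1 u);
  lc_y : forall u, is_derive y u (y1 u);
  lc_x1 : forall u, is_derive x1 u ((2 * N * (x u ^ 2 + y u ^ 2) * B (qsq (x u) (y u)) * y1 u
     - (x u ^ 2 + y u ^ 2) * (d_1 E (qsq (x u) (y u)) (t u) * x u + d_2 E (qsq (x u) (y u)) (t u) * y u) + k u * x u)
         / (2 * N ^ 2));
  lc_y1 : forall u, is_derive y1 u ((- (2 * N * (x u ^ 2 + y u ^ 2) * B (qsq (x u) (y u)) * x1 u)
     - (x u ^ 2 + y u ^ 2) * (d_2 E (qsq (x u) (y u)) (t u) * x u - d_1 E (qsq (x u) (y u)) (t u) * y u) + k u * y u)
         / (2 * N ^ 2));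
  lc_t : forall u, is_derive t u ((x u ^ 2 + y u ^ 2) / N);
  lc_t0 : t 0 = 0;
  lc_t1 : forall u, t (u + 1) = t u + 1;
  lc_k : forall u, is_derive k u (- (d_1 E (qsq (x u) (y u)) (t u) * (2 * (x u * x1 u - y u * y1 u)) +
    d_2 E (qsq (x u) (y u)) (t u) * (2 * (x u * y1 u + x1 u * y u))));
  lc_energy : forall u, 2 * N ^ 2 * (x1 u ^ 2 + y1 u ^ 2) - 1 = (x u ^ 2 + y u ^ 2) * k u
}.

Arguments lc_N {Q0 E B N x y x1 y1 t k} _.
Arguments lc_U {Q0 E B N x y x1 y1 t k} _.
Arguments lc_x {Q0 E B N x y x1 y1 t k} _.
Arguments lc_y {Q0 E B N x y x1 y1 t k} _.
Arguments lc_x1 {Q0 E B N x y x1 y1 t k} _.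
Arguments lc_y1 {Q0 E B N x y x1 y1 t k} _.
Arguments lc_t {Q0 E B N x y x1 y1 t k} _.
Arguments lc_t0 {Q0 E B N x y x1 y1 t k} _.
Arguments lc_t1 {Q0 E B N x y x1 y1 t k} _.
Arguments lc_k {Q0 E B N x y x1 y1 t k} _.
Arguments lc_energy {Q0 E B N x y x1 y1 t k} _.

Definition sign_periodic (s : R) (f : R -> R) : Prop := forall t, f (t + 1) = s * f t.

Lemma shift_derive (f : R -> R) (t l : R) : is_derive f (t + 1) l -> is_derive (fun u => f (u + 1)) t l.
Proof.
  intros H. assert (L : is_derive (fun u => u + 1) t 1) by (der; ring).
  eapply is_derive_eq; [apply (der_comp f (fun u => u + 1) t l 1 H L)|ring].
Qed.

Lemma sign_periodic_derive s f f1 : (forall t, is_derive f t (f1 t)) -> sign_periodic s f -> sign_periodic s f1.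
Proof.
  intros Hd Hs t.
  assert (H1 : is_derive (fun u => f (u + 1)) t (f1 (t + 1))) by (apply shift_derive, Hd).
  assert (H2 : is_derive (fun u => s * f u) t (s * f1 t))
    by (eapply is_derive_eq; [apply (@der_mult (fun _ => s) f t 0 (f1 t) (der_const s t) (Hd t))|ring]).
  rewrite <- (is_derive_unique _ _ _ H1). rewrite (Derive_ext _ (fun u => s * f u)) by apply Hs.
  apply is_derive_unique, H2.
Qed.

Lemma periodic_ext (P : R -> Prop) : (forall t, P t <-> P (t + 1)) -> (forall t, 0 <= t < 1 -> P t) -> forall t, P t.
Proof.
  intros H H0.
  assert (K : forall n t, - INR n <= t < INR n + 1 -> P t).
  { induction n as [|n IH]; intros t Ht.
    - apply H0. simpl in Ht. lra.
    - rewrite S_INR in Ht. destruct (Rlt_dec t (- INR n)).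
      + apply (proj2 (H t)). apply IH. pose proof (pos_INR n). lra.
      + destruct (Rlt_dec t (INR n + 1)); [apply IH; lra|].
        replace t with ((t - 1) + 1) by ring. apply (proj1 (H (t - 1))). apply IH. pose proof (pos_INR n). lra. }
  intros t. destruct (INR_unbounded (Rabs t)) as [n Hn]. apply (K n). apply Rabs_def2 in Hn. lra.
Qed.

Lemma eq_of_not_ne (a b : R) : ~ a <> b -> a = b.
Proof. intros H. destruct (Req_dec a b); tauto. Qed.

Section Data.
Context {Q0 : C -> Prop} {E : C -> R -> R} {B A1 A2 : C -> R} (HD : smooth_data Q0 E B A1 A2).

Lemma d_t_per q t : Q0 q -> d_t E q (t + 1) = d_t E q t.
Proof.
  intros Hq. destruct (sd_E HD 1%nat) as [_ [Hex _]].
  assert (H : is_derive (fun s => E q s) (t + 1) (d_t E q (t + 1)))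
    by (apply (Derive_correct (fun s => E q s)), Hex, Hq).
  apply shift_derive in H. apply is_derive_unique in H. rewrite <- H. unfold d_t. apply Derive_ext. intros s.
  now apply (sd_per HD).
Qed.
Lemma d_1_per q t : Q0 q -> d_1 E q (t + 1) = d_1 E q t.
Proof.
  intros Hq. unfold d_1. apply Derive_ext_loc. destruct q as [a b].
  destruct (open_R2 Q0 a b (sd_open HD) Hq) as [d [Hd K]]. apply locally_R. exists d; split; auto.
  intros u Hu. apply (sd_per HD). apply K; auto. simpl. now rewrite Rminus_diag, Rabs_R0.
Qed.
Lemma d_2_per q t : Q0 q -> d_2 E q (t + 1) = d_2 E q t.
Proof.
  intros Hq. unfold d_2. apply Derive_ext_loc. destruct q as [a b].
  destruct (open_R2 Q0 a b (sd_open HD) Hq) as [d [Hd K]]. apply locally_R. exists d; split; auto.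
  intros u Hu. apply (sd_per HD). apply K; auto. simpl. now rewrite Rminus_diag, Rabs_R0.
Qed.

Lemma partials_smooth n : Ck_over n Q0 E /\ Ck_over n Q0 (d_1 E) /\ Ck_over n Q0 (d_2 E) /\ Ck_over n Q0 (d_t E).
Proof.
  pose proof (sd_E HD) as HE. split; [apply HE|]. destruct (HE (S n)) as [_ [_ H]]. exact H.
Qed.

Lemma Ck_along (x y s : R -> R) n A D : open D -> Ck_over n Q0 A -> Ck n D x -> Ck n D y -> Ck n D s ->
  (forall t, Q0 (qsq (x t) (y t))) -> Ck n D (fun t => A (qsq (x t) (y t)) (s t)).
Proof.
  intros HO HA Hx Hy Hs HU. unfold qsq.
  apply (Ck_over_comp Q0 D n A (fun t => x t ^ 2 - y t ^ 2)
    (fun t => 2 * (x t * y t)) s (sd_open HD) HO HA (fun t _ => HU t)); auto.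
  - apply Ck_minus; auto; now apply Ck_pow.
  - apply Ck_mult; auto. apply Ck_const. now apply Ck_mult.
Qed.

(** The variational lemma needs continuous defects; their differentiability serves in
    [mean_power_zero], at the ends of the period. *)
Lemma Ck_defects (x y : R -> R) : Cinf x -> Cinf y -> (forall t, Q0 (qsq (x t) (y t))) ->
  Cinf (tm x y) /\ Cinf (gE E x y) /\ Cinf (Jm E x y) /\
  Cinf (delay_defect_x E B x y (Derive x) (Derive y) (Derive (Derive x))) /\
    Cinf (delay_defect_y E B x y (Derive x) (Derive y) (Derive (Derive y))).
Proof.
  intros Hx Hy HU. pose proof open_true as OT.
  assert (Cx : forall t, continuous x t) by (intros t; apply (Ck_continuous 0 (fun _ => True)); auto).
  assert (Cy : forall t, continuous y t) by (intros t; apply (Ck_continuous 0 (fun _ => True)); auto).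
  assert (Hr : Cinf (fun t => x t ^ 2 + y t ^ 2)) by (intros n; apply Ck_plus; auto; apply Ck_pow; auto).
  assert (HT : Cinf (tm x y)).
  { intros n. apply Ck_pred. apply Ck_step with (fun t => (x t ^ 2 + y t ^ 2) * / nrm x y); auto.
    - intros t _. unfold tm. eapply is_derive_eq.
      + apply (@der_mult (fun t => RInt (fun t => x t ^ 2 + y t ^ 2) 0 t)
          (fun _ => / nrm x y) t (x t ^ 2 + y t ^ 2) 0); [|apply der_const].
        apply (is_derive_RInt_cont (fun t => x t ^ 2 + y t ^ 2)). intros; cont.
      + ring.
    - apply Ck_mult; auto. apply Ck_const. }
  assert (Hg : Cinf (gE E x y)).
  { intros n. unfold gE. apply Ck_mult; auto. apply Ck_along; auto. apply partials_smooth. }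
  assert (HJ : Cinf (Jm E x y)).
  { intros n. apply Ck_pred. apply Ck_step with (fun t => - gE E x y t); auto.
    - intros t _. apply is_derive_RInt_cont_l. intros u. apply (Ck_continuous 0 (fun _ => True)); auto.
    - apply Ck_opp; auto. }
  assert (HB : Cinf (fun t => B (qsq (x t) (y t)))).
  { intros n. apply (Ck_along x y (fun _ => 0) n (static B)); auto; [apply (sd_B HD)|apply Ck_const]. }
  assert (HE0 : Cinf (fun t => E (qsq (x t) (y t)) (tm x y t)))
    by (intros n; apply Ck_along; auto; apply partials_smooth).
  assert (HE1 : Cinf (fun t => d_1 E (qsq (x t) (y t)) (tm x y t)))
    by (intros n; apply Ck_along; auto; apply partials_smooth).
  assert (HE2 : Cinf (fun t => d_2 E (qsq (x t) (y t)) (tm x y t)))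
    by (intros n; apply Ck_along; auto; apply partials_smooth).
  assert (D1 : forall f, Cinf f -> Cinf (Derive f)) by (intros f Hf n; apply (Hf (S n))).
  split; [exact HT|]. split; [exact Hg|]. split; [exact HJ|].
  split; intros n; unfold delay_defect_x, delay_defect_y, Rdiv;
  repeat first [ apply HE0 | apply HE1 | apply HE2 | apply HJ | apply HB | apply Hx | apply Hy | apply Hr | apply
    (D1 _ Hx) | apply (D1 _ Hy) | apply (D1 _ (D1 _ Hx)) | apply (D1 _ (D1 _ Hy))
    | apply Ck_const | apply Ck_minus; [exact OT| |] | apply Ck_plus; [exact OT| |] | apply Ck_mult;
      [exact OT| |] | apply Ck_opp; [exact OT|] ].
Qed.

Lemma line_perturb (z zeta : R -> C) (s : R) :
  (fun t => z t + s * zeta t)%C = (fun t => (Re (z t) + s * Re (zeta t), Im (z t) + s * Im (zeta t)) : C).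
Proof.
  apply FunctionalExtensionality.functional_extensionality. intros t. destruct (z t), (zeta t).
  apply C_eq; simpl; ring.
Qed.

Lemma loop_nrm (z : R -> C) : loop Q0 z -> 0 < nrm (fun t => Re (z t)) (fun t => Im (z t)).
Proof.
  intros [Hz [_ HN]].
  assert (C0 := fun n => Ck_smooth z n Hz).
  assert (EN : L2norm z ^ 2 = nrm (fun t => Re (z t)) (fun t => Im (z t))).
  { apply (L2sq z); intros t; apply (Ck_continuous 0 (fun _ => True)); auto; apply C0. }
  rewrite <- EN. assert (0 < L2norm z ^ 2 \/ 0 = L2norm z ^ 2) as [H|H] by (pose proof (pow2_ge_0 (L2norm z)); lra);
    auto.
  symmetry in H. apply (pow_nonzero (L2norm z) 2) in HN. contradiction.
Qed.

Lemma critical_defects (s : R) (z : R -> C) : s = 1 \/ s = -1 -> loop Q0 z ->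
  let x := fun t => Re (z t) in let y := fun t => Im (z t) in
  sign_periodic s x -> sign_periodic s y ->
  (forall zeta, smooth zeta -> sign_periodic s (fun t => Re (zeta t)) -> sign_periodic s (fun t => Im (zeta t)) ->
    is_differential (calF E A1 A2) z zeta 0) <->
  (forall t, 0 <= t <= 1 -> delay_defect_x E B x y (Derive x) (Derive y) (Derive (Derive x)) t = 0 /\
    delay_defect_y E B x y (Derive x) (Derive y) (Derive (Derive y)) t = 0).
Proof.
  intros Hs Hl x y Px Py. pose proof (loop_nrm z Hl) as HN. fold x y in HN. destruct Hl as [Hz [HQ _]].
  assert (C0 := fun n => Ck_smooth z n Hz). assert (Hx : Cinf x) by apply C0. assert (Hy : Cinf y) by apply C0.
  assert (HU : forall t, Q0 (qsq (x t) (y t))) by (intros t; specialize (HQ t); rewrite sq_xy in HQ; exact HQ).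
  destruct (Ck_defects x y Hx Hy HU) as (HT & Hg & HJ & Hdx & Hdy).
  assert (Hs2 : s ^ 2 = 1) by (destruct Hs as [-> | ->]; ring).
  assert (DD : forall f, Cinf f -> forall t, is_derive f t (Derive f t))
    by (intros f Hf t; apply (Ck_derive 0 (fun _ => True)); auto).
  assert (D1 : forall f, Cinf f -> Cinf (Derive f)) by (intros f Hf n; apply (Hf (S n))).
  assert (CC : forall f, Cinf f -> forall t, continuous f t)
    by (intros f Hf t; apply (Ck_continuous 0 (fun _ => True)); auto).
  pose proof (sign_periodic_derive s x _ (DD x Hx) Px) as Px1.
  pose proof (sign_periodic_derive s y _ (DD y Hy) Py) as Py1.
  assert (per1 : forall f, sign_periodic s f -> f 1 = s * f 0) by (intros f Hf; rewrite <- (Hf 0); f_equal; ring).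
  set (dx := delay_defect_x E B x y (Derive x) (Derive y) (Derive (Derive x))) in *.
  set (dy := delay_defect_y E B x y (Derive x) (Derive y) (Derive (Derive y))) in *.
  assert (V : forall a b, Cinf a -> Cinf b -> sign_periodic s a -> sign_periodic s b ->
    is_derive (fun s => calF E A1 A2 (fun t => (x t + s * a t, y t + s * b t))) 0
      (4 * nrm x y * RInt (fun t => dx t * a t + dy t * b t) 0 1)).
  { intros a b Ha Hb Pa Pb. apply (first_variation_sum HD x y a b (Derive x) (Derive y) (Derive a) (Derive b)
      (Derive (Derive x)) (Derive (Derive y)) s); auto. }
  split.
  - intros H.
    assert (K : forall t, 0 < t < 1 -> dx t = 0 /\ dy t = 0).
    { apply (variational_lemma s); auto. intros a b Ha Hb Pa Pb.
      specialize (H (fun t => (a t, b t)) (smooth_Ck a b Ha Hb) Pa Pb). specialize (V a b Ha Hb Pa Pb).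
      unfold is_differential in H. apply is_derive_ext
        with (g := fun s => calF E A1 A2 (fun t => (x t + s * a t, y t + s * b t))) in H.
      2:{ intros u. now rewrite line_perturb. }
      apply is_derive_unique in H. apply is_derive_unique in V. assert (V0 := eq_trans (eq_sym V) H).
      apply Rmult_eq_reg_l with (4 * nrm x y); lra. }
    (* The variational lemma speaks of the open interval. Continuity adds the end points, on which
       the later comparison of 0 and 1 relies. *)
    assert (K' : forall f, Cinf f -> (forall t, 0 < t < 1 -> f t = 0) -> forall t, 0 <= t <= 1 -> f t = 0).
    { intros f Hf Hf0 t Ht. apply eq_of_not_ne. intros Hne.
      destruct (proj1 (continuous_R _ _) (CC f Hf t) (Rabs (f t)) ltac:(now apply Rabs_pos_lt)) as [d [Hd Hc]].
      assert (Hu : exists u, 0 < u < 1 /\ Rabs (u - t) < d).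
      { assert (0 < Rmin d 1) by (apply Rmin_pos; lra). pose proof (Rmin_l d 1). pose proof (Rmin_r d 1).
        destruct (Rlt_dec t (1 / 2)); [exists (t + Rmin d 1 / 4)|exists (t - Rmin d 1 / 4)];
          (split; [lra|apply Rabs_def1; lra]). }
      destruct Hu as [u [Hu1 Hu2]]. specialize (Hc u Hu2). rewrite (Hf0 u Hu1), Rminus_0_l, Rabs_Ropp in Hc. lra. }
    intros t Ht. split; apply K'; auto; intros; now apply K.
  - intros H zeta Hzeta Pa Pb. assert (C1 := fun n => Ck_smooth zeta n Hzeta).
    specialize (V (fun t => Re (zeta t)) (fun t => Im (zeta t)) (fun n => proj1 (C1 n))
      (fun n => proj2 (C1 n)) Pa Pb).
    unfold is_differential. apply is_derive_ext with
      (f := fun s => calF E A1 A2 (fun t => (x t + s * Re (zeta t), y t + s * Im (zeta t)))).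
    { intros u. now rewrite line_perturb. }
    apply (is_derive_eq V). rewrite (RInt_ext (V := R_CompleteNormedModule) _ (fun _ => 0)).
    + rewrite (RInt_const (V := R_CompleteNormedModule)). unfold scal; simpl; unfold mult; simpl. ring.
    + intros t Ht. rewrite Rmin_left, Rmax_right in Ht by lra. change (dx t * Re (zeta t) + dy t * Im (zeta t) = 0).
      destruct (H t ltac:(lra)) as [-> ->]. ring.
Qed.
End Data.

Lemma Cinf_cont f : Cinf f -> forall t, continuous f t.
Proof. intros Hf t; apply (Ck_continuous 0 (fun _ => True)); auto. Qed.
Lemma Cinf_is_derive f : Cinf f -> forall t, is_derive f t (Derive f t).
Proof. intros Hf t; apply (Ck_derive 0 (fun _ => True)); auto. Qed.
Lemma Cinf_Derive f : Cinf f -> Cinf (Derive f).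
Proof. intros Hf n; apply (Hf (S n)). Qed.

(** A derivative is determined by one side alone. Meant for the defects at 0 and at 1, which are
    first known to vanish on [0,1] only. *)
Lemma der_zero_right (f : R -> R) (a l : R) : (forall t, a <= t <= a + 1 -> f t = 0) -> is_derive f a l -> l = 0.
Proof.
  intros H0 H. apply cond_eq. intros e He. rewrite Rminus_0_r.
  destruct (proj1 (is_derive_R _ _ _) H (e / 2) ltac:(lra)) as [d [Hd K]].
  assert (Hm : 0 < Rmin d 1) by (apply Rmin_pos; lra). pose proof (Rmin_l d 1). pose proof (Rmin_r d 1).
  set (h := Rmin d 1 / 2) in *. specialize (K (a + h)). replace (a + h - a) with h in K by ring.
  assert (0 < h) by (unfold h; lra). assert (h < d) by (unfold h; lra). assert (h < 1) by (unfold h; lra).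
  rewrite (Rabs_right h) in K by lra. specialize (K ltac:(lra)). rewrite !H0 in K by lra.
  replace (0 - 0 - l * h) with (- (l * h)) in K by ring. rewrite Rabs_Ropp, Rabs_mult, (Rabs_right h) in K by lra.
  apply Rmult_le_reg_r in K; lra.
Qed.
Lemma der_zero_left (f : R -> R) (a l : R) : (forall t, a - 1 <= t <= a -> f t = 0) -> is_derive f a l -> l = 0.
Proof.
  intros H0 H. assert (K : is_derive (fun t => f (- t)) (- a) (- l)).
  { assert (L : is_derive (fun t => - t) (- a) (-1)) by (der; ring).
    rewrite <- (Ropp_involutive a) in H. eapply is_derive_eq;
      [apply (der_comp f (fun t => - t) (- a) l (-1) H L)|ring]. }
  apply der_zero_right in K; [lra|]. intros t Ht. apply H0. lra.
Qed.

Lemma der_tm (x y : R -> R) t : (forall t, continuous x t) -> (forall t, continuous y t) ->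
  is_derive (tm x y) t ((x t ^ 2 + y t ^ 2) / nrm x y).
Proof.
  intros Cx Cy. unfold tm, Rdiv. eapply is_derive_eq.
  - apply (@der_mult (fun t => RInt (fun t => x t ^ 2 + y t ^ 2) 0 t) (fun _ => / nrm x y) t (x t ^ 2 + y t ^ 2) 0);
      [|apply der_const].
    apply (is_derive_RInt_cont (fun t => x t ^ 2 + y t ^ 2)). intros; cont.
  - ring.
Qed.

Lemma tm_0 (x y : R -> R) : tm x y 0 = 0.
Proof. unfold tm. rewrite RInt_point_R. unfold Rdiv; ring. Qed.
Lemma tm_1 (x y : R -> R) : nrm x y <> 0 -> tm x y 1 = 1.
Proof. intros H. unfold tm. fold (nrm x y). now field. Qed.

Section Data.
Context {Q0 : C -> Prop} {E : C -> R -> R} {B A1 A2 : C -> R} (HD : smooth_data Q0 E B A1 A2).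

Lemma der_along (f : C -> R -> R) (x y s : R -> R) (t x1 y1 s1 : R) : Ck_over 1 Q0 f -> Q0 (qsq (x t) (y t)) ->
  is_derive x t x1 -> is_derive y t y1 -> is_derive s t s1 ->
  is_derive (fun t => f (qsq (x t) (y t)) (s t)) t
   (d_1 f (qsq (x t) (y t)) (s t) * (2 * (x t * x1 - y t * y1)) + d_2 f (qsq (x t) (y t)) (s t) *
     (2 * (x t * y1 + x1 * y t)) + d_t f (qsq (x t) (y t)) (s t) * s1).
Proof.
  intros Hf HU Hx Hy Hs. unfold qsq.
  apply (der_over Q0 f (fun t => x t ^ 2 - y t ^ 2) (fun t => 2 * (x t * y t)) s t); auto.
  - apply (sd_open HD).
  - der. ring.
  - der. ring.
Qed.

(** * From the delay equation to the regularized equation *)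

Section Defects.
Context (s : R) (x y : R -> R) (Hs : s = 1 \/ s = -1) (Hx : Cinf x) (Hy : Cinf y)
  (HU : forall t, Q0 (qsq (x t) (y t))) (HN : 0 < nrm x y).
Context (Px : sign_periodic s x) (Py : sign_periodic s y).
Let N := nrm x y.
Let x1 := Derive x.
Let y1 := Derive y.
Let x2 := Derive x1.
Let y2 := Derive y1.
Let w t := qsq (x t) (y t).
Let T := tm x y.
Let J := Jm E x y.
Let r t := x t ^ 2 + y t ^ 2.
Let al := multiplier E x y x1 y1.
Let dx := delay_defect_x E B x y x1 y1 x2.
Let dy := delay_defect_y E B x y x1 y1 y2.
(** [k] collects all that multiplies z once the delay equation is scaled by 2 N^2, and [P] is the
    defect of the energy law of [LC]. *)
Let k t := 2 * N ^ 2 * al - E (w t) (T t) - J t / N.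
Let P t := 2 * N ^ 2 * (x1 t ^ 2 + y1 t ^ 2) - 1 - r t * k t.

Lemma gE_cont t : continuous (gE E x y) t.
Proof. apply (cont_gE Q0); auto using Cinf_cont. apply (sd_E HD). Qed.

(** Along the loop E changes through the position and through the time; the derivative of the tail
    integral [J] cancels the second contribution. *)
Lemma kepler_derive t : is_derive k t (- (d_1 E (w t) (T t) * (2 * (x t * x1 t - y t * y1 t)) + d_2 E (w t) (T t) *
  (2 * (x t * y1 t + x1 t * y t)))).
Proof.
  assert (DT := der_tm x y t (Cinf_cont x Hx) (Cinf_cont y Hy)).
  assert (DE := der_along E x y (tm x y) t _ _ _ (sd_E HD 1%nat) (HU t) (Cinf_is_derive x Hx t)
    (Cinf_is_derive y Hy t) DT).
  assert (DJ : is_derive J t (- gE E x y t)) by (unfold J, Jm; apply is_derive_RInt_cont_l, gE_cont).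
  eapply is_derive_eq.
  - unfold k. apply (der_minus (der_minus (der_const _ t) DE) (der_mult DJ (der_const (/ N) t))).
  - unfold gE. fold N. fold x1 y1. fold (w t). fold T. field. unfold N; lra.
Qed.

(** The magnetic term is orthogonal to z', and the terms with grad E match those of k'; what remains
    is the pairing of z' with the defect. *)
Lemma energy_defect_derive t : is_derive P t (- 4 * N ^ 2 * (x1 t * dx t + y1 t * dy t)).
Proof.
  assert (Dx := Cinf_is_derive x Hx t). assert (Dy := Cinf_is_derive y Hy t).
  assert (Dx1 := Cinf_is_derive _ (Cinf_Derive x Hx) t). assert (Dy1 := Cinf_is_derive _ (Cinf_Derive y Hy) t).
  fold x1 y1 x2 y2 in Dx, Dy, Dx1, Dy1.
  assert (Dr : is_derive r t (2 * (x t * x1 t + y t * y1 t))) by (unfold r; der; ring).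
  assert (Dk := kepler_derive t).
  eapply is_derive_eq.
  - unfold P. apply (der_minus (der_minus (der_mult (der_const _ t) (der_plus (der_pow2 Dx1) (der_pow2 Dy1)))
      (der_const 1 t)) (der_mult Dr Dk)).
  - unfold dx, dy, delay_defect_x, delay_defect_y, k. fold N w al T J. fold (w t). unfold r. field. unfold N; lra.
Qed.

(** Integrating (T J)' with T 0 = 0 and J 1 = 0 turns the integral of |z|^2 J into N times that of T
    (dE/dt) |z|^2, which is the numerator of [calE1]. The multiplier is then exactly the value that
    makes the mean vanish. [LC_defects] uses the identity in the other direction, to recover the
    multiplier. *)
Lemma energy_defect_integral : (RInt P 0 1 : R) = 0.
Proof.
  pose proof (Cinf_cont x Hx) as Cx. pose proof (Cinf_cont y Hy) as Cy.
  pose proof (Cinf_cont _ (Cinf_Derive x Hx)) as Cx1. pose proof (Cinf_cont _ (Cinf_Derive y Hy)) as Cy1.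
  fold x1 y1 in Cx1, Cy1.
  assert (CT : forall t, continuous T t) by (intros; now apply cont_tm).
  pose proof gE_cont as Cg.
  assert (DJ : forall t, is_derive J t (- gE E x y t))
    by (intros; unfold J, Jm; apply is_derive_RInt_cont_l, gE_cont).
  assert (CJ : forall t, continuous J t) by (intros; eapply der_cont; apply DJ).
  assert (CE : forall t, continuous (fun t => E (w t) (T t)) t)
    by (intros; apply (cont_along Q0); auto; apply (smooth_cont_over _ _ (sd_E HD))).
  assert (radius_cont : forall t, continuous r t) by (intros; unfold r; cont).
  assert (K : RInt (fun t => / N * (r t * J t) - T t * gE E x y t) 0 1 = T 1 * J 1 - T 0 * J 0).
  { apply (RInt_ftc (fun t => T t * J t)); [|intros; cont]. intros t.
    eapply is_derive_eq; [apply (der_mult (der_tm x y t Cx Cy) (DJ t))|]. fold T N. unfold r. field. unfold N; lra. }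
  rewrite RInt_minus_cont, RInt_scal_cont in K by (intros; cont).
  unfold J at 2 in K. unfold Jm in K. rewrite RInt_point_R in K. unfold T at 3 in K. rewrite tm_0 in K.
  unfold P, k.
  set (D := (RInt (fun t => x1 t ^ 2 + y1 t ^ 2) 0 1) : R).
  set (I0 := (RInt (fun t => E (w t) (T t) * r t) 0 1) : R).
  set (I1 := (RInt (fun t => T t * gE E x y t) 0 1) : R) in *. set (I2 := (RInt (fun t => r t * J t) 0 1) : R) in *.
  transitivity (2 * N ^ 2 * D - 1 - (2 * N ^ 2 * al * N - I0 - / N * I2)).
  - rewrite (RInt_ext_all _ (fun t => 2 * N ^ 2 * (x1 t ^ 2 + y1 t ^ 2) - 1 -
      (2 * N ^ 2 * al * r t - E (w t) (T t) * r t - / N * (r t * J t)))) by (intros; field; unfold N; lra).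
    rewrite !RInt_minus_cont by (intros; cont). rewrite !RInt_scal_cont by (intros; cont).
    rewrite (RInt_const (V := R_CompleteNormedModule)).
    unfold scal; simpl; unfold mult; simpl. replace ((1 - 0) * 1) with 1 by ring. reflexivity.
  - assert (EI0 : / N * I2 = I1) by lra.
    assert (EI : I2 = N * I1) by (rewrite <- EI0; field; unfold N; lra).
    rewrite EI. unfold al, multiplier. fold N T. change (RInt (fun t => x1 t ^ 2 + y1 t ^ 2) 0 1) with D.
    change (RInt (fun t => E (qsq (x t) (y t)) (T t) * (x t ^ 2 + y t ^ 2)) 0 1) with I0.
    change (RInt (fun t => T t * gE E x y t) 0 1) with I1.
    field. unfold N; lra.
Qed.

Context (H0 : forall t, 0 <= t <= 1 -> dx t = 0 /\ dy t = 0).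

Lemma energy_on_period t : 0 <= t <= 1 -> P t = 0.
Proof.
  assert (Hc : forall t, 0 <= t <= 1 -> P t = P 0).
  { intros u Hu. destruct (Req_dec u 0) as [->|Hne]; auto.
    destruct (mvt P (fun t => - 4 * N ^ 2 * (x1 t * dx t + y1 t * dy t)) 0 u ltac:(lra)) as [c [Hc1 Hc2]].
    - intros; apply energy_defect_derive.
    - intros; eapply der_cont; apply energy_defect_derive.
    - destruct (H0 c ltac:(lra)) as [E1 E2]. rewrite E1, E2 in Hc2. lra. }
  assert (HP := energy_defect_integral).
  rewrite (RInt_ext (V := R_CompleteNormedModule) P (fun _ => P 0)) in HP.
  2:{ intros u Hu. rewrite Rmin_left, Rmax_right in Hu by lra. apply Hc. lra. }
  rewrite (RInt_const (V := R_CompleteNormedModule)) in HP.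
  unfold scal in HP; simpl in HP; unfold mult in HP; simpl in HP.
  intros Ht. rewrite Hc by auto. lra.
Qed.

Lemma sign_sq : s ^ 2 = 1.
Proof. destruct Hs as [-> | ->]; ring. Qed.
Lemma square_periodic t : w (t + 1) = w t.
Proof.
  unfold w, qsq. rewrite (Px t), (Py t). pose proof sign_sq. f_equal.
  - replace ((s * x t) ^ 2 - (s * y t) ^ 2) with (s ^ 2 * (x t ^ 2 - y t ^ 2)) by ring. rewrite H; ring.
  - replace (2 * (s * x t * (s * y t))) with (s ^ 2 * (2 * (x t * y t))) by ring. rewrite H; ring.
Qed.
Lemma radius_periodic t : r (t + 1) = r t.
Proof.
  unfold r. rewrite (Px t), (Py t). replace ((s * x t) ^ 2 + (s * y t) ^ 2)
    with (s ^ 2 * (x t ^ 2 + y t ^ 2)) by ring. rewrite sign_sq; ring.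
Qed.
Lemma time_shift t : T (t + 1) = T t + 1.
Proof.
  assert (D : forall t, is_derive (fun t => T (t + 1) - T t) t 0).
  { intros u. pose proof (der_tm x y (u + 1) (Cinf_cont x Hx) (Cinf_cont y Hy)) as K. apply shift_derive in K.
    eapply is_derive_eq; [apply (der_minus K (der_tm x y u (Cinf_cont x Hx) (Cinf_cont y Hy)))|].
    pose proof (radius_periodic u) as R. unfold r in R. rewrite R. ring. }
  pose proof (derive_zero_const _ t 0 D) as K. cbv beta in K. rewrite Rplus_0_l in K.
  assert (T0 : T 0 = 0) by apply tm_0. assert (T1 : T 1 = 1) by (apply tm_1; lra). rewrite T0, T1 in K. lra.
Qed.
Lemma gE_periodic t : gE E x y (t + 1) = gE E x y t.
Proof.
  unfold gE. fold (r (t + 1)) (r t) (w (t + 1)) (w t). fold T. rewrite radius_periodic, square_periodic, time_shift.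
  rewrite (d_t_per HD); auto. apply HU.
Qed.
Lemma Jm_shift t : J (t + 1) = J t - J 0.
Proof.
  assert (DJ : forall t, is_derive J t (- gE E x y t))
    by (intros; unfold J, Jm; apply is_derive_RInt_cont_l, gE_cont).
  assert (D : forall t, is_derive (fun t => J (t + 1) - J t) t 0).
  { intros u. pose proof (shift_derive _ _ _ (DJ (u + 1))) as K.
    eapply is_derive_eq; [apply (der_minus K (DJ u))|]. rewrite gE_periodic. ring. }
  pose proof (derive_zero_const _ t 0 D) as K. cbv beta in K. rewrite Rplus_0_l in K.
  assert (J1 : J 1 = 0) by (unfold J, Jm; apply RInt_point_R). rewrite J1 in K. lra.
Qed.
Lemma defects_shift t : dx (t + 1) = s * (dx t + J 0 / (2 * N ^ 3) * x t) /\
  dy (t + 1) = s * (dy t + J 0 / (2 * N ^ 3) * y t).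
Proof.
  pose proof (sign_periodic_derive s x x1 (Cinf_is_derive x Hx) Px) as Px1.
  pose proof (sign_periodic_derive s y y1 (Cinf_is_derive y Hy) Py) as Py1.
  pose proof (sign_periodic_derive s x1 x2 (Cinf_is_derive _ (Cinf_Derive x Hx)) Px1 t) as Px2.
  pose proof (sign_periodic_derive s y1 y2 (Cinf_is_derive _ (Cinf_Derive y Hy)) Py1 t) as Py2.
  specialize (Px1 t). specialize (Py1 t). pose proof (Px t) as Px0. pose proof (Py t) as Py0.
  pose proof (square_periodic t) as Ew. pose proof (radius_periodic t) as Er. pose proof (time_shift t) as ET.
  pose proof (Jm_shift t) as EJ.
  pose proof (d_1_per HD (w t) (T t) (HU t)) as E1. pose proof (d_2_per HD (w t) (T t) (HU t)) as E2.
  pose proof (sd_per HD (w t) (T t) (HU t)) as E0.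
  unfold dx, dy, delay_defect_x, delay_defect_y. fold (w t) (w (t + 1)) (r t) (r (t + 1)). fold T J N al.
  rewrite Ew, Er, ET, EJ, E0, E1, E2, Px0, Py0, Px1, Py1, Px2, Py2.
  split; field; unfold N; lra.
Qed.

Lemma mean_power_zero : J 0 = 0.
Proof.
  pose proof (energy_on_period 0 ltac:(lra)) as HP. unfold P in HP.
  assert (HN0 : 0 < N) by exact HN.
  assert (S0 : s <> 0) by (destruct Hs; lra).
  assert (Hc : J 0 / (2 * N ^ 3) = 0 -> J 0 = 0).
  { intros H. replace (J 0) with (J 0 / (2 * N ^ 3) * (2 * N ^ 3)) by (field; lra). rewrite H. ring. }
  apply Hc. clear Hc. set (c := J 0 / (2 * N ^ 3)) in *.
  destruct (Ck_defects HD x y Hx Hy HU) as (_ & _ & _ & Hdx & Hdy).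
  change (Cinf dx) in Hdx. change (Cinf dy) in Hdy.
  assert (Z : forall f : R -> R, Cinf f -> forall d : R -> R, Cinf d -> (forall t, 0 <= t <= 1 -> d t = 0) ->
    (forall t, d (t + 1) = s * (d t + c * f t)) ->
    c * f 0 = 0 /\ c * Derive f 0 = 0).
  { intros f Hf d Hd Hd0 Hsh. split.
    - specialize (Hsh 0). rewrite Rplus_0_l, !Hd0 in Hsh by lra. apply Rmult_eq_reg_l with s; auto. lra.
    - pose proof (Cinf_is_derive d Hd) as Dd.
      (* The defect vanishes to the right of 0 and to the left of 1; differentiating the shift
         relation at 0 links the two derivatives. *)
      assert (L0 : Derive d 0 = 0) by (apply (der_zero_right d 0); [intros; apply Hd0; lra|apply Dd]).
      assert (L1 : Derive d 1 = 0) by (apply (der_zero_left d 1); [intros; apply Hd0; lra|apply Dd]).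
      assert (K1 : is_derive (fun t => d (t + 1)) 0 (Derive d 1))
        by (apply shift_derive; rewrite Rplus_0_l; apply Dd).
      assert (K2 : is_derive (fun t => d (t + 1)) 0 (s * (Derive d 0 + c * Derive f 0))).
      { apply is_derive_ext with (fun t => s * (d t + c * f t)); [intros; symmetry; apply Hsh|].
        eapply is_derive_eq; [apply (der_mult (der_const s 0)
          (der_plus (Dd 0) (der_mult (der_const c 0) (Cinf_is_derive f Hf 0))))|]. ring. }
      apply is_derive_unique in K1. apply is_derive_unique in K2. rewrite K1 in K2. rewrite L0, L1 in K2.
      apply Rmult_eq_reg_l with s; auto. lra. }
  destruct (Z x Hx dx Hdx (fun t Ht => proj1 (H0 t Ht)) (fun t => proj1 (defects_shift t))) as [X0 X1].
  destruct (Z y Hy dy Hdy (fun t Ht => proj2 (H0 t Ht)) (fun t => proj2 (defects_shift t))) as [Y0 Y1].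
  (* If c were nonzero, z and z' would both vanish at 0, where the energy law would read -1 = 0. *)
  destruct (Req_dec c 0) as [|Hc]; auto. exfalso.
  assert (x 0 = 0) by (apply Rmult_eq_reg_l with c; lra). assert (y 0 = 0) by (apply Rmult_eq_reg_l with c; lra).
  assert (x1 0 = 0) by (apply Rmult_eq_reg_l with c; unfold x1; lra).
  assert (y1 0 = 0) by (apply Rmult_eq_reg_l with c; unfold y1; lra).
  unfold r in HP. rewrite H, H1, H2, H3 in HP. lra.
Qed.

Lemma defects_zero t : dx t = 0 /\ dy t = 0.
Proof.
  revert t. apply periodic_ext; [|intros; apply H0; lra].
  intros t. destruct (defects_shift t) as [-> ->]. rewrite mean_power_zero.
  assert (S0 : s <> 0) by (destruct Hs; lra).
  assert (Z : forall d v, s * (d + 0 / (2 * N ^ 3) * v) = s * d) by (intros; field; pose proof HN; unfold N; lra).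
  rewrite !Z. split.
  - intros [-> ->]. split; ring.
  - intros [K1 K2]. split; apply Rmult_eq_reg_l with s; auto; lra.
Qed.

Lemma defects_LC : LC Q0 E B N x y x1 y1 T k.
Proof.
  assert (HN0 : 0 < N) by exact HN.
  constructor; auto.
  - apply (Cinf_is_derive x Hx).
  - apply (Cinf_is_derive y Hy).
  - intros u. apply (is_derive_eq (Cinf_is_derive _ (Cinf_Derive x Hx) u)). fold x1. fold x2.
    destruct (defects_zero u) as [K _]. unfold dx, delay_defect_x in K. fold N w al T J in K. fold (w u) (r u) in *.
    apply Rminus_diag_uniq. transitivity (- 0); [rewrite <- K; unfold k; field; lra|ring].
  - intros u. apply (is_derive_eq (Cinf_is_derive _ (Cinf_Derive y Hy) u)). fold y1. fold y2.
    destruct (defects_zero u) as [_ K]. unfold dy, delay_defect_y in K. fold N w al T J in K. fold (w u) (r u) in *.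
    apply Rminus_diag_uniq. transitivity (- 0); [rewrite <- K; unfold k; field; lra|ring].
  - intros u. apply der_tm; now apply Cinf_cont.
  - apply tm_0.
  - apply time_shift.
  - apply kepler_derive.
  - assert (K : forall u, P u = 0).
    { intros u. rewrite <- (energy_on_period 0 ltac:(lra)). apply derive_zero_const. intros v.
      apply (is_derive_eq (energy_defect_derive v)). destruct (defects_zero v) as [-> ->]. ring. }
    intros u. specialize (K u). unfold P in K. unfold r in K. lra.
Qed.
End Defects.
End Data.

Section Data.
Context {Q0 : C -> Prop} {E : C -> R -> R} {B A1 A2 : C -> R} (HD : smooth_data Q0 E B A1 A2).

(** Bootstrap: the right-hand sides are smooth expressions in the six unknowns, so class C^n of all
    of them yields class C^(n+1). *)
Lemma LC_Ck {N x y x1 y1 t k} : LC Q0 E B N x y x1 y1 t k ->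
  Cinf x /\ Cinf y /\ Cinf x1 /\ Cinf y1 /\ Cinf t /\ Cinf k.
Proof.
  intros [HN HU Dx Dy Dx1 Dy1 Dt t0 t1 Dk En]. pose proof open_true as OT.
  assert (K : forall n, Ck n (fun _ => True) x /\ Ck n (fun _ => True) y /\ Ck n (fun _ => True) x1 /\
    Ck n (fun _ => True) y1 /\ Ck n (fun _ => True) t /\ Ck n (fun _ => True) k).
  { induction n as [|n (Hx & Hy & Hx1 & Hy1 & Ht & Hk)].
    - assert (S : forall f g, (forall u, is_derive f u (g u)) -> Ck 0 (fun _ => True) f)
        by (intros f g Hfg; split; auto; intros u _; eapply der_cont; apply Hfg).
      split; [|split; [|split; [|split; [|split]]]]; eapply S;
        [exact Dx|exact Dy|exact Dx1|exact Dy1|exact Dt|exact Dk].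
    - assert (Hr : Ck n (fun _ => True) (fun t => x t ^ 2 + y t ^ 2)) by (apply Ck_plus; auto; apply Ck_pow; auto).
      assert (HB : Ck n (fun _ => True) (fun t => B (qsq (x t) (y t)))).
      { apply (Ck_along HD x y (fun _ => 0) n (static B)); auto; [apply (sd_B HD)|apply Ck_const]. }
      assert (HE1 : Ck n (fun _ => True) (fun u => d_1 E (qsq (x u) (y u)) (t u)))
        by (apply (Ck_along HD); auto; apply (partials_smooth HD)).
      assert (HE2 : Ck n (fun _ => True) (fun u => d_2 E (qsq (x u) (y u)) (t u)))
        by (apply (Ck_along HD); auto; apply (partials_smooth HD)).
      assert (S : forall f g, (forall u, is_derive f u (g u)) -> Ck n (fun _ => True) g ->
        Ck (S n) (fun _ => True) f) by (intros f g Hfg; apply Ck_step; auto).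
      split; [|split; [|split; [|split; [|split]]]].
      + eapply S; [exact Dx|auto].
      + eapply S; [exact Dy|auto].
      + eapply S; [exact Dx1|]. unfold Rdiv.
        repeat first [ apply HE1 | apply HE2 | apply HB | apply Hx | apply Hy | apply Hr | apply Hx1 | apply Hy1 |
          apply Hk
          | apply Ck_const | apply Ck_minus; [exact OT| |] | apply Ck_plus; [exact OT| |] | apply Ck_mult;
            [exact OT| |] | apply Ck_opp; [exact OT|] ].
      + eapply S; [exact Dy1|]. unfold Rdiv.
        repeat first [ apply HE1 | apply HE2 | apply HB | apply Hx | apply Hy | apply Hr | apply Hx1 | apply Hy1 |
          apply Hk
          | apply Ck_const | apply Ck_minus; [exact OT| |] | apply Ck_plus; [exact OT| |] | apply Ck_mult;
            [exact OT| |] | apply Ck_opp; [exact OT|] ].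
      + eapply S; [exact Dt|]. unfold Rdiv. apply Ck_mult; auto. apply Ck_const.
      + eapply S; [exact Dk|].
        repeat first [ apply HE1 | apply HE2 | apply Hx | apply Hy | apply Hx1 | apply Hy1
          | apply Ck_const | apply Ck_minus; [exact OT| |] | apply Ck_plus; [exact OT| |] | apply Ck_mult;
            [exact OT| |] | apply Ck_opp; [exact OT|] ]. }
  repeat split; intros n; apply (K n).
Qed.

(** k + E + J / N is constant, because [lc_k] leaves out exactly the change of E in time. The energy
    law makes the integrand of [energy_defect_integral] a constant multiple of |z|^2, and its
    vanishing mean identifies the constant with 2 N^2 times the multiplier. *)
Lemma LC_defects {N x y x1 y1 t k} : LC Q0 E B N x y x1 y1 t k ->
  nrm x y = N /\ (forall u, tm x y u = t u) /\
  (forall u, delay_defect_x E B x y (Derive x) (Derive y) (Derive (Derive x)) u = 0 /\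
    delay_defect_y E B x y (Derive x) (Derive y) (Derive (Derive y)) u = 0).
Proof.
  intros H. destruct (LC_Ck H) as (Hx & Hy & Hx1 & Hy1 & Ht & Hk).
  destruct H as [HN HU Dx Dy Dx1 Dy1 Dt t0 t1 Dk En].
  assert (Cx := Cinf_cont x Hx). assert (Cy := Cinf_cont y Hy).
  assert (EN : nrm x y = N).
  { assert (K : RInt (fun u => / N * (x u ^ 2 + y u ^ 2)) 0 1 = t 1 - t 0).
    { apply RInt_ftc; [|intros; cont]. intros u. apply (is_derive_eq (Dt u)). unfold Rdiv; ring. }
    rewrite RInt_scal_cont in K by (intros; cont). fold (nrm x y) in K. specialize (t1 0).
    rewrite Rplus_0_l, t0 in t1. rewrite t1, t0 in K.
    replace (nrm x y) with (N * (/ N * nrm x y)) by (field; lra). rewrite K. ring. }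
  assert (ET : forall u, tm x y u = t u).
  { intros u. assert (D : forall v, is_derive (fun v => tm x y v - t v) v 0).
    { intros v. eapply is_derive_eq; [apply (der_minus (der_tm x y v Cx Cy) (Dt v))|]. rewrite EN. ring. }
    pose proof (derive_zero_const _ u 0 D) as K. cbv beta in K. rewrite tm_0, t0 in K. lra. }
  split; [exact EN|]. split; [exact ET|].
  assert (ET' : tm x y = t) by (apply FunctionalExtensionality.functional_extensionality; exact ET).
  assert (EX : Derive x = x1) by (apply FunctionalExtensionality.functional_extensionality; intros u;
    apply is_derive_unique, Dx).
  assert (EY : Derive y = y1) by (apply FunctionalExtensionality.functional_extensionality; intros u;
    apply is_derive_unique, Dy).
  assert (DJ : forall u, is_derive (Jm E x y) u (- gE E x y u)).
  { intros u. unfold Jm. apply is_derive_RInt_cont_l. intros v. apply (cont_gE Q0); auto. apply (sd_E HD). }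
  pose (c := k 0 + E (qsq (x 0) (y 0)) (t 0) + Jm E x y 0 / N).
  assert (Ek : forall u, k u = c - E (qsq (x u) (y u)) (t u) - Jm E x y u / N).
  { intros u. assert (D : forall v, is_derive (fun v => k v + E (qsq (x v) (y v)) (t v) + Jm E x y v * / N) v 0).
    { intros v. eapply is_derive_eq.
      - apply (der_plus (der_plus (Dk v) (der_along HD E x y t v _ _ _ (sd_E HD 1%nat) (HU v) (Dx v) (Dy v) (Dt v)))
          (der_mult (DJ v) (der_const (/ N) v))).
      - unfold gE. rewrite ET. field. lra. }
    pose proof (derive_zero_const _ u 0 D) as K. cbv beta in K. unfold c, Rdiv. lra. }
  assert (Ec : c = 2 * N ^ 2 * multiplier E x y x1 y1).
  { pose proof (energy_defect_integral HD x y Hx Hy HU ltac:(lra)) as HP. rewrite ET', EX, EY, EN in HP.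
    set (al := multiplier E x y x1 y1) in *.
    rewrite (RInt_ext_all _ (fun u => (c - 2 * N ^ 2 * al) * (x u ^ 2 + y u ^ 2))) in HP.
    - rewrite RInt_scal_cont in HP by (intros; cont). fold (nrm x y) in HP. rewrite EN in HP.
      apply Rmult_integral in HP. lra.
    - intros u. rewrite En, Ek. unfold Rdiv. ring. }
  intros u. rewrite EX, EY. unfold delay_defect_x, delay_defect_y. rewrite ET, EN.
  rewrite (is_derive_unique _ _ _ (Dx1 u)), (is_derive_unique _ _ _ (Dy1 u)), Ek, Ec. split; field; lra.
Qed.
End Data.

(** * From the regularized equation to collisional solutions *)

Lemma finite_of_isolated (Z : R -> Prop) (a b : R) : (forall u, locally' u (fun v => ~ Z v)) ->
  exists l : list R, forall u, a <= u <= b -> Z u -> In u l.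
Proof.
  intros H.
  assert (H' : forall u, exists d : posreal, forall v, Rabs (v - u) < d -> v <> u -> ~ Z v).
  { intros u. destruct (proj1 (locally'_R _ _) (H u)) as [d [Hd K]]. now exists (mkposreal d Hd). }
  pose (delta := fun u => proj1_sig (constructive_indefinite_description _ (H' u))).
  assert (Hdelta : forall u v, Rabs (v - u) < delta u -> v <> u -> ~ Z v).
  { intros u. unfold delta. destruct (constructive_indefinite_description _ (H' u)) as [d K]. exact K. }
  destruct (excluded_middle_informative (exists l : list R, forall u, a <= u <= b -> Z u -> In u l)) as [|Hn]; auto.
  (* Points of the line are here pairs with [tt], and the finite family of centres comes under a
     double negation. A neighbourhood contains no point of [Z] except possibly its centre, so the
     centres form the list. *)
  exfalso. apply (compactness_list 1 (a, tt) (b, tt) (fun p => delta (fst p))).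
  intros [l Hl]. apply Hn. exists (map fst l). intros u Hu HZ.
  destruct (Hl (u, tt)) as [[v []] [Hin [_ [Hc _]]]]; [now split|].
  destruct (Req_dec u v) as [->|Hne].
  - now apply (in_map fst l (v, tt)).
  - exfalso. now apply (Hdelta v u).
Qed.

Lemma nonzero_isolated (f : R -> R) (u l : R) : is_derive f u l -> l <> 0 -> locally' u (fun v => f v <> f u).
Proof.
  intros H Hl. apply locally'_R. assert (Hl' : 0 < Rabs l) by now apply Rabs_pos_lt.
  destruct (proj1 (is_derive_R _ _ _) H (Rabs l / 2) ltac:(lra)) as [d [Hd K]].
  exists d; split; auto. intros v Hv Hne E. specialize (K v Hv). rewrite E in K.
  replace (f u - f u - l * (v - u)) with (- (l * (v - u))) in K by ring. rewrite Rabs_Ropp, Rabs_mult in K.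
  assert (0 < Rabs (v - u)) by (apply Rabs_pos_lt; lra). nra.
Qed.

(** The difference quotient completed by the derivative: limits of z / (u - u0) at a zero of z
    become values of a function continuous there. *)
Definition slope (f : R -> R) (l u v : R) : R := if Req_EM_T v u then l else (f v - f u) / (v - u).

Lemma slope_cont (f : R -> R) (u l : R) : is_derive f u l -> continuous (slope f l u) u.
Proof.
  intros H. apply continuous_R. intros e He. destruct (proj1 (is_derive_R _ _ _) H (e / 2) ltac:(lra)) as [d [Hd K]].
  exists d; split; auto. intros v Hv. unfold slope. destruct (Req_EM_T u u) as [_|]; [|tauto].
  destruct (Req_EM_T v u) as [->|Hne]; [rewrite Rminus_diag, Rabs_R0; auto|].
  specialize (K v Hv). assert (0 < Rabs (v - u)) by (apply Rabs_pos_lt; lra).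
  replace ((f v - f u) / (v - u) - l) with ((f v - f u - l * (v - u)) / (v - u)) by (field; lra).
  unfold Rdiv at 1. rewrite Rabs_mult, Rabs_inv. apply Rle_lt_trans with (e / 2); [|lra].
  apply Rmult_le_reg_r with (Rabs (v - u)); auto. rewrite Rmult_assoc, Rinv_l, Rmult_1_r by lra. exact K.
Qed.
Lemma slope_ne (f : R -> R) (u l v : R) : v <> u -> slope f l u v = (f v - f u) / (v - u).
Proof. intros H. unfold slope. destruct (Req_EM_T v u); tauto. Qed.
Lemma slope_eq (f : R -> R) (u l : R) : slope f l u u = l.
Proof. unfold slope. destruct (Req_EM_T u u); tauto. Qed.

Lemma shift_surj (f : R -> R) : (forall u, continuous f u) -> (forall u, f (u + 1) = f u + 1) ->
  forall y, exists u, f u = y.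
Proof.
  intros Hc Hs.
  assert (Hn : forall n, f (INR n) = f 0 + INR n /\ f (- INR n) = f 0 - INR n).
  { induction n as [|n [IH1 IH2]].
    - simpl. rewrite Ropp_0. split; ring.
    - rewrite S_INR. split.
      + rewrite Hs, IH1. ring.
      + specialize (Hs (- (INR n + 1))). replace (- (INR n + 1) + 1) with (- INR n) in Hs by ring. lra. }
  intros y. destruct (INR_unbounded (Rabs (y - f 0))) as [n Hn']. apply Rabs_def2 in Hn'.
  destruct (Hn n) as [E1 E2]. pose proof (pos_INR n).
  destruct (IVT_gen f (- INR n) (INR n) y) as [u [_ Hu]].
  - intros u. apply continuous_continuity_pt, Hc.
  - rewrite E1, E2, Rmin_left, Rmax_right by lra. lra.
  - now exists u.
Qed.

Lemma Cmod_qsq (x y : R) : Cmod (qsq x y) = x ^ 2 + y ^ 2.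
Proof.
  unfold Cmod, qsq, fst, snd. replace ((x ^ 2 - y ^ 2) ^ 2 + (2 * (x * y)) ^ 2) with ((x ^ 2 + y ^ 2) ^ 2) by ring.
  apply sqrt_pow2. nra.
Qed.
Lemma qsq_0 (x y : R) : qsq x y = 0 <-> x ^ 2 + y ^ 2 = 0.
Proof.
  rewrite <- Cmod_qsq. split; [intros ->; apply Cmod_0|apply Cmod_eq_0].
Qed.

Section Data.
Context {Q0 : C -> Prop} {E : C -> R -> R} {B A1 A2 : C -> R} (HD : smooth_data Q0 E B A1 A2).
Context {N : R} {x y x1 y1 t k : R -> R} (H : LC Q0 E B N x y x1 y1 t k).

Let r u := x u ^ 2 + y u ^ 2.

Lemma radius_nonneg u : 0 <= r u. Proof. unfold r. nra. Qed.
Lemma LC_zero_velocity u : r u = 0 -> 2 * N ^ 2 * (x1 u ^ 2 + y1 u ^ 2) = 1 /\ x u = 0 /\ y u = 0.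
Proof.
  intros Hr. pose proof (lc_energy H u) as K. fold (r u) in K. rewrite Hr in K. split; [lra|]. unfold r in Hr.
  split; nra.
Qed.

(** At a zero of z the energy law leaves 2 N^2 |z'|^2 = 1, so one coordinate has a nonzero
    derivative and no other zero nearby. *)
Lemma LC_isolated u : locally' u (fun v => r v <> 0).
Proof.
  destruct (Req_dec (r u) 0) as [Hr|Hr].
  - destruct (LC_zero_velocity u Hr) as (Hv & Hx & Hy).
    destruct (Req_dec (x1 u) 0) as [Hx1|Hx1].
    + assert (Hy1 : y1 u <> 0) by (intros E0; rewrite Hx1, E0 in Hv; lra).
      apply filter_imp with (2 := nonzero_isolated y u _ (lc_y H u) Hy1). intros v Hne E0. apply Hne. rewrite Hy.
      unfold r in E0. nra.
    + apply filter_imp with (2 := nonzero_isolated x u _ (lc_x H u) Hx1). intros v Hne E0. apply Hne. rewrite Hx.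
      unfold r in E0. nra.
  - assert (radius_cont : continuous r u).
    { unfold r. cont; eapply der_cont; [apply (lc_x H)|apply (lc_y H)]. }
    destruct (proj1 (continuous_R _ _) radius_cont (Rabs (r u)) ltac:(now apply Rabs_pos_lt)) as [d [Hd K]].
    apply locally'_R. exists d; split; auto. intros v Hv _ E0. specialize (K v Hv).
    rewrite E0, Rminus_0_l, Rabs_Ropp in K. lra.
Qed.

Lemma LC_time_cont u : continuous t u.
Proof. eapply der_cont. apply (lc_t H). Qed.
Lemma LC_time_incr a b : a < b -> t a < t b.
Proof.
  apply strict_incr_of_pos; [apply LC_time_cont|]. intros u.
  apply filter_imp with (2 := LC_isolated u). intros v Hv. exists (r v / N). split; [|apply (lc_t H)].
  pose proof (lc_N H). pose proof (radius_nonneg v). apply Rdiv_lt_0_compat; lra.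
Qed.

Lemma LC_inverse : exists g : R -> R, (forall u, g (t u) = u) /\ (forall v, t (g v) = v) /\
  (forall v, continuous g v) /\ (forall v, g (v + 1) = g v + 1) /\ g 0 = 0.
Proof.
  destruct (incr_inverse t LC_time_cont LC_time_incr (shift_surj t LC_time_cont (lc_t1 H)))
    as [g (G1 & G2 & G3 & G4)].
  exists g. repeat split; auto.
  - intros v. rewrite <- (G1 (g v + 1)). f_equal. rewrite (lc_t1 H), G2. reflexivity.
  - pose proof (G1 0) as K. rewrite (lc_t0 H) in K. exact K.
Qed.

Context (g : R -> R) (G1 : forall u, g (t u) = u) (G2 : forall v, t (g v) = v) (Gc : forall v, continuous g v).
Let D v := r (g v) <> 0.
Let q v : C := qsq (x (g v)) (y (g v)).

Lemma radius_cont u : continuous r u.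
Proof. unfold r. cont; eapply der_cont; [apply (lc_x H)|apply (lc_y H)]. Qed.

Lemma noncollision_open : open D.
Proof.
  intros v Hv. assert (C : continuous (fun v => r (g v)) v)
    by (apply (continuous_comp g r); [apply Gc|apply radius_cont]).
  destruct (proj1 (continuous_R _ _) C (Rabs (r (g v))) ltac:(now apply Rabs_pos_lt)) as [d [Hd K]].
  apply locally_R. exists d; split; auto. intros u Hu E0. specialize (K u Hu).
  rewrite E0, Rminus_0_l, Rabs_Ropp in K. lra.
Qed.

Lemma inverse_time_derive v : D v -> is_derive g v (N / r (g v)).
Proof.
  intros Hv. pose proof (lc_N H) as HN. unfold D in Hv.
  replace (N / r (g v)) with (/ (r (g v) / N)) by (field; lra).
  apply (inverse_derive t g); auto.
  - apply (lc_t H).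
  - apply Rmult_integral_contrapositive_currified; auto. apply Rinv_neq_0_compat. lra.
Qed.

(** Off collisions g' is N / |z|^2 composed with g, so differentiation stays within smooth functions
    composed with g and their inverses. *)
Lemma Ck_comp_g n f : Cinf f -> Ck n D (fun v => f (g v)).
Proof.
  revert f. induction n as [|n IH]; intros f Hf.
  - split; auto. intros v _. apply (continuous_comp g f); auto. now apply Cinf_cont.
  - destruct (LC_Ck HD H) as (Hx & Hy & _).
    apply Ck_step with (fun v => Derive f (g v) * (N * / r (g v))); [apply noncollision_open| |].
    + intros v Hv. apply (der_comp f g); [apply (Cinf_is_derive f Hf)|now apply inverse_time_derive].
    + apply Ck_mult; [apply noncollision_open|apply IH, Cinf_Derive, Hf|].
      apply Ck_mult; [apply noncollision_open|apply Ck_const|].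
      apply Ck_inv; [apply noncollision_open|auto|]. apply (IH r). intros m. unfold r.
      apply Ck_plus; [apply open_true| |]; apply Ck_pow; auto using open_true.
Qed.

Lemma curve_zero_iff v : q v = 0 <-> r (g v) = 0.
Proof. unfold q. rewrite qsq_0. unfold r. tauto. Qed.

Lemma q_derive v : D v ->
  is_derive (fun s => Re (q s)) v (2 * N * (x (g v) * x1 (g v) - y (g v) * y1 (g v)) / r (g v)) /\
  is_derive (fun s => Im (q s)) v (2 * N * (x (g v) * y1 (g v) + x1 (g v) * y (g v)) / r (g v)).
Proof.
  intros Hv. pose proof (inverse_time_derive v Hv) as Dg.
  pose proof (der_comp x g v _ _ (lc_x H (g v)) Dg) as Dx.
  pose proof (der_comp y g v _ _ (lc_y H (g v)) Dg) as Dy.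
  unfold q, qsq; simpl. split.
  - eapply is_derive_eq; [apply (der_minus (der_pow2 Dx) (der_pow2 Dy))|]. field. exact Hv.
  - eapply is_derive_eq; [apply (der_mult (der_const 2 v) (der_mult Dx Dy))|]. field. exact Hv.
Qed.

Lemma q_velocity v : D v -> Cderive q v = (2 * N * (x (g v) * x1 (g v) - y (g v) * y1 (g v)) / r (g v),
  2 * N * (x (g v) * y1 (g v) + x1 (g v) * y (g v)) / r (g v)).
Proof.
  intros Hv. destruct (q_derive v Hv) as [K1 K2]. unfold Cderive. f_equal; now apply is_derive_unique.
Qed.

(** Here |q'| = 2 N |z'| / |z|, so this is the energy law divided by |z|^2; it reads |q'|^2 / 2 - 1
    / |q| = k. *)
Lemma q_speed v : D v -> Cmod (Cderive q v) ^ 2 = 2 / r (g v) + 2 * k (g v).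
Proof.
  intros Hv. rewrite q_velocity, Cmod2 by auto. simpl Re; simpl Im.
  pose proof (lc_energy H (g v)) as K. fold (r (g v)) in K. unfold D in Hv. set (u := g v) in *.
  assert (Kk : k u = (2 * N ^ 2 * (x1 u ^ 2 + y1 u ^ 2) - 1) / r u) by (rewrite K; field; auto).
  rewrite Kk. unfold r in *. field. auto.
Qed.

Lemma q_newton v : D v -> newton E B q v.
Proof.
  intros Hv. unfold newton. pose proof (lc_N H) as HN.
  pose proof (inverse_time_derive v Hv) as Dg.
  pose proof (der_comp x g v _ _ (lc_x H (g v)) Dg) as Dx.
  pose proof (der_comp y g v _ _ (lc_y H (g v)) Dg) as Dy.
  pose proof (der_comp x1 g v _ _ (lc_x1 H (g v)) Dg) as Dx1.
  pose proof (der_comp y1 g v _ _ (lc_y1 H (g v)) Dg) as Dy1.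
  pose proof (lc_energy H (g v)) as K.
  assert (Dr : is_derive (fun v => r (g v)) v (2 * (x (g v) * x1 (g v) + y (g v) * y1 (g v)) * (N / r (g v)))).
  { unfold r at 1. eapply is_derive_eq; [apply (der_plus (der_pow2 Dx) (der_pow2 Dy))|]. ring. }
  pose (p1 v := 2 * N * (x (g v) * x1 (g v) - y (g v) * y1 (g v)) * / r (g v)).
  pose (p2 v := 2 * N * (x (g v) * y1 (g v) + x1 (g v) * y (g v)) * / r (g v)).
  assert (D1 := der_mult (der_mult (der_const (2 * N) v) (der_minus (der_mult Dx Dx1) (der_mult Dy Dy1)))
    (der_inv Dr Hv)).
  assert (D2 := der_mult (der_mult (der_const (2 * N) v) (der_plus (der_mult Dx Dy1) (der_mult Dx1 Dy)))
    (der_inv Dr Hv)).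
  cbv beta in D1, D2.
  assert (L1 : locally v (fun s => p1 s = Re (Cderive q s))).
  { apply filter_imp with (2 := noncollision_open v Hv). intros s Hs. now rewrite q_velocity. }
  assert (L2 : locally v (fun s => p2 s = Im (Cderive q s))).
  { apply filter_imp with (2 := noncollision_open v Hv). intros s Hs. now rewrite q_velocity. }
  pose proof (is_derive_ext_loc p1 _ v _ L1 D1) as F1. pose proof (is_derive_ext_loc p2 _ v _ L2 D2) as F2.
  apply is_derive_unique in F1. apply is_derive_unique in F2.
  assert (FF : forall a b, Derive (fun s => Re (Cderive q s)) v = a -> Derive (fun s => Im (Cderive q s)) v = b ->
    Cderive (Cderive q) v = (a, b)) by (intros a b <- <-; reflexivity).
  rewrite (FF _ _ F1 F2), q_velocity by auto. unfold grad.
  replace (Cmod (q v)) with (r (g v)) by (symmetry; apply Cmod_qsq).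
  unfold q. rewrite G2. unfold D in Hv. set (u := g v) in *.
  (* With k eliminated by the energy law, both components of Newton's equation become identities of
     rational functions in z, z' and the values of B and grad E. *)
  assert (Kk : k u = (2 * N ^ 2 * (x1 u ^ 2 + y1 u ^ 2) - 1) / r u) by (rewrite K; unfold r; field; exact Hv).
  rewrite Kk. set (w := qsq (x u) (y u)).
  apply C_eq; simpl; unfold w, r in *; simpl; field; repeat split; auto; lra.
Qed.

Lemma locally'_inverse_time (P : R -> Prop) v : locally' (g v) P -> locally' v (fun s => P (g s)).
Proof.
  intros HP. destruct (proj1 (locally'_R _ _) HP) as [d [Hd K]].
  destruct (proj1 (continuous_R _ _) (Gc v) d Hd) as [e [He L]].
  apply locally'_R. exists e; split; auto. intros s Hs Hne. apply K; [now apply L|]. intros E0. apply Hne.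
  rewrite <- (G2 s), <- (G2 v). now rewrite E0.
Qed.

Lemma noncollision_near v : locally' v D.
Proof. apply (locally'_inverse_time (fun u => r u <> 0)), LC_isolated. Qed.

Lemma locally'_cont {U : UniformSpace} (f : R -> U) v : continuous f v -> filterlim f (locally' v) (locally (f v)).
Proof. intros Hf P HP. specialize (Hf P HP). unfold filtermap in *. apply filter_imp with (2 := Hf). auto. Qed.

Lemma Cdiv_real (w : C) (m : R) : m <> 0 -> (w / RtoC m)%C = (Re w / m, Im w / m).
Proof. intros Hm. destruct w as [a b]. apply C_eq; simpl; field; auto. Qed.

(** Near the collision z is u - u0 times a slope with nonzero limit z'(u0), and q / |q| is the
    square of the slope over its squared modulus. The sign of u - u0 drops out, so both sides give
    the same limit. *)
Lemma q_direction v : r (g v) = 0 -> exists l : C,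
  filterlim (fun s => (q s / RtoC (Cmod (q s)))%C) (locally' v) (locally l).
Proof.
  intros Hv. destruct (LC_zero_velocity (g v) Hv) as (Hv1 & Hx0 & Hy0).
  pose (X := slope x (x1 (g v)) (g v)). pose (Y := slope y (y1 (g v)) (g v)).
  assert (CX : continuous X (g v)) by (apply slope_cont, (lc_x H)).
  assert (CY : continuous Y (g v)) by (apply slope_cont, (lc_y H)).
  pose (L u := ((X u ^ 2 - Y u ^ 2) / (X u ^ 2 + Y u ^ 2), 2 * (X u * Y u) / (X u ^ 2 + Y u ^ 2)) : C).
  assert (CL : continuous L (g v)).
  { assert (X (g v) ^ 2 + Y (g v) ^ 2 <> 0). { unfold X, Y. rewrite !slope_eq. intros E0. rewrite E0 in Hv1. lra. }
    unfold L. cont. }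
  exists (L (g v)).
  assert (CLg : continuous (fun s => L (g s)) v) by (apply (continuous_comp g L); auto).
  apply filterlim_ext_loc with (f := fun s => L (g s)); [|now apply (locally'_cont (fun s => L (g s)))].
  assert (Hne : locally' v (fun s => g s <> g v))
    by (apply (locally'_inverse_time (fun u => u <> g v)); apply locally'_R; exists 1; split; [lra|auto]).
  apply filter_imp with (2 := filter_and _ _ (noncollision_near v) Hne). intros s [Hs Hgs].
  unfold q at 2. rewrite Cmod_qsq. fold (r (g s)). rewrite Cdiv_real by exact Hs.
  unfold L, X, Y. rewrite !slope_ne by auto. rewrite Hx0, Hy0, !Rminus_0_r. unfold q, qsq, D, r in *.
  simpl Re; simpl Im.
  assert (g s - g v <> 0) by lra. set (h := g s - g v) in *.
  assert ((x (g s) / h) ^ 2 + (y (g s) / h) ^ 2 <> 0).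
  { replace ((x (g s) / h) ^ 2 + (y (g s) / h) ^ 2) with ((x (g s) ^ 2 + y (g s) ^ 2) * / h ^ 2) by (field; auto).
    apply Rmult_integral_contrapositive_currified; auto. apply Rinv_neq_0_compat, pow_nonzero; auto. }
  f_equal; field; repeat split; auto.
Qed.

Lemma kepler_inverse_time_cont v : continuous (fun s => k (g s)) v.
Proof. apply (continuous_comp g k); auto. eapply der_cont. apply (lc_k H). Qed.

Lemma q_energy v : r (g v) = 0 -> exists h : R, filterlim (fun s => Cmod (Cderive q s) ^ 2 / 2 - / Cmod (q s))
  (locally' v) (locally h).
Proof.
  intros Hv. exists (k (g v)).
  apply filterlim_ext_loc with (f := fun s => k (g s));
    [|apply (locally'_cont (fun s => k (g s))), kepler_inverse_time_cont].
  apply filter_imp with (2 := noncollision_near v). intros s Hs. rewrite q_speed by auto. unfold q. rewrite Cmod_qsq.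
  fold (r (g s)). unfold D in Hs. field. auto.
Qed.

Lemma q_explode v : r (g v) = 0 -> filterlim (fun s => Cmod (Cderive q s)) (locally' v) (Rbar_locally p_infty).
Proof.
  intros Hv P [M HM].
  assert (C1 : continuous (fun s => r (g s)) v) by (apply (continuous_comp g r); auto; apply radius_cont).
  (* Once 1 / |q| exceeds [K], the speed exceeds M: the surplus in [K] pays for the energy, which is
     within 1 of its limit. *)
  pose (K := M ^ 2 + 2 * Rabs (k (g v)) + 3). assert (HK : 0 < K) by (unfold K; pose proof (Rabs_pos (k (g v))); nra).
  destruct (proj1 (continuous_R _ _) C1 (1 / K) ltac:(apply Rdiv_lt_0_compat; lra)) as [d1 [Hd1 L1]].
  destruct (proj1 (continuous_R _ _) (kepler_inverse_time_cont v) 1 ltac:(lra)) as [d2 [Hd2 L2]].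
  assert (Hd : locally' v (fun s => Rabs (s - v) < Rmin d1 d2)).
  { apply locally'_R. exists (Rmin d1 d2). split; auto. now apply Rmin_pos. }
  unfold filtermap. apply filter_imp with (2 := filter_and _ _ (noncollision_near v) Hd). intros s [Hs Hsd]. apply HM.
  pose proof (Rmin_l d1 d2). pose proof (Rmin_r d1 d2). specialize (L1 s ltac:(lra)). specialize (L2 s ltac:(lra)).
  rewrite Hv, Rminus_0_r in L1. pose proof (q_speed s Hs) as Sp. pose proof (radius_nonneg (g s)) as R0.
  unfold D in Hs.
  rewrite Rabs_right in L1 by lra. apply Rabs_def2 in L2.
  assert (K < / r (g s)).
  { rewrite <- (Rinv_inv K). apply Rinv_lt_contravar; [|unfold Rdiv in L1; lra].
    apply Rmult_lt_0_compat; [lra|now apply Rinv_0_lt_compat]. }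
  assert (M ^ 2 < Cmod (Cderive q s) ^ 2).
  { rewrite Sp. unfold Rdiv, K in *. pose proof (Rle_abs (- k (g v))). rewrite Rabs_Ropp in *. lra. }
  pose proof (Cmod_ge_0 (Cderive q s)). nra.
Qed.

Context (s : R) (Hs : s = 1 \/ s = -1) (Px : sign_periodic s x) (Py : sign_periodic s y)
  (Gp : forall v, g (v + 1) = g v + 1).

Lemma qsq_periodic u : qsq (x (u + 1)) (y (u + 1)) = qsq (x u) (y u).
Proof. rewrite (Px u), (Py u). unfold qsq. destruct Hs as [-> | ->]; f_equal; ring. Qed.

Lemma LC_collisional : collisional_solution Q0 E B q.
Proof.
  assert (EQ : forall v, q v <> 0 <-> D v) by (intros v; rewrite curve_zero_iff; unfold D; tauto).
  constructor.
  - intros v. unfold q. rewrite Gp. apply qsq_periodic.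
  - intros v. apply (lc_U H).
  - intros v. apply (continuous_comp g (fun u => qsq (x u) (y u))); auto. unfold qsq.
    assert (continuous x (g v)) by (eapply der_cont; apply (lc_x H)).
    assert (continuous y (g v)) by (eapply der_cont; apply (lc_y H)). cont.
  - destruct (finite_of_isolated (fun v => q v = 0) 0 1) as [l Hl].
    + intros v. apply filter_imp with (2 := noncollision_near v). intros u. apply EQ.
    + exists l. intros v Hv. apply Hl. lra.
  - intros v Hv n. apply EQ in Hv. destruct (LC_Ck HD H) as (Hx & Hy & _).
    split; apply (Ck_ex_derive_n n D); auto.
    + apply (Ck_comp_g n (fun u => x u ^ 2 - y u ^ 2)). intros m.
      apply Ck_minus; [apply open_true| |]; apply Ck_pow; auto using open_true.
    + apply (Ck_comp_g n (fun u => 2 * (x u * y u))). intros m. apply Ck_mult; [apply open_true|apply Ck_const|].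
      apply Ck_mult; auto using open_true.
  - intros v Hv. apply q_newton. now apply EQ.
  - intros v Hv. apply q_explode. now apply curve_zero_iff.
  - intros v Hv. apply q_direction. now apply curve_zero_iff.
  - intros v Hv. apply q_energy. now apply curve_zero_iff.
Qed.
End Data.

Lemma cont_eq_at (f g : R -> R) u : continuous f u -> continuous g u -> locally' u (fun v => f v = g v) -> f u = g u.
Proof.
  intros Hf Hg H. apply cond_eq. intros e He.
  destruct (proj1 (continuous_R _ _) Hf (e / 2) ltac:(lra)) as [d1 [Hd1 K1]].
  destruct (proj1 (continuous_R _ _) Hg (e / 2) ltac:(lra)) as [d2 [Hd2 K2]].
  destruct (proj1 (locally'_R _ _) H) as [d3 [Hd3 K3]].
  pose (h := Rmin d1 (Rmin d2 d3) / 2).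
  pose proof (Rmin_l d1 (Rmin d2 d3)). pose proof (Rmin_r d1 (Rmin d2 d3)). pose proof (Rmin_l d2 d3).
  pose proof (Rmin_r d2 d3).
  assert (0 < Rmin d1 (Rmin d2 d3)) by (repeat apply Rmin_pos; lra).
  assert (Hh : Rabs (u + h - u) = h) by (replace (u + h - u) with h by ring; apply Rabs_right; unfold h; lra).
  specialize (K1 (u + h)). specialize (K2 (u + h)). specialize (K3 (u + h)). rewrite Hh in K1, K2, K3.
  rewrite K3 in K1 by (unfold h; lra).
  specialize (K1 ltac:(unfold h; lra)). specialize (K2 ltac:(unfold h; lra)).
  replace (f u - g u) with ((g (u + h) - g u) - (g (u + h) - f u)) by ring.
  eapply Rle_lt_trans; [apply Rabs_triang|]. rewrite Rabs_Ropp. lra.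
Qed.

(** Equal real parts and equal moduli give x^2 = a^2 and y^2 = b^2; the imaginary part excludes
    mixed signs unless a coordinate is 0. *)
Lemma qsq_inj (x y a b : R) : qsq x y = qsq a b -> exists s, (s = 1 \/ s = -1) /\ a = s * x /\ b = s * y.
Proof.
  intros H. assert (H1 := f_equal Re H). assert (H2 := f_equal Im H). simpl in H1, H2.
  assert (Hm : x ^ 2 + y ^ 2 = a ^ 2 + b ^ 2) by (rewrite <- !Cmod_qsq; now rewrite H).
  assert (X : (a - x) * (a + x) = 0) by nra. assert (Y : (b - y) * (b + y) = 0) by nra.
  apply Rmult_integral in X. apply Rmult_integral in Y.
  destruct X as [X|X]; destruct Y as [Y|Y].
  - exists 1. split; auto. split; lra.
  - assert (a = x) by lra. assert (b = - y) by lra. subst a b. assert (x * y = 0) by nra. apply Rmult_integral in H0.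
    destruct H0; subst.
    + exists (-1). split; auto. split; lra.
    + exists 1. split; auto. split; lra.
  - assert (a = - x) by lra. assert (b = y) by lra. subst a b. assert (x * y = 0) by nra. apply Rmult_integral in H0.
    destruct H0; subst.
    + exists 1. split; auto. split; lra.
    + exists (-1). split; auto. split; lra.
  - exists (-1). split; auto. split; lra.
Qed.

(* Two square roots of the same curve with nonzero velocity at the zeros: the
   continuous function Re (z conj w) + Re (z' conj w') has no zero, and its sign is the sign relating w to z. *)
Lemma sqrt_unique (D : R -> Prop) (x y a b x1 y1 a1 b1 : R -> R) :
  open D -> (forall u v w, D u -> D v -> u <= w <= v -> D w) ->
  (forall u, D u -> is_derive x u (x1 u)) -> (forall u, D u -> is_derive y u (y1 u)) ->
  (forall u, D u -> is_derive a u (a1 u)) -> (forall u, D u -> is_derive b u (b1 u)) ->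
  (forall u, D u -> continuous x1 u /\ continuous y1 u /\ continuous a1 u /\ continuous b1 u) ->
  (forall u, D u -> qsq (x u) (y u) = qsq (a u) (b u)) ->
  (forall u, D u -> x u ^ 2 + y u ^ 2 = 0 -> x1 u ^ 2 + y1 u ^ 2 <> 0) ->
  exists s, (s = 1 \/ s = -1) /\ forall u, D u -> a u = s * x u /\ b u = s * y u.
Proof.
  intros HO Hconv Dx Dy Da Db HC HQ HZ.
  pose (f u := x u * a u + y u * b u + (x1 u * a1 u + y1 u * b1 u)).
  assert (P : forall u, D u -> exists s, (s = 1 \/ s = -1) /\ a u = s * x u /\ b u = s * y u /\ 0 < s * f u).
  { intros u Hu. destruct (Req_dec (x u ^ 2 + y u ^ 2) 0) as [H0|H0].
    - specialize (HZ u Hu H0). assert (x u = 0 /\ y u = 0) as [Hx Hy] by (split; nra).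
      destruct (qsq_inj _ _ _ _ (HQ u Hu)) as [s0 [Hs0 [Ea Eb]]]. rewrite Hx, Rmult_0_r in Ea.
      rewrite Hy, Rmult_0_r in Eb.
      (* At a common zero the sign is read off from the velocities: the slopes of the two roots have
         equal squares, and in the limit so do z' and w'. *)
      assert (L : forall v, D v -> v <> u -> qsq (slope x (x1 u) u v) (slope y (y1 u) u v) =
        qsq (slope a (a1 u) u v) (slope b (b1 u) u v)).
      { intros v Hv Hne. rewrite !slope_ne by auto. rewrite Hx, Hy, Ea, Eb, !Rminus_0_r. specialize (HQ v Hv).
        assert (H1 := f_equal Re HQ). assert (H2 := f_equal Im HQ). simpl in H1, H2. assert (v - u <> 0) by lra.
        unfold qsq. f_equal.
        - replace ((x v / (v - u)) ^ 2 - (y v / (v - u)) ^ 2)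
            with ((x v * (x v * 1) - y v * (y v * 1)) / (v - u) ^ 2) by (field; auto). rewrite H1. field; auto.
        - replace (2 * (x v / (v - u) * (y v / (v - u)))) with (2 * (x v * y v) / (v - u) ^ 2) by (field; auto).
          rewrite H2. field; auto. }
      pose proof (slope_cont x u _ (Dx u Hu)). pose proof (slope_cont y u _ (Dy u Hu)).
      pose proof (slope_cont a u _ (Da u Hu)). pose proof (slope_cont b u _ (Db u Hu)).
      assert (HL : locally' u (fun v => D v /\ v <> u)).
      { unfold locally', within. apply filter_imp with (2 := HO u Hu). auto. }
      assert (E : qsq (x1 u) (y1 u) = qsq (a1 u) (b1 u)).
      { rewrite <- (slope_eq x u (x1 u)) at 1. rewrite <- (slope_eq y u (y1 u)) at 1.
        rewrite <- (slope_eq a u (a1 u)) at 1. rewrite <- (slope_eq b u (b1 u)) at 1.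
        apply C_eq.
        - apply (cont_eq_at (fun v => Re (qsq (slope x (x1 u) u v) (slope y (y1 u) u v)))
            (fun v => Re (qsq (slope a (a1 u) u v) (slope b (b1 u) u v)))); try (unfold qsq, Re, fst; cont).
          apply filter_imp with (2 := HL). intros v [Hv Hne]. exact (f_equal Re (L v Hv Hne)).
        - apply (cont_eq_at (fun v => Im (qsq (slope x (x1 u) u v) (slope y (y1 u) u v)))
            (fun v => Im (qsq (slope a (a1 u) u v) (slope b (b1 u) u v)))); try (unfold qsq, Im, snd; cont).
          apply filter_imp with (2 := HL). intros v [Hv Hne]. exact (f_equal Im (L v Hv Hne)). }
      destruct (qsq_inj _ _ _ _ E) as [s [Hs [E1 E2]]]. exists s. split; auto. rewrite Hx, Hy, Ea, Eb, !Rmult_0_r.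
      repeat split; auto.
      unfold f. rewrite Hx, Hy, E1, E2. destruct Hs as [-> | ->]; nra.
    - destruct (qsq_inj _ _ _ _ (HQ u Hu)) as [s [Hs [Ea Eb]]]. exists s. split; auto. repeat split; auto.
      assert (K1 : 2 * (x u * x1 u - y u * y1 u) = 2 * (a u * a1 u - b u * b1 u)).
      { assert (is_derive (fun v => x v ^ 2 - y v ^ 2) u (2 * (x u * x1 u - y u * y1 u))) as W1
          by (pose proof (Dx u Hu); pose proof (Dy u Hu); der; ring).
        assert (is_derive (fun v => a v ^ 2 - b v ^ 2) u (2 * (a u * a1 u - b u * b1 u))) as W2
          by (pose proof (Da u Hu); pose proof (Db u Hu); der; ring).
        apply is_derive_unique in W1. apply is_derive_unique in W2. rewrite <- W1, <- W2. apply Derive_ext_loc.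
        apply filter_imp with (2 := HO u Hu). intros v Hv. exact (f_equal Re (HQ v Hv)). }
      assert (K2 : 2 * (x u * y1 u + x1 u * y u) = 2 * (a u * b1 u + a1 u * b u)).
      { assert (is_derive (fun v => 2 * (x v * y v)) u (2 * (x u * y1 u + x1 u * y u))) as W1
          by (pose proof (Dx u Hu); pose proof (Dy u Hu); der; ring).
        assert (is_derive (fun v => 2 * (a v * b v)) u (2 * (a u * b1 u + a1 u * b u))) as W2
          by (pose proof (Da u Hu); pose proof (Db u Hu); der; ring).
        apply is_derive_unique in W1. apply is_derive_unique in W2. rewrite <- W1, <- W2. apply Derive_ext_loc.
        apply filter_imp with (2 := HO u Hu). intros v Hv. exact (f_equal Im (HQ v Hv)). }
      rewrite Ea, Eb in K1, K2.
      assert (S1 : s * s = 1) by (destruct Hs as [-> | ->]; ring).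
      (* With w = s z, differentiating z^2 = w^2 gives z z' = s z w'; multiplication by conj z
         yields |z|^2 (z' - s w') = 0, of which these are the two coordinates. *)
      assert (U1 : (x u ^ 2 + y u ^ 2) * (x1 u - s * a1 u) = 0).
      { replace ((x u ^ 2 + y u ^ 2) * (x1 u - s * a1 u))
          with (x u * ((x u * x1 u - y u * y1 u) - s * (x u * a1 u - y u * b1 u)) + y u *
          ((x u * y1 u + x1 u * y u) - s * (x u * b1 u + a1 u * y u))) by ring.
        replace ((x u * x1 u - y u * y1 u) - s * (x u * a1 u - y u * b1 u)) with 0 by lra.
        replace ((x u * y1 u + x1 u * y u) - s * (x u * b1 u + a1 u * y u)) with 0 by lra. ring. }
      assert (U2 : (x u ^ 2 + y u ^ 2) * (y1 u - s * b1 u) = 0).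
      { replace ((x u ^ 2 + y u ^ 2) * (y1 u - s * b1 u))
          with (x u * ((x u * y1 u + x1 u * y u) - s * (x u * b1 u + a1 u * y u)) - y u *
          ((x u * x1 u - y u * y1 u) - s * (x u * a1 u - y u * b1 u))) by ring.
        replace ((x u * x1 u - y u * y1 u) - s * (x u * a1 u - y u * b1 u)) with 0 by lra.
        replace ((x u * y1 u + x1 u * y u) - s * (x u * b1 u + a1 u * y u)) with 0 by lra. ring. }
      apply Rmult_integral in U1. apply Rmult_integral in U2. destruct U1 as [|U1]; [contradiction|].
      destruct U2 as [|U2]; [contradiction|].
      unfold f. replace (x1 u) with (s * a1 u) by lra. replace (y1 u) with (s * b1 u) by lra. rewrite Ea, Eb.
      replace (s * (x u * (s * x u) + y u * (s * y u) + (s * a1 u * a1 u + s * b1 u * b1 u)))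
        with ((s * s) * ((x u ^ 2 + y u ^ 2) + (a1 u ^ 2 + b1 u ^ 2))) by ring.
      rewrite S1. nra. }
  assert (Cf : forall u, D u -> continuity_pt f u).
  { intros u Hu. apply continuous_continuity_pt. destruct (HC u Hu) as (C1 & C2 & C3 & C4).
    pose proof (der_cont (Dx u Hu)). pose proof (der_cont (Dy u Hu)). pose proof (der_cont (Da u Hu)).
    pose proof (der_cont (Db u Hu)).
    unfold f. cont. }
  assert (NZ : forall u, D u -> f u <> 0).
  { intros u Hu E. destruct (P u Hu) as [s (_ & _ & _ & K)]. rewrite E in K. lra. }
  (* The intermediate value theorem, for which the whole segment from u to v must lie in [D]. *)
  assert (Sg : forall u v, u < v -> D u -> D v -> 0 < f u * f v).
  { intros u v Huv Hu Hv. assert (K : forall w, u <= w <= v -> D w) by (intros w Hw; exact (Hconv u v w Hu Hv Hw)).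
    pose proof (NZ u Hu). pose proof (NZ v Hv).
    destruct (Rtotal_order (f u) 0) as [L|[L|L]]; [|contradiction|]; destruct (Rtotal_order (f v) 0) as [M|[M|M]];
      try contradiction; try nra; exfalso.
    - destruct (IVT_interv f u v) as [w [Hw Hw0]]; auto. now apply (NZ w (K w Hw)).
    - destruct (IVT_interv (fun t => - f t) u v) as [w [Hw Hw0]]; auto; try lra.
      + intros c Hc. apply continuity_pt_opp. auto.
      + apply (NZ w (K w Hw)). lra. }
  destruct (excluded_middle_informative (exists u0, D u0)) as [[u0 Hu0]|Hn].
  2:{ exists 1. split; auto. intros u Hu. exfalso. apply Hn. now exists u. }
  destruct (P u0 Hu0) as [s (Hs & _ & _ & Fs)]. exists s. split; auto. intros u Hu.
  destruct (P u Hu) as [s' (Hs' & Ea & Eb & Fs')].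
  assert (0 < f u0 * f u).
  { destruct (Rtotal_order u0 u) as [L|[<-|L]]; [now apply Sg| |rewrite Rmult_comm; now apply Sg].
    pose proof (NZ u0 Hu0). nra. }
  assert (s' = s) by (destruct Hs as [-> | ->]; destruct Hs' as [-> | ->]; auto; exfalso; nra). subst s'. auto.
Qed.

(** * Critical points as solutions of the regularized equation *)

Definition critical Q0 E A1 A2 (s : R) (z : R -> C) : Prop :=
  loop Q0 z /\ sign_periodic s (fun t => Re (z t)) /\ sign_periodic s (fun t => Im (z t)) /\
  forall zeta, smooth zeta -> sign_periodic s (fun t => Re (zeta t)) -> sign_periodic s (fun t => Im (zeta t)) ->
    is_differential (calF E A1 A2) z zeta 0.

Lemma periodic_iff z : periodic z <-> sign_periodic 1 (fun t => Re (z t)) /\ sign_periodic 1 (fun t => Im (z t)).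
Proof.
  split.
  - intros H. split; intros t; rewrite (H t); ring.
  - intros [H1 H2] t. apply C_eq; [rewrite (H1 t)|rewrite (H2 t)]; ring.
Qed.
Lemma antiperiodic_iff z : antiperiodic z <-> sign_periodic (-1) (fun t => Re (z t)) /\
  sign_periodic (-1) (fun t => Im (z t)).
Proof.
  split.
  - intros H. split; intros t; rewrite (H t); destruct (z t); simpl; ring.
  - intros [H1 H2] t. apply C_eq; [rewrite (H1 t)|rewrite (H2 t)]; destruct (z t); simpl; ring.
Qed.
Lemma crit_untwisted_iff Q0 E A1 A2 z : crit_untwisted Q0 E A1 A2 z <-> critical Q0 E A1 A2 1 z.
Proof.
  unfold crit_untwisted, untwisted_loop, critical. rewrite periodic_iff. split.
  - intros [[H1 [H2 H3]] H4]. split; [exact H1|]. split; [exact H2|]. split; [exact H3|]. intros zeta Hz P1 P2.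
    apply H4; auto. apply periodic_iff; auto.
  - intros (H1 & H2 & H3 & H4). split; [auto|]. intros zeta Hz P. apply periodic_iff in P. now apply H4.
Qed.
Lemma crit_twisted_iff Q0 E A1 A2 z : crit_twisted Q0 E A1 A2 z <-> critical Q0 E A1 A2 (-1) z.
Proof.
  unfold crit_twisted, twisted_loop, critical. rewrite antiperiodic_iff. split.
  - intros [[H1 [H2 H3]] H4]. split; [exact H1|]. split; [exact H2|]. split; [exact H3|]. intros zeta Hz P1 P2.
    apply H4; auto. apply antiperiodic_iff; auto.
  - intros (H1 & H2 & H3 & H4). split; [auto|]. intros zeta Hz P. apply antiperiodic_iff in P. now apply H4.
Qed.

Lemma frac_part_shift v : frac_part (v + 1) = frac_part v.
Proof.
  symmetry. destruct (base_fp v). apply (Int_part_frac_part_spec (v + 1) (Int_part v + 1)%Z); [lra|].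
  rewrite plus_IZR. rewrite (Rplus_Int_part_frac_part v) at 1. ring.
Qed.
Lemma frac_part_id v : 0 <= v < 1 -> frac_part v = v.
Proof. intros H. symmetry. apply (Int_part_frac_part_spec v 0%Z); [auto|]. simpl; ring. Qed.

Section Data.
Context {Q0 : C -> Prop} {E : C -> R -> R} {B A1 A2 : C -> R} (HD : smooth_data Q0 E B A1 A2).

Lemma critical_LC s z : s = 1 \/ s = -1 -> critical Q0 E A1 A2 s z ->
  let x := fun t => Re (z t) in let y := fun t => Im (z t) in
  exists k, LC Q0 E B (nrm x y) x y (Derive x) (Derive y) (tm x y) k.
Proof.
  intros Hs (Hl & Px & Py & Hc) x y.
  pose proof (proj1 (critical_defects HD s z Hs Hl Px Py) Hc) as Hdef.
  pose proof (loop_nrm z Hl) as HN. destruct Hl as [Hz [HQ _]]. assert (C0 := fun n => Ck_smooth z n Hz).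
  eexists. apply (defects_LC HD s x y Hs (fun n => proj1 (C0 n)) (fun n => proj2 (C0 n))); auto.
  intros t. specialize (HQ t). rewrite sq_xy in HQ. exact HQ.
Qed.

Lemma LC_critical s N x y x1 y1 t k : s = 1 \/ s = -1 -> LC Q0 E B N x y x1 y1 t k -> sign_periodic s x ->
  sign_periodic s y ->
  critical Q0 E A1 A2 s (fun t => (x t, y t)).
Proof.
  intros Hs H Px Py. destruct (LC_defects HD H) as (EN & _ & Hd).
  destruct (LC_Ck HD H) as (Hx & Hy & _).
  assert (Hl : loop Q0 (fun t => (x t, y t))).
  { split; [now apply smooth_Ck|]. split.
    - intros u. rewrite sq_xy. apply (lc_U H).
    - intros E0. pose proof (L2sq (fun t => (x t, y t)) (Cinf_cont x Hx) (Cinf_cont y Hy)) as K.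
      simpl Re in K; simpl Im in K. fold (nrm x y) in K.
      rewrite E0, EN in K. pose proof (lc_N H). lra. }
  split; [auto|]. split; [exact Px|]. split; [exact Py|].
  apply (critical_defects HD s _ Hs Hl Px Py). intros u _. apply Hd.
Qed.

Lemma Sigma_eq s N (z : R -> C) x1 y1 t k g : s = 1 \/ s = -1 ->
  let x := fun t => Re (z t) in let y := fun t => Im (z t) in
  LC Q0 E B N x y x1 y1 t k -> sign_periodic s x -> sign_periodic s y ->
  (forall u, g (t u) = u) -> (forall v, t (g v) = v) -> (forall v, g (v + 1) = g v + 1) ->
  forall v, Sigma z v = qsq (x (g v)) (y (g v)).
Proof.
  intros Hs x y H Px Py G1 G2 Gp.
  destruct (LC_Ck HD H) as (Hx & Hy & _).
  destruct (LC_defects HD H) as (EN & ET & _).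
  assert (Et : forall u, t_ z u = t u).
  { intros u. rewrite <- ET. unfold t_, tm. rewrite (L2sq z (Cinf_cont x Hx) (Cinf_cont y Hy)). unfold Rdiv.
    rewrite Rmult_comm. f_equal.
    apply RInt_ext_all. intros v. apply Cmod2. }
  apply periodic_ext.
  - intros v. unfold Sigma. rewrite frac_part_shift, Gp. unfold x, y.
    pose proof (qsq_periodic s Hs Px Py (g v)) as K. unfold x, y in K. rewrite K. tauto.
  - intros v Hv. unfold Sigma. rewrite frac_part_id by auto. rewrite sq_xy.
    pose proof (lc_t0 H) as T0. pose proof (lc_t1 H 0) as T1. rewrite Rplus_0_l, T0, Rplus_0_l in T1.
    assert (Inc := LC_time_incr H).
    (* [tau_] selects some preimage in [0,1]. One exists, namely g v, and it is the only one because
       t is injective. *)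
    assert (Ht : 0 <= tau_ z v <= 1 /\ t_ z (tau_ z v) = v).
    { unfold tau_. apply (epsilon_spec (inhabits 0) (fun tau => 0 <= tau <= 1 /\ t_ z tau = v)). exists (g v).
      rewrite Et, G2. split; auto.
      split.
      - destruct (Rle_lt_dec 0 (g v)) as [|L]; auto. apply Inc in L. rewrite G2, T0 in L. lra.
      - destruct (Rle_lt_dec (g v) 1) as [|L]; auto. apply Inc in L. rewrite G2, T1 in L. lra. }
    destruct Ht as [_ Ht]. rewrite Et in Ht. replace (g v) with (tau_ z v); [reflexivity|]. rewrite <- Ht at 2.
    now rewrite G1.
Qed.

Lemma Sigma_collisional s z : s = 1 \/ s = -1 -> critical Q0 E A1 A2 s z -> collisional_solution Q0 E B (Sigma z).
Proof.
  intros Hs Hc. destruct (critical_LC s z Hs Hc) as [k H]. destruct Hc as (_ & Px & Py & _).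
  destruct (LC_inverse H) as (g & G1 & G2 & Gc & Gp & G0).
  replace (Sigma z) with (fun v => qsq (Re (z (g v))) (Im (z (g v)))).
  - apply (LC_collisional HD H g G1 G2 Gc s Hs Px Py Gp).
  - apply FunctionalExtensionality.functional_extensionality. intros v. symmetry.
    apply (Sigma_eq s _ z _ _ _ _ g Hs H Px Py G1 G2 Gp).
Qed.

(** Both inverse times satisfy (g / N)' = 1 / |q| off collisions, so g / N = g' / N' everywhere.
    Time 1 then gives N = N', and [sqrt_unique] compares z and w at equal parameters. The signs s
    and s' are independent, so this also separates twisted from untwisted critical points. *)
Lemma Sigma_inj s s' z w : s = 1 \/ s = -1 -> s' = 1 \/ s' = -1 -> critical Q0 E A1 A2 s z ->
  critical Q0 E A1 A2 s' w -> Sigma z = Sigma w ->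
  w = z \/ w = neg z.
Proof.
  intros Hs Hs' Hcz Hcw HS.
  destruct (critical_LC s z Hs Hcz) as [k H]. destruct Hcz as (_ & Px & Py & _).
  destruct (LC_inverse H) as (g & G1 & G2 & Gc & Gp & G0).
  destruct (critical_LC s' w Hs' Hcw) as [k' H']. destruct Hcw as (_ & Px' & Py' & _).
  destruct (LC_inverse H') as (g' & G1' & G2' & Gc' & Gp' & G0').
  assert (EQ : forall v, qsq (Re (z (g v))) (Im (z (g v))) = qsq (Re (w (g' v))) (Im (w (g' v)))).
  { intros v. rewrite <- (Sigma_eq s _ z _ _ _ _ g Hs H Px Py G1 G2 Gp v), HS.
    apply (Sigma_eq s' _ w _ _ _ _ g' Hs' H' Px' Py' G1' G2' Gp'). }
  assert (ER : forall v, Re (z (g v)) ^ 2 + Im (z (g v)) ^ 2 = Re (w (g' v)) ^ 2 + Im (w (g' v)) ^ 2)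
    by (intros v; rewrite <- !Cmod_qsq; now rewrite EQ).
  set (x := fun t => Re (z t)) in *. set (y := fun t => Im (z t)) in *. set (a := fun t => Re (w t)) in *.
  set (b := fun t => Im (w t)) in *.
  set (N := nrm x y) in *. set (N' := nrm a b) in *.
  pose proof (lc_N H) as HN. pose proof (lc_N H') as HN'.
  assert (Dh : forall v, is_derive (fun v => g v / N - g' v / N') v 0).
  { intros v. apply (derive_of_cont (fun v => g v / N - g' v / N') (fun _ => 0)); [cont; lra| |cont].
    apply filter_imp with (2 := noncollision_near H g G2 Gc v). intros u Hu.
    pose proof (inverse_time_derive H g G1 G2 Gc u Hu) as D1.
    assert (Hu' : a (g' u) ^ 2 + b (g' u) ^ 2 <> 0) by (unfold a, b; rewrite <- ER; exact Hu).
    pose proof (inverse_time_derive H' g' G1' G2' Gc' u Hu') as D2.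
    eapply is_derive_eq; [apply (der_minus (der_mult D1 (der_const (/ N) u)) (der_mult D2 (der_const (/ N') u)))|].
    specialize (ER u). change (x (g u) ^ 2 + y (g u) ^ 2 = a (g' u) ^ 2 + b (g' u) ^ 2) in ER. rewrite ER. fold N N'.
    field. repeat split; auto; lra. }
  assert (Eh : forall v, g v / N = g' v / N').
  { intros v. pose proof (derive_zero_const _ v 0 Dh) as K. cbv beta in K. rewrite G0, G0' in K. unfold Rdiv in *.
    lra. }
  assert (ENN : N = N').
  { specialize (Eh 1). specialize (Gp 0). specialize (Gp' 0). rewrite Rplus_0_l, G0 in Gp.
    rewrite Rplus_0_l, G0' in Gp'. rewrite Gp, Gp' in Eh.
    rewrite <- (Rinv_inv N), <- (Rinv_inv N'). f_equal. unfold Rdiv in Eh. lra. }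
  assert (Eg : forall v, g v = g' v).
  { intros v. specialize (Eh v). rewrite ENN in Eh. apply Rmult_eq_reg_r in Eh; auto. apply Rinv_neq_0_compat; lra. }
  destruct (LC_Ck HD H) as (Cx & Cy & Cx1 & Cy1 & _).
  destruct (LC_Ck HD H') as (Ca & Cb & Ca1 & Cb1 & _).
  destruct (sqrt_unique (fun _ => True) x y a b (Derive x) (Derive y) (Derive a) (Derive b)) as [r [Hr K]];
    auto using open_true, Cinf_is_derive.
  - intros u _. repeat split; now apply Cinf_cont.
  - intros u _. rewrite <- (G1 u) at 1 2. pose proof (EQ (tm x y u)) as K. rewrite <- Eg in K. rewrite G1 in K |- *.
    exact K.
  - intros u _ Hu. destruct (LC_zero_velocity H u Hu) as [K _]. intros E0. rewrite E0 in K. lra.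
  - destruct Hr as [-> | ->]; [left|right]; apply FunctionalExtensionality.functional_extensionality; intros u;
      destruct (K u I) as [K1 K2]; unfold a, b, x, y in K1, K2;
      (apply C_eq; unfold neg; [rewrite K1|rewrite K2]; destruct (z u); simpl; ring).
Qed.
End Data.

(** * Regularization of a collisional solution *)

(** Across a collision the only handle on several functions is a bound on their square, supplied by
    the energy or by |z|^2 = |q|. *)
Lemma cont_squeeze (f g : R -> R) v : continuous g v -> g v = 0 -> f v = 0 -> locally' v (fun u => f u ^ 2 <= g u) ->
  continuous f v.
Proof.
  intros Hg Hg0 Hf0 H. apply continuous_R. intros e He.
  destruct (proj1 (continuous_R _ _) Hg (e ^ 2) ltac:(nra)) as [d [Hd K]].
  destruct (proj1 (locally'_R _ _) H) as [d' [Hd' K']].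
  exists (Rmin d d'). split; [now apply Rmin_pos|]. intros u Hu. pose proof (Rmin_l d d'). pose proof (Rmin_r d d').
  destruct (Req_dec u v) as [->|Hne]; [rewrite Rminus_diag, Rabs_R0; auto|].
  specialize (K u ltac:(lra)). specialize (K' u ltac:(lra) Hne). rewrite Hg0, Rminus_0_r in K.
  rewrite Hf0, Rminus_0_r.
  apply Rabs_def2 in K. apply Rabs_def1; nra.
Qed.

Lemma not_in_near (l : list R) v : locally' v (fun u => ~ In u l).
Proof.
  induction l as [|a l IH].
  - apply filter_forall. intros u [].
  - assert (Ha : locally' v (fun u => u <> a)).
    { apply locally'_R. destruct (Req_dec v a) as [->|Hne]; [exists 1; split; [lra|auto]|].
      exists (Rabs (v - a)). split; [apply Rabs_pos_lt; lra|]. intros u Hu _ ->. rewrite Rabs_minus_sym in Hu. lra. }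
    apply filter_imp with (2 := filter_and _ _ Ha IH). intros u [H1 H2] [H|H]; auto.
Qed.

(* A collisional solution in the regularized time u = tau_z(t): (va, vb) = q(t u), with velocity (VA, VB), and
   kap the Kepler energy; |q| = sqrt (va^2 + vb^2) is written out by [rad]. *)
Definition rad (va vb : R -> R) (u : R) : R := Cmod (va u, vb u).

Record KS (Q0 : C -> Prop) (E : C -> R -> R) (B : C -> R) (N : R) (va vb VA VB t kap : R -> R) : Prop := {
  ks_N : 0 < N;
  ks_U : forall u, Q0 (va u, vb u);
  ks_va : forall u, is_derive va u (VA u);
  ks_vb : forall u, is_derive vb u (VB u);
  ks_VA : forall u, rad va vb u <> 0 -> is_derive VA u
    (rad va vb u * B (va u, vb u) * VB u / N - va u / (rad va vb u * N ^ 2)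
     - rad va vb u ^ 2 * d_1 E (va u, vb u) (t u) / N ^ 2 + VA u * (va u * VA u + vb u * VB u) / rad va vb u ^ 2);
  ks_VB : forall u, rad va vb u <> 0 -> is_derive VB u
    (- (rad va vb u * B (va u, vb u) * VA u / N) - vb u / (rad va vb u * N ^ 2)
     - rad va vb u ^ 2 * d_2 E (va u, vb u) (t u) / N ^ 2 + VB u * (va u * VA u + vb u * VB u) / rad va vb u ^ 2);
  ks_VAc : forall u, continuous VA u;
  ks_VBc : forall u, continuous VB u;
  ks_t : forall u, is_derive t u (rad va vb u / N);
  ks_kap : forall u, is_derive kap u (- (d_1 E (va u, vb u) (t u) * VA u + d_2 E (va u, vb u) (t u) * VB u));
  ks_energy : forall u, N ^ 2 * (VA u ^ 2 + VB u ^ 2) = 2 * rad va vb u ^ 2 * kap u + 2 * rad va vb u;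
  ks_isolated : forall u, locally' u (fun v => rad va vb v <> 0);
  ks_direction : forall u, rad va vb u = 0 -> exists l1 l2,
    filterlim (fun v => va v / rad va vb v) (locally' u) (locally l1) /\
     filterlim (fun v => vb v / rad va vb v) (locally' u) (locally l2);
  ks_per : forall u, va (u + 1) = va u /\ vb (u + 1) = vb u /\ t (u + 1) = t u + 1 /\ kap (u + 1) = kap u;
  ks_t0 : t 0 = 0
}.

Arguments ks_N {Q0 E B N va vb VA VB t kap} _.
Arguments ks_U {Q0 E B N va vb VA VB t kap} _.
Arguments ks_va {Q0 E B N va vb VA VB t kap} _.
Arguments ks_vb {Q0 E B N va vb VA VB t kap} _.
Arguments ks_VA {Q0 E B N va vb VA VB t kap} _.
Arguments ks_VB {Q0 E B N va vb VA VB t kap} _.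
Arguments ks_VAc {Q0 E B N va vb VA VB t kap} _.
Arguments ks_VBc {Q0 E B N va vb VA VB t kap} _.
Arguments ks_t {Q0 E B N va vb VA VB t kap} _.
Arguments ks_kap {Q0 E B N va vb VA VB t kap} _.
Arguments ks_energy {Q0 E B N va vb VA VB t kap} _.
Arguments ks_isolated {Q0 E B N va vb VA VB t kap} _.
Arguments ks_direction {Q0 E B N va vb VA VB t kap} _.
Arguments ks_per {Q0 E B N va vb VA VB t kap} _.
Arguments ks_t0 {Q0 E B N va vb VA VB t kap} _.
Arguments cs_periodic {Q0 E B q} _.
Arguments cs_range {Q0 E B q} _.
Arguments cs_continuous {Q0 E B q} _.
Arguments cs_finite {Q0 E B q} _.
Arguments cs_smooth {Q0 E B q} _.
Arguments cs_newton {Q0 E B q} _.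
Arguments cs_direction {Q0 E B q} _.
Arguments cs_energy {Q0 E B q} _.

Section Collisional.
Context {Q0 : C -> Prop} {E : C -> R -> R} {B A1 A2 : C -> R} (HD : smooth_data Q0 E B A1 A2).
Context {q : R -> C} (Hq : collisional_solution Q0 E B q).

Let a v := Re (q v).
Let b v := Im (q v).
Let a1 := Derive a.
Let b1 := Derive b.
Let r v := Cmod (q v).
Let E1 v := d_1 E (q v) v.
Let E2 v := d_2 E (q v) v.

Lemma curve_eta v : q v = (a v, b v). Proof. unfold a, b. now destruct (q v). Qed.
Lemma modulus_sq v : r v ^ 2 = a v ^ 2 + b v ^ 2. Proof. apply Cmod2. Qed.
Lemma modulus_ge0 v : 0 <= r v. Proof. apply Cmod_ge_0. Qed.
Lemma modulus_pos v : q v <> 0 -> 0 < r v. Proof. apply Cmod_gt_0. Qed.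
Lemma modulus_zero v : q v = 0 -> r v = 0. Proof. intros H. unfold r. rewrite H. apply Cmod_0. Qed.
Lemma re_cont v : continuous a v. Proof. apply (cont_Re q), (cs_continuous Hq). Qed.
Lemma im_cont v : continuous b v. Proof. apply (cont_Im q), (cs_continuous Hq). Qed.
Lemma modulus_cont v : continuous r v.
Proof.
  unfold r, Cmod. apply cont_sqrt. apply cont_plus; apply cont_pow; [apply (cont_Re q)|apply (cont_Im q)];
    apply (cs_continuous Hq).
Qed.

Lemma q_isolated v : locally' v (fun u => q u <> 0).
Proof.
  revert v. assert (EQ : forall u : R, u - 1 + 1 = u) by (intros; ring). apply periodic_ext.
  - intros v. split; intros H; apply locally'_R in H; destruct H as [d [Hd K]]; apply locally'_R; exists d; split;
      auto; intros u Hu Hne.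
    + specialize (K (u - 1)). replace (u - 1 - v) with (u - (v + 1)) in K by ring. specialize (K Hu ltac:(lra)).
      rewrite <- (cs_periodic Hq (u - 1)) in K. now rewrite EQ in K.
    + specialize (K (u + 1)). replace (u + 1 - (v + 1)) with (u - v) in K by ring. specialize (K Hu ltac:(lra)).
      now rewrite (cs_periodic Hq u) in K.
  - intros v Hv. destruct (cs_finite Hq) as [l Hl].
    (* The list covers the zeros in [0,1) only; its translates by -1 and 1 cover those just
       outside. *)
    pose proof (not_in_near (l ++ map (fun u => u - 1) l ++ map (fun u => u + 1) l) v) as H1.
    assert (H2 : locally' v (fun u => Rabs (u - v) < 1)) by (apply locally'_R; exists 1; split; [lra|auto]).
    apply filter_imp with (2 := filter_and _ _ H1 H2). intros u [Hu1 Hu2] H0. apply Hu1. apply Rabs_def2 in Hu2.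
    rewrite !in_app_iff. destruct (Rlt_dec u 0); [right; left|destruct (Rlt_dec u 1); [left|right; right]].
    + apply in_map_iff. exists (u + 1). split; [ring|]. apply Hl; [lra|]. now rewrite (cs_periodic Hq).
    + apply Hl; [lra|auto].
    + apply in_map_iff. exists (u - 1). split; [ring|]. apply Hl; [lra|]. rewrite <- (cs_periodic Hq). now rewrite EQ.
Qed.

Lemma q_open : open (fun v => q v <> 0).
Proof.
  intros v Hv. destruct (proj1 (continuous_R _ _) (modulus_cont v) (r v) (modulus_pos v Hv)) as [d [Hd K]].
  apply locally_R. exists d; split; auto. intros u Hu H0. specialize (K u Hu).
  rewrite (modulus_zero u H0), Rminus_0_l, Rabs_Ropp, Rabs_right in K; [lra|]. pose proof (modulus_ge0 v). lra.
Qed.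

Lemma q_Ck n : Ck n (fun v => q v <> 0) a /\ Ck n (fun v => q v <> 0) b.
Proof. split; apply ex_derive_n_Ck; try apply q_open; intros k v Hv; apply (cs_smooth Hq v Hv k). Qed.

Lemma curve_derive v : q v <> 0 -> is_derive a v (a1 v) /\ is_derive b v (b1 v).
Proof. intros Hv. destruct (q_Ck 1) as [K1 K2]. split;
  [apply (Ck_derive _ _ _ _ K1 Hv)|apply (Ck_derive _ _ _ _ K2 Hv)]. Qed.

Lemma modulus_derive v : q v <> 0 -> is_derive r v ((a v * a1 v + b v * b1 v) / r v).
Proof.
  intros Hv. destruct (curve_derive v Hv) as [Da Db]. pose proof (modulus_pos v Hv).
  assert (K : is_derive (fun v => sqrt (a v ^ 2 + b v ^ 2)) v
    ((2 * a v * a1 v + 2 * b v * b1 v) * / (2 * sqrt (a v ^ 2 + b v ^ 2)))).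
  { apply (der_sqrt (fun v => a v ^ 2 + b v ^ 2)); [apply (der_plus (der_pow2 Da) (der_pow2 Db))|].
    rewrite <- modulus_sq. nra. }
  apply (is_derive_eq K). change (sqrt (a v ^ 2 + b v ^ 2)) with (r v). field. lra.
Qed.

Lemma curve_newton v : q v <> 0 ->
  is_derive a1 v (B (q v) * b1 v - a v / r v ^ 3 - E1 v) /\
    is_derive b1 v (- (B (q v) * a1 v) - b v / r v ^ 3 - E2 v).
Proof.
  intros Hv. destruct (q_Ck 2) as [K1 K2]. pose proof (modulus_pos v Hv).
  assert (D1 : is_derive a1 v (Derive a1 v)) by (apply (Ck_derive 0 (fun v => q v <> 0)); [apply K1|auto]).
  assert (D2 : is_derive b1 v (Derive b1 v)) by (apply (Ck_derive 0 (fun v => q v <> 0)); [apply K2|auto]).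
  pose proof (cs_newton Hq v Hv) as Hn. unfold newton in Hn.
  change (Cderive (Cderive q) v) with ((Derive a1 v, Derive b1 v) : C) in Hn.
  change (Cderive q v) with ((a1 v, b1 v) : C) in Hn.
  fold (r v) in Hn. unfold grad in Hn. fold (E1 v) (E2 v) in Hn. set (Bq := B (q v)) in *. rewrite curve_eta in Hn.
  assert (H1 := f_equal Re Hn). assert (H2 := f_equal Im Hn). simpl in H1, H2. split.
  - apply (is_derive_eq D1). rewrite H1. field. lra.
  - apply (is_derive_eq D2). rewrite H2. field. lra.
Qed.

Lemma velocity_cont v : q v <> 0 -> continuous a1 v /\ continuous b1 v.
Proof. intros Hv. destruct (curve_newton v Hv). split; eapply der_cont; eauto. Qed.

Let e0 v := (a1 v ^ 2 + b1 v ^ 2) / 2 - / r v.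

Definition kepler_energy : R -> R := fun v =>
  if excluded_middle_informative (q v = 0) then epsilon (inhabits 0)
    (fun h => filterlim e0 (locally' v) (locally h)) else e0 v.
Let e := kepler_energy.

Lemma kepler_energy_off v : q v <> 0 -> e v = e0 v.
Proof. intros H. unfold e, kepler_energy. destruct (excluded_middle_informative (q v = 0)); tauto. Qed.

Lemma kepler_energy_cont v : continuous e v.
Proof.
  destruct (excluded_middle_informative (q v = 0)) as [H0|H0].
  - apply continuous_filterlim'. apply filterlim_ext_loc with (f := e0).
    { apply filter_imp with (2 := q_isolated v). intros u Hu. symmetry. now apply kepler_energy_off. }
    unfold e at 1, kepler_energy. destruct (excluded_middle_informative (q v = 0)); [|tauto].
    apply epsilon_spec. destruct (cs_energy Hq v H0) as [h Hh]. exists h.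
    revert Hh. apply filterlim_ext. intros u. rewrite Cmod2. reflexivity.
  - apply (continuous_ext_loc e e0). { apply filter_imp with (2 := q_open v H0). intros u Hu. symmetry.
    now apply kepler_energy_off. }
    destruct (velocity_cont v H0). pose proof (modulus_cont v). pose proof (modulus_pos v H0). unfold e0. cont; lra.
Qed.

Lemma kepler_energy_derive v : q v <> 0 -> is_derive e v (- (E1 v * a1 v + E2 v * b1 v)).
Proof.
  intros Hv. apply is_derive_ext_loc with e0. { apply filter_imp with (2 := q_open v Hv). intros u Hu. symmetry.
  now apply kepler_energy_off. }
  destruct (curve_newton v Hv) as [D1 D2]. pose proof (modulus_derive v Hv) as Dr. pose proof (modulus_pos v Hv).
  unfold e0. eapply is_derive_eq.
  - apply (der_minus (der_mult (der_plus (der_pow2 D1) (der_pow2 D2)) (der_const (/ 2) v)) (der_inv Dr ltac:(lra))).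
  - field. lra.
Qed.

(** Multiplied by |q|^2 so as to hold at collisions too, where [a1] and [b1] are mere default values
    of [Derive]. *)
Lemma speed_eq v : r v ^ 2 * (a1 v ^ 2 + b1 v ^ 2) = 2 * r v ^ 2 * e v + 2 * r v.
Proof.
  destruct (excluded_middle_informative (q v = 0)) as [H0|H0].
  - rewrite (modulus_zero v H0). ring.
  - rewrite kepler_energy_off by auto. unfold e0. pose proof (modulus_pos v H0). field. lra.
Qed.
Let m v := 2 * r v ^ 2 * e v + 2 * r v.
Lemma speed_bound_cont v : continuous m v.
Proof. pose proof (modulus_cont v). pose proof (kepler_energy_cont v). unfold m. cont. Qed.

(** By [speed_eq], |q|^2 |q'|^2 = 2 |q|^2 e + 2 |q| tends to 0 at a collision. So whatever is
    bounded by |q| |q'| extends continuously by 0: |q| q', <q, q'> and the angular momentum. *)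
Lemma small_cont (f : R -> R) v : (forall u, q u <> 0 -> continuous f u) -> (forall u, q u = 0 -> f u = 0) ->
  (forall u, f u ^ 2 <= r u ^ 2 * (a1 u ^ 2 + b1 u ^ 2)) -> continuous f v.
Proof.
  intros Hc H0 Hb. destruct (excluded_middle_informative (q v = 0)) as [Hv|Hv]; auto.
  apply (cont_squeeze f m); auto using speed_bound_cont.
  - unfold m. rewrite (modulus_zero v Hv). ring.
  - apply filter_forall. intros u. unfold m. rewrite <- speed_eq. apply Hb.
Qed.

Lemma reg_velocity_cont v : continuous (fun v => r v * a1 v) v /\ continuous (fun v => r v * b1 v) v.
Proof.
  split; apply small_cont; intros u; try (intros Hu; destruct (velocity_cont u Hu); pose proof (modulus_cont u);
    cont; fail); try (intros Hu; rewrite (modulus_zero u Hu); ring);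
  pose proof (pow2_ge_0 (r u)); pose proof (pow2_ge_0 (a1 u)); pose proof (pow2_ge_0 (b1 u)); nra.
Qed.

Let J v := a v * a1 v + b v * b1 v.
Let L v := a v * b1 v - b v * a1 v.

Lemma curve_zero v : q v = 0 -> a v = 0 /\ b v = 0.
Proof. intros H. unfold a, b. rewrite H. split; reflexivity. Qed.

Lemma moments_cont v : continuous J v /\ continuous L v.
Proof.
  split; apply small_cont; intros u.
  - intros Hu; destruct (velocity_cont u Hu); pose proof (re_cont u); pose proof (im_cont u); unfold J; cont.
  - intros Hu. destruct (curve_zero u Hu) as [Ha Hb]. unfold J. rewrite Ha, Hb. ring.
  - rewrite modulus_sq. unfold J. pose proof (pow2_ge_0 (a u * b1 u - b u * a1 u)). nra.
  - intros Hu; destruct (velocity_cont u Hu); pose proof (re_cont u); pose proof (im_cont u); unfold L; cont.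
  - intros Hu. destruct (curve_zero u Hu) as [Ha Hb]. unfold L. rewrite Ha, Hb. ring.
  - rewrite modulus_sq. unfold L. pose proof (pow2_ge_0 (a u * a1 u + b u * b1 u)). nra.
Qed.

Lemma along_q_cont A v : continuous_over Q0 A -> continuous (fun v => A (q v) v) v.
Proof. intros HA. apply (cont_over Q0 A q (fun v => v)); auto;
  [apply (cs_range Hq)|apply (cs_continuous Hq)|apply continuous_id]. Qed.
Lemma force_cont v : continuous E1 v /\ continuous E2 v.
Proof. pose proof (smooth_cont_over _ _ (sd_E HD)). split; apply along_q_cont; tauto. Qed.
Lemma field_cont v : continuous (fun v => B (q v)) v.
Proof. apply (along_q_cont (static B)). apply (sd_B HD 0%nat). Qed.

(** The terms come from |q'|^2 + <q, q''>: the first is 2 e + 2 / |q|, the Kepler force contributes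
    - 1 / |q|, and the magnetic force contributes B times the angular momentum [L]. *)
Let bet v := 2 * e v + B (q v) * L v - (a v * E1 v + b v * E2 v).
Lemma virial_cont v : continuous bet v.
Proof.
  pose proof (kepler_energy_cont v). destruct (moments_cont v). pose proof (field_cont v). pose proof (re_cont v).
  pose proof (im_cont v). destruct (force_cont v). unfold bet. cont.
Qed.

Let T v := J v - RInt bet 0 v.

(* (<q,q'>)' = 1/|q| + bet with bet continuous across collisions: this regularizes the improper integral of 1/|q| *)
Lemma reg_time_derive v : q v <> 0 -> is_derive T v (/ r v).
Proof.
  intros Hv. destruct (curve_derive v Hv) as [Da Db]. destruct (curve_newton v Hv) as [D1 D2].
  pose proof (modulus_pos v Hv).
  unfold T, J. eapply is_derive_eq.
  - apply (der_minus (der_plus (der_mult Da D1) (der_mult Db D2)) (is_derive_RInt_cont bet 0 v virial_cont)).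
  - unfold bet, L. pose proof (speed_eq v) as K. pose proof (modulus_sq v) as K2.
    assert (Ee : e v = (a1 v ^ 2 + b1 v ^ 2) / 2 - / r v) by (rewrite kepler_energy_off by auto; reflexivity).
    rewrite Ee.
    match goal with |- ?l = ?rr => assert (l - rr = - (a v ^ 2 + b v ^ 2 - r v ^ 2) / r v ^ 3) by (field; lra) end.
    rewrite K2 in H0. unfold Rdiv in H0. rewrite Rminus_diag, Ropp_0, Rmult_0_l in H0. lra.
Qed.
Lemma reg_time_cont v : continuous T v.
Proof.
  unfold T. apply cont_minus; [exact (proj1 (moments_cont v))|]. eapply der_cont.
  apply (is_derive_RInt_cont bet 0 v virial_cont).
Qed.
Lemma reg_time_incr u v : u < v -> T u < T v.
Proof.
  apply strict_incr_of_pos; [apply reg_time_cont|]. intros w. apply filter_imp with (2 := q_isolated w). intros s Hs.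
  exists (/ r s). split; [|now apply reg_time_derive]. apply Rinv_0_lt_compat. now apply modulus_pos.
Qed.
Lemma modulus_periodic v : r (v + 1) = r v.
Proof. unfold r. now rewrite (cs_periodic Hq). Qed.
Lemma reg_time_shift v : T (v + 1) = T v + (T 1 - T 0).
Proof.
  assert (D : forall u, is_derive (fun u => T (u + 1) - T u) u 0).
  { intros u. apply (derive_of_cont _ (fun _ => 0)); [|apply filter_imp with (2 := q_isolated u)|cont].
    - apply cont_minus; [|apply reg_time_cont]. apply (continuous_comp (fun u => u + 1) T);
        [cont|apply reg_time_cont].
    - intros s Hs. assert (Hs1 : q (s + 1) <> 0) by now rewrite (cs_periodic Hq).
      eapply is_derive_eq; [apply (der_minus (shift_derive _ _ _ (reg_time_derive (s + 1) Hs1))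
        (reg_time_derive s Hs))|]. rewrite modulus_periodic. ring. }
  pose proof (derive_zero_const _ v 0 D) as K. cbv beta in K. rewrite Rplus_0_l in K. lra.
Qed.

Lemma filterlim_pair_inv (f : R -> C) (F : (R -> Prop) -> Prop) (l : C) : Filter F -> filterlim f F (locally l) ->
  filterlim (fun v => Re (f v)) F (locally (Re l)) /\ filterlim (fun v => Im (f v)) F (locally (Im l)).
Proof.
  intros HF H. split; eapply filterlim_comp; try exact H;
    [apply (continuous_fst (U := R_UniformSpace) (V := R_UniformSpace))|apply
    (continuous_snd (U := R_UniformSpace) (V := R_UniformSpace))].
Qed.

Lemma kepler_energy_periodic v : e (v + 1) = e v.
Proof.
  apply (cont_eq_at (fun v => e (v + 1)) e); [|apply kepler_energy_cont|].
  - apply (continuous_comp (fun u => u + 1) e); [cont|apply kepler_energy_cont].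
  - apply filter_imp with (2 := q_isolated v). intros u Hu.
    assert (Hu1 : q (u + 1) <> 0) by now rewrite (cs_periodic Hq).
    rewrite !kepler_energy_off by auto. unfold e0. rewrite modulus_periodic.
    assert (Sa : forall w, a (w + 1) = a w) by (intros w; unfold a; now rewrite (cs_periodic Hq)).
    assert (Sb : forall w, b (w + 1) = b w) by (intros w; unfold b; now rewrite (cs_periodic Hq)).
    destruct (curve_derive (u + 1) Hu1) as [D1 D2]. apply shift_derive in D1. apply shift_derive in D2.
    apply is_derive_unique in D1. apply is_derive_unique in D2.
    assert (F1 : a1 (u + 1) = a1 u) by (rewrite <- D1; apply Derive_ext; exact Sa).
    assert (F2 : b1 (u + 1) = b1 u) by (rewrite <- D2; apply Derive_ext; exact Sb).
    now rewrite F1, F2.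
Qed.

Theorem collisional_KS : exists N VA VB t kap tinv,
  KS Q0 E B N (fun u => Re (q (t u))) (fun u => Im (q (t u))) VA VB t kap /\ (forall u, tinv (t u) = u) /\
    (forall v, t (tinv v) = v).
Proof.
  (* c is the regularized length of one period. Scaling it to 1 forces N = 1 / c, and then dt/du =
     |q| / N. *)
  pose (c := T 1 - T 0). assert (Hc : 0 < c) by (unfold c; pose proof (reg_time_incr 0 1 ltac:(lra)); lra).
  pose (N := / c). assert (HN : 0 < N) by now apply Rinv_0_lt_compat.
  pose (S v := N * (T v - T 0)).
  assert (CS : forall v, continuous S v) by (intros v; pose proof (reg_time_cont v); unfold S; cont).
  assert (IS : forall u v, u < v -> S u < S v) by (intros u v Huv; pose proof (reg_time_incr u v Huv); unfold S; nra).
  assert (SS : forall v, S (v + 1) = S v + 1) by (intros v; unfold S; rewrite reg_time_shift; fold c; unfold N;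
    field; lra).
  assert (DS : forall v, q v <> 0 -> is_derive S v (N / r v)).
  { intros v Hv. unfold S. eapply is_derive_eq; [apply
      (der_mult (der_const N v) (der_minus (reg_time_derive v Hv) (der_const (T 0) v)))|]. unfold Rdiv; ring. }
  destruct (incr_inverse S CS IS (shift_surj S CS SS)) as [t (G1 & G2 & G3 & Ct)].
  assert (Hloc : forall (P : R -> Prop) u, locally' (t u) P -> locally' u (fun v => P (t v))).
  { intros P u HP. destruct (proj1 (locally'_R _ _) HP) as [d [Hd K]].
    destruct (proj1 (continuous_R _ _) (Ct u) d Hd) as [d' [Hd' K']].
    apply locally'_R. exists d'; split; auto. intros v Hv Hne. apply K; [now apply K'|]. intros E0. apply Hne.
    rewrite <- (G2 v), <- (G2 u). now rewrite E0. }
  assert (Iso : forall u, locally' u (fun v => q (t v) <> 0))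
    by (intros u; apply (Hloc (fun v => q v <> 0)), q_isolated).
  (* At a collision [S] is not differentiable, but its inverse is: the formula for the derivative
     extends continuously, with value 0. *)
  assert (Dt : forall u, is_derive t u (r (t u) / N)).
  { intros u. apply (derive_of_cont t (fun u => r (t u) / N)); auto.
    - apply filter_imp with (2 := Iso u). intros v Hv. pose proof (modulus_pos _ Hv).
      replace (r (t v) / N) with (/ (N / r (t v))) by (field; lra). apply (inverse_derive S t); auto.
      apply Rmult_integral_contrapositive_currified; [lra|]. apply Rinv_neq_0_compat. lra.
    - assert (continuous (fun u => r (t u)) u) by (apply (continuous_comp t r); auto; apply modulus_cont). cont. lra.
      }
  pose (VA u := r (t u) * a1 (t u) / N). pose (VB u := r (t u) * b1 (t u) / N).
  assert (CVA : forall u, continuous VA u).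
  { intros u. unfold VA, Rdiv. apply cont_mult; [|cont]. apply (continuous_comp t (fun v => r v * a1 v)); auto.
    exact (proj1 (reg_velocity_cont (t u))). }
  assert (CVB : forall u, continuous VB u).
  { intros u. unfold VB, Rdiv. apply cont_mult; [|cont]. apply (continuous_comp t (fun v => r v * b1 v)); auto.
    exact (proj2 (reg_velocity_cont (t u))). }
  assert (Rad : forall u, rad (fun u => Re (q (t u))) (fun u => Im (q (t u))) u = r (t u)).
  { intros u. unfold rad, r. now destruct (q (t u)). }
  assert (Rad' : forall u, r (t u) <> 0 -> q (t u) <> 0) by (intros u Hu E0; apply Hu; now apply modulus_zero).
  assert (Eq : forall u, (Re (q (t u)), Im (q (t u))) = q (t u)) by (intros u; now destruct (q (t u))).
  exists N, VA, VB, t, (fun u => e (t u)), S. split; [|split; auto].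
  constructor; auto.
  - intros u. rewrite Eq. apply (cs_range Hq).
  - intros u. change (is_derive (fun u => a (t u)) u (VA u)). apply derive_of_cont; auto.
    + apply (continuous_comp t a); auto. apply re_cont.
    + apply filter_imp with (2 := Iso u). intros v Hv. destruct (curve_derive _ Hv) as [Da _].
      eapply is_derive_eq; [apply (der_comp a t v _ _ Da (Dt v))|]. unfold VA, Rdiv; ring.
  - intros u. change (is_derive (fun u => b (t u)) u (VB u)). apply derive_of_cont; auto.
    + apply (continuous_comp t b); auto. apply im_cont.
    + apply filter_imp with (2 := Iso u). intros v Hv. destruct (curve_derive _ Hv) as [_ Db].
      eapply is_derive_eq; [apply (der_comp b t v _ _ Db (Dt v))|]. unfold VB, Rdiv; ring.
  - intros u Hu. rewrite Rad in *. apply Rad' in Hu. rewrite Eq. pose proof (modulus_pos _ Hu).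
    destruct (curve_newton _ Hu) as [D1 _].
    eapply is_derive_eq.
    + unfold VA. apply (der_mult (der_mult (der_comp r t u _ _ (modulus_derive _ Hu) (Dt u))
        (der_comp a1 t u _ _ D1 (Dt u))) (der_const (/ N) u)).
    + unfold VA, VB. fold (a (t u)) (b (t u)). fold (E1 (t u)). field. lra.
  - intros u Hu. rewrite Rad in *. apply Rad' in Hu. rewrite Eq. pose proof (modulus_pos _ Hu).
    destruct (curve_newton _ Hu) as [_ D2].
    eapply is_derive_eq.
    + unfold VB. apply (der_mult (der_mult (der_comp r t u _ _ (modulus_derive _ Hu) (Dt u))
        (der_comp b1 t u _ _ D2 (Dt u))) (der_const (/ N) u)).
    + unfold VA, VB. fold (a (t u)) (b (t u)). fold (E2 (t u)). field. lra.
  - intros u. rewrite Eq. fold (E1 (t u)) (E2 (t u)).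
    apply (derive_of_cont (fun u => e (t u)) (fun u => - (E1 (t u) * VA u + E2 (t u) * VB u))).
    + apply (continuous_comp t e); auto. apply kepler_energy_cont.
    + apply filter_imp with (2 := Iso u). intros v Hv.
      eapply is_derive_eq; [apply (der_comp e t v _ _ (kepler_energy_derive _ Hv) (Dt v))|].
      unfold VA, VB, Rdiv; ring.
    + assert (continuous (fun u => E1 (t u)) u) by
        (apply (continuous_comp t E1); [apply Ct|exact (proj1 (force_cont (t u)))]).
      assert (continuous (fun u => E2 (t u)) u) by
        (apply (continuous_comp t E2); [apply Ct|exact (proj2 (force_cont (t u)))]).
      pose proof (CVA u). pose proof (CVB u). cont.
  - intros u. rewrite Rad. rewrite <- speed_eq. unfold VA, VB. field. lra.
  - intros u. apply filter_imp with (2 := Iso u). intros v Hv. rewrite Rad. pose proof (modulus_pos _ Hv). lra.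
  - intros u Hu. rewrite Rad in Hu.
    assert (H0 : q (t u) = 0). { apply Cmod_eq_0. exact Hu. }
    destruct (cs_direction Hq (t u) H0) as [l Hl]. exists (Re l), (Im l).
    assert (HF : Filter (locally' (t u))) by typeclasses eauto.
    destruct (filterlim_pair_inv _ _ l HF Hl) as [L1 L2].
    assert (Pull : forall (f : R -> R) l0, filterlim f (locally' (t u)) (locally l0) ->
      filterlim (fun v => f (t v)) (locally' u) (locally l0)).
    { intros f l0 Hf P HP. apply (Hloc (fun v => P (f v))). now apply Hf. }
    apply Pull in L1. apply Pull in L2.
    split; [eapply filterlim_ext_loc; [|exact L1]|eapply filterlim_ext_loc; [|exact L2]]; apply filter_imp
      with (2 := Iso u); intros v Hv; rewrite Rad;
      rewrite Cdiv_real by (pose proof (modulus_pos _ Hv); unfold r in *; lra); reflexivity.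
  - intros u. assert (Tu : t (u + 1) = t u + 1). { rewrite <- (G1 (t u + 1)). f_equal. now rewrite SS, G2. }
    rewrite Tu, (cs_periodic Hq), kepler_energy_periodic. auto.
  - rewrite <- (G1 0) at 2. f_equal. unfold S. ring.
Qed.
End Collisional.

(** * The principal square root *)

(** The half-angle formula for the real part X; the imaginary part Y is recovered from 2 X Y = d.
    Both are used on the right half-plane, where X > 0, and at the origin. *)
Definition sqX (c d : R) : R := sqrt ((sqrt (c ^ 2 + d ^ 2) + c) / 2).
Definition sqY (c d : R) : R := d / (2 * sqX c d).

Lemma sqX_arg c d : 0 < c -> 0 < (sqrt (c ^ 2 + d ^ 2) + c) / 2.
Proof. intros Hc. pose proof (sqrt_pos (c ^ 2 + d ^ 2)). lra. Qed.
Lemma sq_spec c d : 0 < c -> qsq (sqX c d) (sqY c d) = (c, d) /\ 0 < sqX c d.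
Proof.
  intros Hc. assert (HX : 0 < sqX c d) by (apply sqrt_lt_R0, sqX_arg, Hc).
  assert (HX2 : sqX c d ^ 2 = (sqrt (c ^ 2 + d ^ 2) + c) / 2) by (apply pow2_sqrt; left; now apply sqX_arg).
  assert (Hm : sqrt (c ^ 2 + d ^ 2) ^ 2 = c ^ 2 + d ^ 2) by (apply pow2_sqrt; nra).
  set (m := sqrt (c ^ 2 + d ^ 2)) in *. set (X := sqX c d) in *.
  split; auto. unfold qsq, sqY. fold X. f_equal; [|field; lra].
  replace (X ^ 2 - (d / (2 * X)) ^ 2) with ((4 * (X ^ 2) ^ 2 - d ^ 2) / (4 * X ^ 2)) by (field; lra).
  replace (d ^ 2) with (m ^ 2 - c ^ 2) by lra.
  assert (m + c <> 0) by (intros E0; assert (X ^ 2 = 0) by lra; nra).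
  rewrite HX2. field. lra.
Qed.
Lemma sq_00 : sqX 0 0 = 0 /\ sqY 0 0 = 0.
Proof.
  assert (H : sqX 0 0 = 0). { unfold sqX. replace (0 ^ 2 + 0 ^ 2) with 0 by ring. rewrite sqrt_0.
  replace ((0 + 0) / 2) with 0 by field. apply sqrt_0. }
  split; auto. unfold sqY, Rdiv. ring.
Qed.
Lemma sq_ex_derive (c d : R -> R) u : ex_derive c u -> ex_derive d u -> 0 < c u ->
  ex_derive (fun u => sqX (c u) (d u)) u /\ ex_derive (fun u => sqY (c u) (d u)) u.
Proof.
  intros [c1 Dc] [d1 Dd] Hc.
  assert (Dm : exists l, is_derive (fun u => sqrt (c u ^ 2 + d u ^ 2)) u l).
  { eexists. apply (der_sqrt (fun u => c u ^ 2 + d u ^ 2)); [apply (der_plus (der_pow2 Dc) (der_pow2 Dd))|nra]. }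
  destruct Dm as [m1 Dm].
  assert (DX : exists l, is_derive (fun u => sqX (c u) (d u)) u l).
  { eexists. unfold sqX. apply (der_sqrt (fun u => (sqrt (c u ^ 2 + d u ^ 2) + c u) / 2)); [|now apply sqX_arg].
    apply (der_mult (der_plus Dm Dc) (der_const (/ 2) u)). }
  destruct DX as [X1 DX]. split; [now exists X1|]. eexists. unfold sqY.
  apply (der_div Dd (der_mult (der_const 2 u) DX)). destruct (sq_spec (c u) (d u) Hc). lra.
Qed.

Lemma unit_root l1 l2 : l1 ^ 2 + l2 ^ 2 = 1 -> exists m1 m2, qsq m1 m2 = (l1, l2) /\ m1 ^ 2 + m2 ^ 2 = 1.
Proof.
  intros H. assert (-1 <= l1 <= 1) by (split; nra).
  pose (a := sqrt ((1 + l1) / 2)). pose (b := sqrt ((1 - l1) / 2)).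
  assert (Ha : a ^ 2 = (1 + l1) / 2) by (apply pow2_sqrt; lra).
  assert (Hb : b ^ 2 = (1 - l1) / 2) by (apply pow2_sqrt; lra).
  assert (0 <= a) by apply sqrt_pos. assert (0 <= b) by apply sqrt_pos.
  assert (Hab : (2 * (a * b)) ^ 2 = l2 ^ 2). { replace ((2 * (a * b)) ^ 2) with (4 * (a ^ 2 * b ^ 2)) by ring.
  rewrite Ha, Hb. nra. }
  assert (Hs : (2 * (a * b) - l2) * (2 * (a * b) + l2) = 0) by nra. apply Rmult_integral in Hs.
  destruct Hs as [Hs|Hs]; [exists a, b|exists a, (- b)]; (split; [unfold qsq; f_equal; nra|nra]).
Qed.

(** * One-sided limits *)

Lemma primitive_local (f : R -> R) (u0 d : R) : 0 < d -> (forall u, Rabs (u - u0) < d -> continuous f u) ->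
  exists F : R -> R, F u0 = 0 /\ forall u, Rabs (u - u0) < d -> is_derive F u (f u).
Proof.
  intros Hd Hc. exists (fun u => RInt f u0 u). split; [apply RInt_point_R|]. intros u Hu.
  apply (is_derive_RInt f (fun u => RInt f u0 u) u0 u); [|now apply Hc].
  apply locally_R. exists (d - Rabs (u - u0)). split; [lra|]. intros v Hv.
  apply (RInt_correct (V := R_CompleteNormedModule)). apply (ex_RInt_continuous (V := R_CompleteNormedModule)).
  intros w Hw.
  apply Hc. assert (Hvd : Rabs (v - u0) < d).
  { replace (v - u0) with ((v - u) + (u - u0)) by ring. eapply Rle_lt_trans; [apply Rabs_triang|]. lra. }
  rewrite Rmin_comm, Rmax_comm in Hw. unfold Rmin, Rmax in Hw. apply Rabs_def2 in Hvd.
  destruct (Rle_dec v u0); apply Rabs_def1; lra.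
Qed.

(** One side of f, folded onto both sides of u0 by u -> u0 + eta |u - u0| and completed by p. Its
    continuity at u0 expresses the one-sided limit p in a form to which [cont_eq_at] applies. *)
Definition pull (eta u0 : R) (f : R -> R) (p : R) : R -> R :=
  fun u => if Req_EM_T u u0 then p else f (u0 + eta * Rabs (u - u0)).

Lemma mvt_between (f df : R -> R) (a b : R) : a <> b ->
  (forall x, (a < x < b \/ b < x < a) -> is_derive f x (df x)) ->
    (forall x, (a <= x <= b \/ b <= x <= a) -> continuous f x) ->
  exists c, (a < c < b \/ b < c < a) /\ f b - f a = df c * (b - a).
Proof.
  intros Hab Hd Hc. destruct (Rtotal_order a b) as [H|[H|H]]; [|contradiction|].
  - destruct (mvt f df a b H) as [c [H1 H2]]; auto. exists c; auto.
  - destruct (mvt f df b a H) as [c [H1 H2]]; auto. exists c; split; auto. lra.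
Qed.

(** On the side considered f1 differs by a constant from a primitive of g, which is continuous up to
    u0; so f1 has a limit. The mean value theorem gives f / (u - u0) the same limit. *)
Lemma side_limit (eta u0 d : R) (f f1 g : R -> R) : eta = 1 \/ eta = -1 -> 0 < d -> f u0 = 0 -> continuous f u0 ->
  (forall u, 0 < eta * (u - u0) < d -> is_derive f u (f1 u) /\ is_derive f1 u (g u)) ->
  (forall u, Rabs (u - u0) < d -> continuous g u) ->
  exists p, continuous (pull eta u0 f1 p) u0 /\ continuous (pull eta u0 (fun u => f u / (u - u0)) p) u0.
Proof.
  intros He Hd Hf0 Hfc Hder Hg.
  destruct (primitive_local g u0 d Hd Hg) as [F [F0 HF]].
  assert (Hside : forall u, 0 < eta * (u - u0) < d -> Rabs (u - u0) < d).
  { intros u Hu. apply Rabs_def1; destruct He as [-> | ->]; lra. }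
  assert (Hbet : forall u v w, 0 < eta * (u - u0) < d -> 0 < eta * (v - u0) < d -> (u <= w <= v \/ v <= w <= u) ->
    0 < eta * (w - u0) < d).
  { intros u v w. destruct He as [-> | ->]; lra. }
  set (w0 := u0 + eta * (d / 2)). assert (Hw0 : 0 < eta * (w0 - u0) < d)
    by (unfold w0; destruct He as [-> | ->]; lra).
  set (p := f1 w0 - F w0).
  assert (Hp : forall u, 0 < eta * (u - u0) < d -> f1 u = p + F u).
  { intros u Hu. unfold p. destruct (Req_dec w0 u) as [->|Hne]; [ring|].
    destruct (mvt_between (fun u => f1 u - F u) (fun _ => 0) w0 u Hne) as [c [_ Hc]]; [| |lra].
    - intros v Hv. assert (Hv' : 0 < eta * (v - u0) < d) by (apply (Hbet w0 u v); auto; lra).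
      eapply is_derive_eq; [apply (der_minus (proj2 (Hder v Hv')) (HF v (Hside v Hv')))|ring].
    - intros v Hv. assert (Hv' : 0 < eta * (v - u0) < d) by (apply (Hbet w0 u v); auto; lra).
      eapply der_cont. apply (der_minus (proj2 (Hder v Hv')) (HF v (Hside v Hv'))). }
  exists p.
  assert (CF : continuous F u0) by (eapply der_cont; apply HF; rewrite Rminus_diag, Rabs_R0; auto).
  assert (Phi : forall u, u <> u0 -> Rabs (u - u0) < d -> 0 < eta * (u0 + eta * Rabs (u - u0) - u0) < d).
  { intros u Hne Hu. assert (0 < Rabs (u - u0)) by (apply Rabs_pos_lt; lra). destruct He as [-> | ->]; lra. }
  assert (Abs : forall u, Rabs (u0 + eta * Rabs (u - u0) - u0) = Rabs (u - u0)).
  { intros u. replace (u0 + eta * Rabs (u - u0) - u0) with (eta * Rabs (u - u0)) by ring.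
    rewrite Rabs_mult, Rabs_Rabsolu.
    destruct He as [-> | ->]; [rewrite Rabs_R1|replace (Rabs (-1)) with 1 by (rewrite Rabs_left; lra)]; ring. }
  assert (Main : forall h : R -> R, (forall u, 0 < eta * (u - u0) < d -> exists c, Rabs (c - u0) <= Rabs (u - u0) /\
    h u = p + F c) -> continuous (pull eta u0 h p) u0).
  { intros h Hh. apply continuous_R. intros e He0. destruct (proj1 (continuous_R _ _) CF e He0) as [d' [Hd' K]].
    exists (Rmin d d'). split; [now apply Rmin_pos|]. intros u Hu. pose proof (Rmin_l d d'). pose proof (Rmin_r d d').
    unfold pull. destruct (Req_EM_T u0 u0) as [_|]; [|tauto].
    destruct (Req_EM_T u u0) as [->|Hne]; [rewrite Rminus_diag, Rabs_R0; auto|].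
    destruct (Hh (u0 + eta * Rabs (u - u0))) as [c [Hc ->]]; [apply Phi; auto; lra|]. rewrite Abs in Hc.
    specialize (K c ltac:(lra)). rewrite F0, Rminus_0_r in K. replace (p + F c - p) with (F c) by ring. exact K. }
  split; apply Main; intros u Hu.
  - exists u. split; [lra|]. now apply Hp.
  - assert (Hne : u0 <> u) by (destruct He as [-> | ->]; lra).
    destruct (mvt_between f f1 u0 u Hne) as [c [Hc1 Hc2]].
    + intros v Hv. refine (proj1 (Hder v _)). destruct He as [-> | ->]; lra.
    + intros v Hv. destruct (Req_dec v u0) as [->|Hvne]; auto. refine (der_cont (proj1 (Hder v _))).
      destruct He as [-> | ->]; lra.
    + exists c. split.
      * destruct He as [-> | ->]; [rewrite !Rabs_right by lra; lra|rewrite !Rabs_left by lra; lra].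
      * assert (Hc : 0 < eta * (c - u0) < d) by (destruct He as [-> | ->]; lra).
        rewrite <- (Hp c Hc). rewrite Hf0, Rminus_0_r in Hc2. rewrite Hc2. field. lra.
Qed.

Lemma pull_both (f : R -> R) (u0 p : R) : continuous (pull 1 u0 f p) u0 -> continuous (pull (-1) u0 f p) u0 ->
  continuous (fun u => if Req_EM_T u u0 then p else f u) u0.
Proof.
  intros H1 H2. apply continuous_R. intros e He.
  destruct (proj1 (continuous_R _ _) H1 e He) as [d1 [Hd1 K1]].
  destruct (proj1 (continuous_R _ _) H2 e He) as [d2 [Hd2 K2]].
  exists (Rmin d1 d2). split; [now apply Rmin_pos|]. intros u Hu. pose proof (Rmin_l d1 d2).
  pose proof (Rmin_r d1 d2).
  specialize (K1 u ltac:(lra)). specialize (K2 u ltac:(lra)). unfold pull in *.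
  destruct (Req_EM_T u0 u0) as [_|]; [|tauto]. destruct (Req_EM_T u u0) as [->|Hne]; auto.
  destruct (Rlt_dec u u0).
  - rewrite (Rabs_left (u - u0)) in K2 by lra. replace (u0 + -1 * - (u - u0)) with u in K2 by ring. exact K2.
  - rewrite (Rabs_right (u - u0)) in K1 by lra. replace (u0 + 1 * (u - u0)) with u in K1 by ring. exact K1.
Qed.

Lemma cont_of_limit (f : R -> R) (u0 l : R) : filterlim f (locally' u0) (locally l) ->
  continuous (fun u => if Req_EM_T u u0 then l else f u) u0.
Proof.
  intros H. apply continuous_R. intros e He. destruct (proj1 (filterlim'_R _ _ _) H e He) as [d [Hd K]].
  exists d; split; auto. intros u Hu.
  destruct (Req_EM_T u0 u0) as [_|]; [|tauto]. destruct (Req_EM_T u u0) as [->|Hne];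
    [rewrite Rminus_diag, Rabs_R0; auto|]. now apply K.
Qed.

(** * Local square roots of the regularized curve *)

Section Lift.
Context (Q0 : C -> Prop) (E : C -> R -> R) (B A1 A2 : C -> R) (HD : smooth_data Q0 E B A1 A2).
Context (N : R) (va vb VA VB t kap : R -> R) (HK : KS Q0 E B N va vb VA VB t kap).

Let rho := rad va vb.
Let fx (x y y1 : R -> R) u := (2 * N * (x u ^ 2 + y u ^ 2) * B (qsq (x u) (y u)) * y1 u
     - (x u ^ 2 + y u ^ 2) * (d_1 E (qsq (x u) (y u)) (t u) * x u + d_2 E (qsq (x u) (y u)) (t u) * y u) + kap u *
         x u) / (2 * N ^ 2).
Let fy (x y x1 : R -> R) u := (- (2 * N * (x u ^ 2 + y u ^ 2) * B (qsq (x u) (y u)) * x1 u)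
     - (x u ^ 2 + y u ^ 2) * (d_2 E (qsq (x u) (y u)) (t u) * x u - d_1 E (qsq (x u) (y u)) (t u) * y u) + kap u *
         y u) / (2 * N ^ 2).

(** Stated at a single time so that roots can be glued germ by germ. The energy law is included
    because it makes the velocity nonzero at collisions, as [sqrt_unique] requires. *)
Definition lift_at (x y x1 y1 : R -> R) (u : R) : Prop :=
  is_derive x u (x1 u) /\ is_derive y u (y1 u) /\ is_derive x1 u (fx x y y1 u) /\ is_derive y1 u (fy x y x1 u) /\
  qsq (x u) (y u) = (va u, vb u) /\ 2 * N ^ 2 * (x1 u ^ 2 + y1 u ^ 2) - 1 = (x u ^ 2 + y u ^ 2) * kap u.

Lemma rho_sq u : rho u ^ 2 = va u ^ 2 + vb u ^ 2. Proof. apply Cmod2. Qed.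
Lemma rho_ge0 u : 0 <= rho u. Proof. apply Cmod_ge_0. Qed.
Lemma va_cont u : continuous va u. Proof. exact (der_cont (ks_va HK u)). Qed.
Lemma vb_cont u : continuous vb u. Proof. exact (der_cont (ks_vb HK u)). Qed.
Lemma rho_cont u : continuous rho u.
Proof. unfold rho, rad, Cmod. apply cont_sqrt. apply cont_plus; apply cont_pow; [apply va_cont|apply vb_cont]. Qed.
Lemma kap_cont u : continuous kap u. Proof. exact (der_cont (ks_kap HK u)). Qed.

Let v1 (x y : R -> R) u := (x u * VA u + y u * VB u) * / (2 * (x u ^ 2 + y u ^ 2)).
Let w1 (x y : R -> R) u := (x u * VB u - y u * VA u) * / (2 * (x u ^ 2 + y u ^ 2)).

(* away from collisions: z' = v' conj z / (2 |z|^2) *)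
Lemma lift_off (D : R -> Prop) (x y : R -> R) : open D -> (forall u, D u -> rho u <> 0) ->
  (forall u, D u -> ex_derive x u) -> (forall u, D u -> ex_derive y u) ->
    (forall u, D u -> qsq (x u) (y u) = (va u, vb u)) ->
  forall u, D u -> lift_at x y (v1 x y) (w1 x y) u.
Proof.
  intros HO Hr Hx Hy HQ u Hu. pose proof (ks_N HK) as HN.
  assert (Er : forall u, D u -> rho u = x u ^ 2 + y u ^ 2)
    by (intros w Hw; rewrite <- Cmod_qsq, HQ by auto; reflexivity).
  assert (Ea : forall u, D u -> va u = x u ^ 2 - y u ^ 2) by (intros w Hw; exact (eq_sym (f_equal Re (HQ w Hw)))).
  assert (Eb : forall u, D u -> vb u = 2 * (x u * y u)) by (intros w Hw; exact (eq_sym (f_equal Im (HQ w Hw)))).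
  destruct (Hx u Hu) as [x1 Dx]. destruct (Hy u Hu) as [y1 Dy].
  assert (EVA : VA u = 2 * (x u * x1 - y u * y1)).
  { rewrite <- (is_derive_unique _ _ _ (ks_va HK u)).
    rewrite (Derive_ext_loc va (fun u => x u ^ 2 - y u ^ 2)) by (apply filter_imp with (2 := HO u Hu); exact Ea).
    apply is_derive_unique. der. ring. }
  assert (EVB : VB u = 2 * (x u * y1 + x1 * y u)).
  { rewrite <- (is_derive_unique _ _ _ (ks_vb HK u)).
    rewrite (Derive_ext_loc vb (fun u => 2 * (x u * y u))) by (apply filter_imp with (2 := HO u Hu); exact Eb).
    apply is_derive_unique. der. ring. }
  pose proof (Hr u Hu) as Hru. rewrite Er in Hru by auto.
  assert (Ex1 : v1 x y u = x1) by (unfold v1; rewrite EVA, EVB; field; auto).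
  assert (Ey1 : w1 x y u = y1) by (unfold w1; rewrite EVA, EVB; field; auto).
  pose proof (ks_energy HK u) as En. fold rho in En. rewrite Er, EVA, EVB in En by auto.
  (* Since |v'|^2 = 4 |z|^2 |z'|^2, this is the energy identity of [KS] divided by 2 |z|^2. *)
  assert (En' : 2 * N ^ 2 * (x1 ^ 2 + y1 ^ 2) - 1 = (x u ^ 2 + y u ^ 2) * kap u).
  { apply Rmult_eq_reg_l with (2 * (x u ^ 2 + y u ^ 2)); [|lra].
    replace (2 * (x u ^ 2 + y u ^ 2) * (2 * N ^ 2 * (x1 ^ 2 + y1 ^ 2) - 1))
      with (N ^ 2 * ((2 * (x u * x1 - y u * y1)) ^ 2 + (2 * (x u * y1 + x1 * y u)) ^ 2) - 2 * (x u ^ 2 + y u ^ 2))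
      by ring.
    rewrite En. ring. }
  assert (Ek : kap u = (2 * N ^ 2 * (x1 ^ 2 + y1 ^ 2) - 1) / (x u ^ 2 + y u ^ 2)) by (rewrite En'; field; auto).
  pose proof (ks_VA HK u (Hr u Hu)) as DVA. pose proof (ks_VB HK u (Hr u Hu)) as DVB. fold rho in DVA, DVB.
  assert (Dr : is_derive (fun u => 2 * (x u ^ 2 + y u ^ 2)) u (4 * (x u * x1 + y u * y1))) by (der; ring).
  split; [|split; [|split; [|split; [|split]]]]; rewrite ?Ex1, ?Ey1; auto.
  - eapply is_derive_eq.
    + unfold v1. apply (der_mult (der_plus (der_mult Dx DVA) (der_mult Dy DVB)) (der_inv Dr ltac:(lra))).
    + unfold fx. rewrite Ey1, HQ, Ek, EVA, EVB, Er by auto. set (Bv := B (va u, vb u)).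
      set (F1 := d_1 E (va u, vb u) (t u)). set (F2 := d_2 E (va u, vb u) (t u)). clearbody Bv F1 F2.
      rewrite Ea, Eb by auto. field. split; [auto|lra].
  - eapply is_derive_eq.
    + unfold w1. apply (der_mult (der_minus (der_mult Dx DVB) (der_mult Dy DVA)) (der_inv Dr ltac:(lra))).
    + unfold fy. rewrite Ex1, HQ, Ek, EVA, EVB, Er by auto. set (Bv := B (va u, vb u)).
      set (F1 := d_1 E (va u, vb u) (t u)). set (F2 := d_2 E (va u, vb u) (t u)). clearbody Bv F1 F2.
      rewrite Ea, Eb by auto. field. split; [auto|lra].
Qed.

Lemma ball_open (u0 d : R) : open (fun u => Rabs (u - u0) < d).
Proof.
  intros u Hu. apply locally_R. exists (d - Rabs (u - u0)). split; [lra|]. intros v Hv.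
  replace (v - u0) with ((v - u) + (u - u0)) by ring. eapply Rle_lt_trans; [apply Rabs_triang|]. lra.
Qed.
Lemma punctured_open (u0 d : R) : open (fun u => Rabs (u - u0) < d /\ u <> u0).
Proof.
  intros u [Hu Hne]. apply filter_and; [now apply ball_open|]. apply locally_R. exists (Rabs (u - u0)).
  split; [apply Rabs_pos_lt; lra|].
  intros v Hv ->. rewrite Rabs_minus_sym in Hv. lra.
Qed.

(* the branch m sqrt(v conj l) of the square root of v near the direction l = m^2 *)
Let cc (l1 l2 : R) u := va u * l1 + vb u * l2.
Let dd (l1 l2 : R) u := vb u * l1 - va u * l2.
Let bx l1 l2 m1 m2 u := m1 * sqX (cc l1 l2 u) (dd l1 l2 u) - m2 * sqY (cc l1 l2 u) (dd l1 l2 u).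
Let by_ l1 l2 m1 m2 u := m1 * sqY (cc l1 l2 u) (dd l1 l2 u) + m2 * sqX (cc l1 l2 u) (dd l1 l2 u).

(** [cc] > 0 puts v conj l into the right half-plane, where the principal root is differentiable.
    The last clause places the branch in the half-plane around m; it decides the sign of the limit
    velocity at a collision. *)
Lemma branch_spec l1 l2 m1 m2 u : qsq m1 m2 = (l1, l2) -> m1 ^ 2 + m2 ^ 2 = 1 -> 0 < cc l1 l2 u ->
  qsq (bx l1 l2 m1 m2 u) (by_ l1 l2 m1 m2 u) = (va u, vb u) /\ ex_derive (bx l1 l2 m1 m2) u /\
    ex_derive (by_ l1 l2 m1 m2) u /\ rho u <> 0 /\
  0 < m1 * bx l1 l2 m1 m2 u + m2 * by_ l1 l2 m1 m2 u.
Proof.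
  intros Hm Hm1 Hc. assert (L1 := f_equal Re Hm). assert (L2 := f_equal Im Hm). simpl in L1, L2.
  assert (Hl : l1 ^ 2 + l2 ^ 2 = 1). { rewrite <- L1, <- L2. replace 1 with (1 ^ 2) at 3 by ring.
  rewrite <- Hm1 at 3. ring. }
  destruct (sq_spec _ (dd l1 l2 u) Hc) as [HS HX].
  assert (S1 := f_equal Re HS). assert (S2 := f_equal Im HS). simpl in S1, S2.
  destruct (sq_ex_derive (cc l1 l2) (dd l1 l2) u) as [DX DY]; auto.
  { eexists. unfold cc. apply (der_plus (der_mult (ks_va HK u) (der_const l1 u))
      (der_mult (ks_vb HK u) (der_const l2 u))). }
  { eexists. unfold dd. apply (der_minus (der_mult (ks_vb HK u) (der_const l1 u))
      (der_mult (ks_va HK u) (der_const l2 u))). }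
  destruct DX as [X1 DX]. destruct DY as [Y1 DY].
  split; [|split; [|split; [|split]]].
  - unfold bx, by_. set (X := sqX (cc l1 l2 u) (dd l1 l2 u)) in *. set (Y := sqY (cc l1 l2 u) (dd l1 l2 u)) in *.
    unfold qsq. f_equal.
    + replace ((m1 * X - m2 * Y) ^ 2 - (m1 * Y + m2 * X) ^ 2)
        with ((m1 * (m1 * 1) - m2 * (m2 * 1)) * (X * (X * 1) - Y * (Y * 1)) - (2 * (m1 * m2)) * (2 * (X * Y)))
        by ring.
      rewrite S1, S2, L1, L2. unfold cc, dd. replace (va u)
        with (va u * (l1 ^ 2 + l2 ^ 2)) at 3 by (rewrite Hl; ring). ring.
    + replace (2 * ((m1 * X - m2 * Y) * (m1 * Y + m2 * X)))
        with ((m1 * (m1 * 1) - m2 * (m2 * 1)) * (2 * (X * Y)) + (2 * (m1 * m2)) * (X * (X * 1) - Y * (Y * 1)))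
        by ring.
      rewrite S1, S2, L1, L2. unfold cc, dd. replace (vb u)
        with (vb u * (l1 ^ 2 + l2 ^ 2)) at 3 by (rewrite Hl; ring). ring.
  - eexists. unfold bx. apply (der_minus (der_mult (der_const m1 u) DX) (der_mult (der_const m2 u) DY)).
  - eexists. unfold by_. apply (der_plus (der_mult (der_const m1 u) DY) (der_mult (der_const m2 u) DX)).
  - intros H0. pose proof (rho_sq u) as K. rewrite H0 in K. assert (va u = 0) by nra. assert (vb u = 0) by nra.
    unfold cc in Hc. rewrite H, H1 in Hc. lra.
  - unfold bx, by_. set (X := sqX (cc l1 l2 u) (dd l1 l2 u)) in *. set (Y := sqY (cc l1 l2 u) (dd l1 l2 u)).
    replace (m1 * (m1 * X - m2 * Y) + m2 * (m1 * Y + m2 * X)) with ((m1 ^ 2 + m2 ^ 2) * X) by ring. rewrite Hm1. lra.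
Qed.

Lemma branch_re_cont l1 l2 u : continuous (cc l1 l2) u.
Proof. pose proof (va_cont u). pose proof (vb_cont u). unfold cc. cont. Qed.

Lemma local_lift_regular u0 : rho u0 <> 0 -> exists d x y x1 y1, 0 < d /\ forall u, Rabs (u - u0) < d ->
  lift_at x y x1 y1 u.
Proof.
  intros H0. pose proof (rho_sq u0) as K.
  (* With l the direction of v at u0 itself, v conj l is the positive number |v| there. *)
  pose (l1 := va u0 / rho u0). pose (l2 := vb u0 / rho u0).
  assert (Hl : l1 ^ 2 + l2 ^ 2 = 1). { unfold l1, l2.
  replace ((va u0 / rho u0) ^ 2 + (vb u0 / rho u0) ^ 2) with ((va u0 ^ 2 + vb u0 ^ 2) / rho u0 ^ 2) by (field; auto).
  rewrite <- K. field; auto. }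
  destruct (unit_root l1 l2 Hl) as (m1 & m2 & Hm & Hm1).
  assert (Hc : 0 < cc l1 l2 u0).
  { unfold cc, l1, l2. replace (va u0 * (va u0 / rho u0) + vb u0 * (vb u0 / rho u0))
      with ((va u0 ^ 2 + vb u0 ^ 2) / rho u0) by (field; auto).
    rewrite <- K. replace (rho u0 ^ 2 / rho u0) with (rho u0) by (field; auto). pose proof (rho_ge0 u0). lra. }
  destruct (proj1 (continuous_R _ _) (branch_re_cont l1 l2 u0) _ Hc) as [d [Hd Kd]].
  assert (Hpos : forall u, Rabs (u - u0) < d -> 0 < cc l1 l2 u)
    by (intros u Hu; specialize (Kd u Hu); apply Rabs_def2 in Kd; lra).
  assert (Sp := fun u Hu => branch_spec l1 l2 m1 m2 u Hm Hm1 (Hpos u Hu)).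
  exists d, (bx l1 l2 m1 m2), (by_ l1 l2 m1 m2), (v1 (bx l1 l2 m1 m2) (by_ l1 l2 m1 m2)),
    (w1 (bx l1 l2 m1 m2) (by_ l1 l2 m1 m2)). split; auto.
  apply (lift_off (fun u => Rabs (u - u0) < d)); [apply ball_open| | | |]; intros u Hu; apply (Sp u Hu).
Qed.

Lemma fold_cont (eta u0 : R) : continuous (fun u => u0 + eta * Rabs (u - u0)) u0.
Proof. cont. Qed.

Lemma fold_comp_cont (eta u0 : R) (f : R -> R) : continuous f u0 ->
  continuous (fun u => f (u0 + eta * Rabs (u - u0))) u0.
Proof.
  intros Hf. apply (continuous_comp (fun u => u0 + eta * Rabs (u - u0)) f); [apply fold_cont|].
  replace (u0 + eta * Rabs (u0 - u0)) with u0 by (rewrite Rminus_diag, Rabs_R0; ring). exact Hf.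
Qed.

(** The root passes through 0 with nonzero velocity, while v / |v| has the same limit from both
    sides; so the branch along m has to change its sign at u0. With this choice both one-sided
    velocities equal m / K, and the equation extends to u0 by continuity. *)
Lemma local_lift_collision u0 : rho u0 = 0 -> exists d x y x1 y1, 0 < d /\ forall u, Rabs (u - u0) < d ->
  lift_at x y x1 y1 u.
Proof.
  intros H0. pose proof (ks_N HK) as HN.
  assert (V0 : va u0 = 0 /\ vb u0 = 0). { pose proof (rho_sq u0) as K. rewrite H0 in K. split; nra.
  } destruct V0 as [Va0 Vb0].
  destruct (ks_direction HK u0 H0) as (l1 & l2 & Lim1 & Lim2). fold rho in Lim1, Lim2.
  pose (La u := if Req_EM_T u u0 then l1 else va u / rho u).
  pose (Lb u := if Req_EM_T u u0 then l2 else vb u / rho u).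
  assert (CLa : continuous La u0) by (apply (cont_of_limit (fun u => va u / rho u)); exact Lim1).
  assert (CLb : continuous Lb u0) by (apply (cont_of_limit (fun u => vb u / rho u)); exact Lim2).
  assert (La0 : La u0 = l1) by (unfold La; destruct (Req_EM_T u0 u0); tauto).
  assert (Lb0 : Lb u0 = l2) by (unfold Lb; destruct (Req_EM_T u0 u0); tauto).
  assert (LaE : forall u, u <> u0 -> La u = va u / rho u)
    by (intros u Hu; unfold La; destruct (Req_EM_T u u0); tauto).
  assert (LbE : forall u, u <> u0 -> Lb u = vb u / rho u)
    by (intros u Hu; unfold Lb; destruct (Req_EM_T u u0); tauto).
  assert (Iso : locally' u0 (fun u => rho u <> 0 /\ u <> u0)).
  { apply filter_and; [apply (ks_isolated HK)|]. apply locally'_R. exists 1; split; [lra|auto]. }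
  assert (Hl : l1 ^ 2 + l2 ^ 2 = 1).
  { rewrite <- La0, <- Lb0. apply (cont_eq_at (fun u => La u ^ 2 + Lb u ^ 2) (fun _ => 1)); [cont|cont|].
    apply filter_imp with (2 := Iso). intros u [Hu Hne]. rewrite LaE, LbE by auto.
    replace ((va u / rho u) ^ 2 + (vb u / rho u) ^ 2) with ((va u ^ 2 + vb u ^ 2) / rho u ^ 2) by (field; auto).
    rewrite <- rho_sq. field; auto. }
  destruct (unit_root l1 l2 Hl) as (m1 & m2 & Hm & Hm1).
  (* v / |v| tends to l, so the real part of v conj l / |v| tends to 1. *)
  assert (Hpos0 : exists d, 0 < d /\ forall u, Rabs (u - u0) < d -> u <> u0 -> 0 < cc l1 l2 u).
  { assert (C : continuous (fun u => La u * l1 + Lb u * l2) u0) by cont.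
    assert (C0 : La u0 * l1 + Lb u0 * l2 = 1) by (rewrite La0, Lb0; lra).
    destruct (proj1 (continuous_R _ _) C 1 ltac:(lra)) as [d1 [Hd1 K1]].
    destruct (proj1 (locally'_R _ _) Iso) as [d2 [Hd2 K2]].
    exists (Rmin d1 d2). split; [now apply Rmin_pos|]. intros u Hu Hne. pose proof (Rmin_l d1 d2).
    pose proof (Rmin_r d1 d2).
    specialize (K1 u ltac:(lra)). destruct (K2 u ltac:(lra) Hne) as [Hr _]. rewrite C0 in K1. apply Rabs_def2 in K1.
    rewrite LaE, LbE in K1 by auto.
    replace (cc l1 l2 u) with (rho u * (va u / rho u * l1 + vb u / rho u * l2)) by (unfold cc; field; auto).
    apply Rmult_lt_0_compat; [pose proof (rho_ge0 u); lra|lra]. }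
  destruct Hpos0 as [d [Hd Hpos]].
  pose (sg u := if Rlt_dec u u0 then -1 else 1).
  assert (Sg2 : forall u, sg u ^ 2 = 1) by (intros u; unfold sg; destruct (Rlt_dec u u0); ring).
  pose (x u := sg u * bx l1 l2 m1 m2 u). pose (y u := sg u * by_ l1 l2 m1 m2 u).
  assert (X0 : x u0 = 0 /\ y u0 = 0).
  { unfold x, y, bx, by_, cc, dd. rewrite Va0, Vb0. replace (0 * l1 + 0 * l2) with 0 by ring.
    replace (0 * l1 - 0 * l2) with 0 by ring.
    destruct sq_00 as [-> ->]. split; ring. }
  destruct X0 as [X0 Y0].
  set (D := fun u => Rabs (u - u0) < d /\ u <> u0).
  assert (HO : open D) by apply punctured_open.
  assert (Sp := fun u (Hu : D u) => branch_spec l1 l2 m1 m2 u Hm Hm1 (Hpos u (proj1 Hu) (proj2 Hu))).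
  assert (Sloc : forall u, D u -> locally u (fun v => sg v = sg u)).
  { intros u [_ Hne]. apply locally_R. exists (Rabs (u - u0)). split; [apply Rabs_pos_lt; lra|]. intros v Hv.
    unfold sg.
    destruct (Rlt_dec u u0); [rewrite (Rabs_left (u - u0)) in Hv by lra|rewrite (Rabs_right (u - u0)) in Hv by lra];
      apply Rabs_def2 in Hv; destruct (Rlt_dec v u0); lra. }
  assert (Qxy : forall u, D u -> qsq (x u) (y u) = (va u, vb u)).
  { intros u Hu. rewrite <- (proj1 (Sp u Hu)). unfold x, y, qsq. f_equal.
    - replace ((sg u * bx l1 l2 m1 m2 u) ^ 2 - (sg u * by_ l1 l2 m1 m2 u) ^ 2)
        with (sg u ^ 2 * (bx l1 l2 m1 m2 u ^ 2 - by_ l1 l2 m1 m2 u ^ 2)) by ring. rewrite Sg2. ring.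
    - replace (2 * (sg u * bx l1 l2 m1 m2 u * (sg u * by_ l1 l2 m1 m2 u)))
        with (sg u ^ 2 * (2 * (bx l1 l2 m1 m2 u * by_ l1 l2 m1 m2 u))) by ring. rewrite Sg2. ring. }
  assert (Lift : forall u, D u -> lift_at x y (v1 x y) (w1 x y) u).
  { apply (lift_off D); auto.
    - intros u Hu. apply (Sp u Hu).
    - intros u Hu. apply ex_derive_ext_loc with (fun v => sg u * bx l1 l2 m1 m2 v).
      + apply filter_imp with (2 := Sloc u Hu). intros v Hv. unfold x. now rewrite Hv.
      + destruct (proj1 (proj2 (Sp u Hu))) as [l Hl']. eexists. apply (der_mult (der_const (sg u) u) Hl').
    - intros u Hu. apply ex_derive_ext_loc with (fun v => sg u * by_ l1 l2 m1 m2 v).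
      + apply filter_imp with (2 := Sloc u Hu). intros v Hv. unfold y. now rewrite Hv.
      + destruct (proj1 (proj2 (proj2 (Sp u Hu)))) as [l Hl']. eexists. apply (der_mult (der_const (sg u) u) Hl'). }
  assert (Er : forall u, Rabs (u - u0) < d -> x u ^ 2 + y u ^ 2 = rho u).
  { intros u Hu. destruct (Req_dec u u0) as [->|Hne]; [rewrite X0, Y0, H0; ring|].
    rewrite <- Cmod_qsq, Qxy by (split; auto). reflexivity. }
  assert (Near : locally' u0 D) by (apply locally'_R; exists d; split; auto; intros; split; auto).
  assert (Cx : forall u, Rabs (u - u0) < d -> continuous x u).
  { intros u Hu. destruct (Req_dec u u0) as [->|Hne].
    - apply (cont_squeeze x rho); auto using rho_cont. apply filter_imp with (2 := Near). intros v [Hv _].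
      rewrite <- Er by auto. pose proof (pow2_ge_0 (y v)). lra.
    - exact (der_cont (proj1 (Lift u (conj Hu Hne)))). }
  assert (Cy : forall u, Rabs (u - u0) < d -> continuous y u).
  { intros u Hu. destruct (Req_dec u u0) as [->|Hne].
    - apply (cont_squeeze y rho); auto using rho_cont. apply filter_imp with (2 := Near). intros v [Hv _].
      rewrite <- Er by auto. pose proof (pow2_ge_0 (x v)). lra.
    - exact (der_cont (proj1 (proj2 (Lift u (conj Hu Hne))))). }
  (* The right-hand sides with |z|^2 z' replaced by v' conj z / 2 and |z|^2 by |v|. Free of the
     denominators of [v1] and [w1], they are continuous at u0. *)
  pose (Rx u := (2 * N * B (va u, vb u) * ((x u * VB u - y u * VA u) * / 2) - rho u *
    (d_1 E (va u, vb u) (t u) * x u + d_2 E (va u, vb u) (t u) * y u) + kap u * x u) * / (2 * N ^ 2)).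
  pose (Ry u := (- (2 * N * B (va u, vb u) * ((x u * VA u + y u * VB u) * / 2)) - rho u *
    (d_2 E (va u, vb u) (t u) * x u - d_1 E (va u, vb u) (t u) * y u) + kap u * y u) * / (2 * N ^ 2)).
  assert (CE : forall A, continuous_over Q0 A -> forall u, continuous (fun u => A (va u, vb u) (t u)) u).
  { intros A HA u. apply (cont_over Q0 A (fun u => (va u, vb u)) t); auto;
      [apply (ks_U HK)|apply cont_pair; [apply va_cont|apply vb_cont]|exact (der_cont (ks_t HK u))]. }
  destruct (smooth_cont_over _ _ (sd_E HD)) as (_ & CE1' & CE2' & _). pose proof (CE _ CE1') as CE1.
  pose proof (CE _ CE2') as CE2.
  assert (CB := CE (static B) (proj1 (sd_B HD 0%nat))). unfold static in CB.
  assert (CRx : forall u, Rabs (u - u0) < d -> continuous Rx u).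
  { intros u Hu. pose proof (Cx u Hu). pose proof (Cy u Hu). pose proof (kap_cont u). pose proof (rho_cont u).
    pose proof (ks_VAc HK u). pose proof (ks_VBc HK u).
    specialize (CE1 u). specialize (CE2 u). specialize (CB u). unfold Rx. cont. }
  assert (CRy : forall u, Rabs (u - u0) < d -> continuous Ry u).
  { intros u Hu. pose proof (Cx u Hu). pose proof (Cy u Hu). pose proof (kap_cont u). pose proof (rho_cont u).
    pose proof (ks_VAc HK u). pose proof (ks_VBc HK u).
    specialize (CE1 u). specialize (CE2 u). specialize (CB u). unfold Ry. cont. }
  assert (ERx : forall u, D u -> fx x y (w1 x y) u = Rx u).
  { intros u Hu. pose proof (proj1 (proj2 (proj2 (proj2 (Sp u Hu))))) as Hr. unfold fx, Rx, w1.
    rewrite (Qxy u Hu), (Er u (proj1 Hu)). field. split; auto; lra. }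
  assert (ERy : forall u, D u -> fy x y (v1 x y) u = Ry u).
  { intros u Hu. pose proof (proj1 (proj2 (proj2 (proj2 (Sp u Hu))))) as Hr. unfold fy, Ry, v1.
    rewrite (Qxy u Hu), (Er u (proj1 Hu)). field. split; auto; lra. }
  (* At a collision the energy law is 2 N^2 |z'|^2 = 1, that is, |z'| = 1 / K. *)
  pose (K := sqrt 2 * N). assert (HK0 : 0 < K) by (apply Rmult_lt_0_compat; auto; apply sqrt_lt_R0; lra).
  assert (HK2 : K ^ 2 = 2 * N ^ 2). { unfold K. replace ((sqrt 2 * N) ^ 2) with (sqrt 2 ^ 2 * N ^ 2) by ring.
  rewrite pow2_sqrt by lra. ring. }
  assert (Side : forall eta, eta = 1 \/ eta = -1 -> continuous (pull eta u0 (v1 x y) (m1 / K)) u0 /\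
    continuous (pull eta u0 (w1 x y) (m2 / K)) u0).
  { intros eta Heta.
    assert (HD' : forall u, 0 < eta * (u - u0) < d -> D u).
    { intros u Hu. split; [apply Rabs_def1; destruct Heta as [-> | ->]; lra|]. intros ->. rewrite Rminus_diag in Hu.
      lra. }
    destruct (side_limit eta u0 d x (v1 x y) Rx Heta Hd X0) as [px [Cp1 Cp2]]; auto.
    { apply Cx. rewrite Rminus_diag, Rabs_R0; auto. }
    { intros u Hu. pose proof (HD' u Hu) as Du. destruct (Lift u Du) as (L1 & _ & L3 & _). split; [exact L1|].
      rewrite ERx in L3 by auto. exact L3. }
    destruct (side_limit eta u0 d y (w1 x y) Ry Heta Hd Y0) as [py [Cq1 Cq2]]; auto.
    { apply Cy. rewrite Rminus_diag, Rabs_R0; auto. }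
    { intros u Hu. pose proof (HD' u Hu) as Du. destruct (Lift u Du) as (_ & L2 & _ & L4 & _). split; [exact L2|].
      rewrite ERy in L4 by auto. exact L4. }
    assert (P0 : forall f p, pull eta u0 f p u0 = p) by (intros; unfold pull; destruct (Req_EM_T u0 u0); tauto).
    assert (P1 : forall f p u, u <> u0 -> pull eta u0 f p u = f (u0 + eta * Rabs (u - u0)))
      by (intros f p u Hu; unfold pull; destruct (Req_EM_T u u0); tauto).
    assert (Phi0 : u0 + eta * Rabs (u0 - u0) = u0) by (rewrite Rminus_diag, Rabs_R0; ring).
    assert (Phi : forall u, D u -> D (u0 + eta * Rabs (u - u0))).
    { intros u [Hu Hne]. apply HD'. assert (0 < Rabs (u - u0)) by (apply Rabs_pos_lt; lra).
      destruct Heta as [-> | ->]; lra. }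
    assert (En : 2 * N ^ 2 * (px ^ 2 + py ^ 2) - 1 = 0).
    { transitivity (rho u0 * kap u0); [|rewrite H0; ring].
      pose proof (cont_eq_at (fun u => 2 * N ^ 2 * (pull eta u0 (v1 x y) px u ^ 2 + pull eta u0 (w1 x y) py u ^ 2) -
        1) (fun u => rho (u0 + eta * Rabs (u - u0)) * kap (u0 + eta * Rabs (u - u0))) u0) as T1.
      cbv beta in T1. rewrite !P0, Phi0 in T1. apply T1.
      - cont.
      - apply cont_mult; apply fold_comp_cont; [apply rho_cont|apply kap_cont].
      - apply filter_imp with (2 := Near). intros u Hu. rewrite !P1 by apply Hu. pose proof (Phi u Hu) as Du.
        destruct (Lift _ Du) as (_ & _ & _ & _ & _ & L6). rewrite L6, (Er _ (proj1 Du)). reflexivity. }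
    set (sx := pull eta u0 (fun u => x u / (u - u0)) px) in *.
    set (sy := pull eta u0 (fun u => y u / (u - u0)) py) in *.
    assert (Hs0 : sx u0 = px /\ sy u0 = py) by (split; apply P0). destruct Hs0 as [Sx0 Sy0].
    assert (SxE : forall u, D u -> let w := u0 + eta * Rabs (u - u0) in sx u = x w / (w - u0) /\
      sy u = y w / (w - u0) /\ D w).
    { intros u Hu. split; [|split]; [apply P1, Hu|apply P1, Hu|now apply Phi]. }
    (* The square of z / (u - u0) has the direction of v, which tends to l; in the limit the square
       of (px, py) is l times its squared modulus. [Q2] is the imaginary part. *)
    assert (Q1 : px ^ 2 - py ^ 2 = l1 * (px ^ 2 + py ^ 2)).
    { rewrite <- Sx0, <- Sy0.
      pose proof (cont_eq_at (fun u => sx u ^ 2 - sy u ^ 2)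
        (fun u => La (u0 + eta * Rabs (u - u0)) * (sx u ^ 2 + sy u ^ 2)) u0) as T1. cbv beta in T1.
      rewrite Phi0, La0 in T1. apply T1.
      - cont.
      - apply cont_mult; [now apply fold_comp_cont|cont].
      - apply filter_imp with (2 := Near). intros u Hu. destruct (SxE u Hu) as (-> & -> & Dw).
        set (w := u0 + eta * Rabs (u - u0)) in *. rewrite LaE by apply Dw.
        assert (w - u0 <> 0) by (destruct Dw; lra). pose proof (proj1 (proj2 (proj2 (proj2 (Sp w Dw))))) as Hr.
        pose proof (Er w (proj1 Dw)) as Erw.
        pose proof (f_equal Re (Qxy w Dw)) as Qr. change (x w ^ 2 - y w ^ 2 = va w) in Qr. rewrite <- Qr, <- Erw.
        rewrite <- Erw in Hr. field. auto. }
    assert (Q2 : 2 * (px * py) = l2 * (px ^ 2 + py ^ 2)).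
    { rewrite <- Sx0, <- Sy0.
      pose proof (cont_eq_at (fun u => 2 * (sx u * sy u))
        (fun u => Lb (u0 + eta * Rabs (u - u0)) * (sx u ^ 2 + sy u ^ 2)) u0) as T1. cbv beta in T1.
      rewrite Phi0, Lb0 in T1. apply T1.
      - cont.
      - apply cont_mult; [now apply fold_comp_cont|cont].
      - apply filter_imp with (2 := Near). intros u Hu. destruct (SxE u Hu) as (-> & -> & Dw).
        set (w := u0 + eta * Rabs (u - u0)) in *. rewrite LbE by apply Dw.
        assert (w - u0 <> 0) by (destruct Dw; lra). pose proof (proj1 (proj2 (proj2 (proj2 (Sp w Dw))))) as Hr.
        pose proof (Er w (proj1 Dw)) as Erw.
        pose proof (f_equal Im (Qxy w Dw)) as Qr. change (2 * (x w * y w) = vb w) in Qr. rewrite <- Qr, <- Erw.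
        rewrite <- Erw in Hr. field. auto. }
    (* [sg w] and w - u0 have the same sign, so z / (w - u0) is a positive multiple of the branch
       and lies in the half-plane around m. *)
    assert (Q3 : 0 <= m1 * px + m2 * py).
    { rewrite <- Sx0, <- Sy0.
      pose proof (cont_eq_at (fun u => Rabs (m1 * sx u + m2 * sy u)) (fun u => m1 * sx u + m2 * sy u) u0) as T1.
      cbv beta in T1.
      rewrite <- T1; [apply Rabs_pos|cont|cont|].
      apply filter_imp with (2 := Near). intros u Hu. destruct (SxE u Hu) as (-> & -> & Dw).
      set (w := u0 + eta * Rabs (u - u0)) in *.
      apply Rabs_right. left. pose proof (proj2 (proj2 (proj2 (proj2 (Sp w Dw))))) as Hb.
      assert (Hpu : 0 < Rabs (u - u0)) by (apply Rabs_pos_lt; destruct Hu; lra).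
      replace (m1 * (x w / (w - u0)) + m2 * (y w / (w - u0)))
        with ((m1 * bx l1 l2 m1 m2 w + m2 * by_ l1 l2 m1 m2 w) * (sg w / (w - u0))).
      2:{ unfold x, y. field. destruct Dw; lra. }
      apply Rmult_lt_0_compat; auto. unfold sg. destruct Heta as [He | He]; destruct (Rlt_dec w u0) as [Hw|Hw];
        unfold w in Hw |- *; rewrite He in Hw |- *; try lra.
      - apply Rdiv_lt_0_compat; lra.
      - replace (-1 / (u0 + -1 * Rabs (u - u0) - u0)) with (/ Rabs (u - u0)) by (field; lra).
        now apply Rinv_0_lt_compat. }
    assert (S1 : px ^ 2 + py ^ 2 = / K ^ 2).
    { rewrite HK2. apply Rmult_eq_reg_l with (2 * N ^ 2); [|nra]. rewrite Rinv_r by nra. lra. }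
    rewrite S1 in Q1, Q2. assert (HKn : K <> 0) by lra.
    assert (Eq : qsq (K * px) (K * py) = qsq m1 m2).
    { rewrite Hm. unfold qsq. f_equal.
      - replace ((K * px) ^ 2 - (K * py) ^ 2) with (K ^ 2 * (px ^ 2 - py ^ 2)) by ring. rewrite Q1. field; auto.
      - replace (2 * (K * px * (K * py))) with (K ^ 2 * (2 * (px * py))) by ring. rewrite Q2. field; auto. }
    (* K (px, py) and m have the same square l, so they agree up to sign, and [Q3] excludes the
       minus sign. *)
    destruct (qsq_inj _ _ _ _ Eq) as [s [Hs [Em1 Em2]]].
    assert (Hs1 : s = 1).
    { destruct Hs as [|Hs]; auto. exfalso. rewrite Em1, Em2, Hs in Q3.
      replace (-1 * (K * px) * px + -1 * (K * py) * py) with (- K * (px ^ 2 + py ^ 2)) in Q3 by ring.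
      rewrite S1 in Q3.
      assert (0 < / K ^ 2) by (apply Rinv_0_lt_compat; nra). nra. }
    rewrite Hs1 in Em1, Em2. replace (m1 / K) with px by (rewrite Em1; field; auto).
    replace (m2 / K) with py by (rewrite Em2; field; auto). split; auto. }
  destruct (Side 1 (or_introl eq_refl)) as [R1 R2]. destruct (Side (-1) (or_intror eq_refl)) as [R3 R4].
  pose (x1 u := if Req_EM_T u u0 then m1 / K else v1 x y u).
  pose (y1 u := if Req_EM_T u u0 then m2 / K else w1 x y u).
  assert (Cx1 : continuous x1 u0) by (apply pull_both; auto).
  assert (Cy1 : continuous y1 u0) by (apply pull_both; auto).
  assert (x1E : forall u, u <> u0 -> x1 u = v1 x y u) by (intros u Hu; unfold x1; destruct (Req_EM_T u u0); tauto).
  assert (y1E : forall u, u <> u0 -> y1 u = w1 x y u) by (intros u Hu; unfold y1; destruct (Req_EM_T u u0); tauto).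
  assert (x10 : x1 u0 = m1 / K) by (unfold x1; destruct (Req_EM_T u0 u0); tauto).
  assert (y10 : y1 u0 = m2 / K) by (unfold y1; destruct (Req_EM_T u0 u0); tauto).
  assert (B0 : Rabs (u0 - u0) < d) by (rewrite Rminus_diag, Rabs_R0; auto).
  assert (Dev : forall u, D u -> lift_at x y x1 y1 u).
  { intros u Hu. destruct (Lift u Hu) as (L1 & L2 & L3 & L4 & L5 & L6). unfold lift_at, fx, fy.
    rewrite x1E, y1E by apply Hu.
    split; [exact L1|]. split; [exact L2|]. split; [|split; [|split; [exact L5|exact L6]]].
    - apply is_derive_ext_loc with (2 := L3). apply filter_imp with (2 := HO u Hu). intros v Hv. symmetry.
      apply x1E, Hv.
    - apply is_derive_ext_loc with (2 := L4). apply filter_imp with (2 := HO u Hu). intros v Hv. symmetry.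
      apply y1E, Hv. }
  exists d, x, y, x1, y1. split; auto. intros u Hu. destruct (Req_dec u u0) as [->|Hne]; [|apply Dev; split; auto].
  assert (Rx0 : Rx u0 = 0) by (unfold Rx; rewrite X0, Y0, H0; ring).
  assert (Ry0 : Ry u0 = 0) by (unfold Ry; rewrite X0, Y0, H0; ring).
  split; [|split; [|split; [|split; [|split]]]].
  - apply derive_of_cont; auto. apply filter_imp with (2 := Near). intros v Hv. exact (proj1 (Dev v Hv)).
  - apply derive_of_cont; auto. apply filter_imp with (2 := Near). intros v Hv. exact (proj1 (proj2 (Dev v Hv))).
  - apply is_derive_eq with (Rx u0).
    + apply derive_of_cont; auto. apply filter_imp with (2 := Near). intros v Hv.
      destruct (Dev v Hv) as (_ & _ & L3 & _).
      apply (is_derive_eq L3). unfold fx. rewrite y1E by apply Hv. exact (ERx v Hv).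
    + rewrite Rx0. unfold fx. rewrite X0, Y0. unfold Rdiv. ring.
  - apply is_derive_eq with (Ry u0).
    + apply derive_of_cont; auto. apply filter_imp with (2 := Near). intros v Hv.
      destruct (Dev v Hv) as (_ & _ & _ & L4 & _).
      apply (is_derive_eq L4). unfold fy. rewrite x1E by apply Hv. exact (ERy v Hv).
    + rewrite Ry0. unfold fy. rewrite X0, Y0. unfold Rdiv. ring.
  - rewrite X0, Y0, Va0, Vb0. unfold qsq. f_equal; ring.
  - rewrite x10, y10, X0, Y0. replace (2 * N ^ 2) with (K ^ 2) by exact HK2.
    replace (K ^ 2 * ((m1 / K) ^ 2 + (m2 / K) ^ 2)) with (m1 ^ 2 + m2 ^ 2) by (field; lra). rewrite Hm1. ring.
Qed.

Lemma local_lift u0 : exists d x y x1 y1, 0 < d /\ forall u, Rabs (u - u0) < d -> lift_at x y x1 y1 u.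
Proof. destruct (Req_dec (rho u0) 0); [now apply local_lift_collision|now apply local_lift_regular]. Qed.
End Lift.

(** * Gluing local square roots *)

Section Glue.
Context (T : Type) (opp : T -> T) (P : (R -> T) -> R -> Prop) (u0 : R).
Context (Hgerm : forall f g u, locally u (fun v : R => f v = g v) -> P f u -> P g u).
Context (Hopp : forall f u, P f u -> P (fun v => opp (f v)) u).
Context (Hinv : forall t, opp (opp t) = t).
Context (Huniq : forall a b f g, (forall u, a < u < b -> P f u) -> (forall u, a < u < b -> P g u) ->
  (forall u, a < u < b -> g u = f u) \/ (forall u, a < u < b -> g u = opp (f u))).
Context (Hloc : forall u, exists d f, 0 < d /\ forall v, Rabs (v - u) < d -> P f v).
Context (Hbase : forall f, P f u0 -> f u0 <> opp (f u0)).

(** On the overlap (c, b) the second lift agrees with the first up to [opp], and may be replaced by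
    its opposite. Switching at the middle of the overlap leaves every germ that of one of the
    two. *)
Lemma glue_step a b c d f g : a < c < b -> b < d -> (forall u, a < u < b -> P f u) ->
  (forall u, c < u < d -> P g u) ->
  exists h, forall u, a < u < d -> P h u.
Proof.
  intros H1 H2 Hf Hg.
  assert (Hg' : exists g', (forall u, c < u < d -> P g' u) /\ forall u, c < u < b -> g' u = f u).
  { destruct (Huniq c b f g) as [K|K]; [intros; apply Hf; lra|intros; apply Hg; lra| |].
    - exists g; auto.
    - exists (fun v => opp (g v)). split; [intros; apply Hopp; auto|]. intros u Hu. rewrite K by auto. apply Hinv. }
  destruct Hg' as [g' [Hg1 Hg2]]. pose (m := (c + b) / 2).
  exists (fun u => if Rlt_dec u m then f u else g' u). intros u Hu.
  destruct (Rlt_dec u b) as [Hub|Hub].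
  - apply Hgerm with f; [|apply Hf; lra]. apply locally_R. exists (b - u). split; [lra|]. intros v Hv.
    apply Rabs_def2 in Hv.
    destruct (Rlt_dec v m) as [|Hvm]; auto. symmetry. apply Hg2. unfold m in Hvm. lra.
  - apply Hgerm with g'; [|apply Hg1; lra]. apply locally_R. exists (u - m). split; [unfold m; lra|]. intros v Hv.
    apply Rabs_def2 in Hv.
    destruct (Rlt_dec v m) as [|Hvm]; auto. unfold m in *. lra.
Qed.

(** A supremum argument: a lift from a that ends close to the largest reachable point s is continued
    beyond s by the local lift around s. *)
Lemma glue_bounded a b : a < b -> exists f, forall u, a < u < b -> P f u.
Proof.
  intros Hab. destruct (excluded_middle_informative (exists f, forall u, a < u < b -> P f u)) as [|Hn]; auto. exfalso.
  pose (S c := a < c /\ exists f, forall u, a < u < c -> P f u).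
  assert (Hne : exists c, S c).
  { destruct (Hloc a) as (d & f & Hd & K). exists (a + d). split; [lra|]. exists f. intros u Hu. apply K.
    apply Rabs_def1; lra. }
  assert (Hbd : bound S).
  { exists b. intros c [Hc [f Hf]]. destruct (Rle_lt_dec c b); auto. exfalso. apply Hn. exists f.
    intros; apply Hf; lra. }
  destruct (completeness S Hbd Hne) as [s [Hs1 Hs2]].
  destruct (Hloc s) as (d & g & Hd & K).
  assert (Hc : exists c, S c /\ s - d < c).
  { destruct (excluded_middle_informative (exists c, S c /\ s - d < c)) as [|Hn2]; auto. exfalso.
    assert (s <= s - d); [|lra]. apply Hs2. intros c Hc. destruct (Rle_lt_dec c (s - d)); auto. exfalso. apply Hn2.
    now exists c. }
  destruct Hc as [c [[Hac [f Hf]] Hcs]]. pose proof (Hs1 c (conj Hac (ex_intro _ f Hf))) as Hcs'.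
  assert (Snew : S (s + d)).
  { split; [lra|]. destruct (Rlt_dec a (s - d)) as [Hl|Hl].
    - apply (glue_step a c (s - d) (s + d) f g); auto; try lra. intros u Hu. apply K. apply Rabs_def1; lra.
    - exists g. intros u Hu. apply K. apply Rabs_def1; lra. }
  apply Hs1 in Snew. lra.
Qed.

(** Lifts chosen on growing intervals need not restrict to one another. Prescribing the value at u0,
    where [Hbase] distinguishes a lift from its opposite, makes them do so. *)
Lemma glue_global : exists f, forall u, P f u.
Proof.
  destruct (Hloc u0) as (d0 & f0 & Hd0 & K0).
  pose (good r f := (forall u, u0 - r < u < u0 + r -> P f u) /\ f u0 = f0 u0).
  assert (Ex : forall r, 0 < r -> exists f, good r f).
  { intros r Hr. destruct (glue_bounded (u0 - r) (u0 + r) ltac:(lra)) as [f Hf].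
    pose proof (Rmin_l r d0). pose proof (Rmin_r r d0). assert (0 < Rmin r d0) by now apply Rmin_pos.
    destruct (Huniq (u0 - Rmin r d0) (u0 + Rmin r d0) f0 f) as [K|K].
    - intros u Hu. apply K0. apply Rabs_def1; lra.
    - intros u Hu. apply Hf. lra.
    - exists f. split; auto. apply K; lra.
    - exists (fun v => opp (f v)). split; [intros; now apply Hopp, Hf|]. rewrite K by lra. apply Hinv. }
  assert (Agree : forall r r' f f' u, 0 < r -> 0 < r' -> good r f -> good r' f' -> Rabs (u - u0) < r ->
    Rabs (u - u0) < r' -> f u = f' u).
  { intros r r' f f' u Hr Hr' [G1 G2] [G1' G2'] Hu Hu'.
    pose proof (Rmin_l r r'). pose proof (Rmin_r r r'). assert (0 < Rmin r r') by now apply Rmin_pos.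
    assert (Hu2 : Rabs (u - u0) < Rmin r r') by (apply Rmin_glb_lt; auto). apply Rabs_def2 in Hu2.
    destruct (Huniq (u0 - Rmin r r') (u0 + Rmin r r') f' f) as [K|K].
    - intros w Hw. apply G1'. lra.
    - intros w Hw. apply G1. lra.
    - apply K; lra.
    - exfalso. specialize (K u0 ltac:(lra)). rewrite G2, <- G2' in K. apply (Hbase f'); auto. apply G1'; lra. }
  pose (F r := epsilon (inhabits f0) (good r)).
  assert (HF : forall r, 0 < r -> good r (F r)) by (intros r Hr; apply epsilon_spec; auto).
  (* Each time is evaluated by a lift whose interval contains it. Near u all these lifts agree with
     the one of radius |u - u0| + 2, so the germs are right although the radius varies with u. *)
  exists (fun u => F (Rabs (u - u0) + 1) u). intros u. pose proof (Rabs_pos (u - u0)).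
  apply Hgerm with (F (Rabs (u - u0) + 2)).
  - apply locally_R. exists 1. split; [lra|]. intros v Hv.
    assert (Hvu : Rabs (v - u0) < Rabs (u - u0) + 1).
    { replace (v - u0) with ((v - u) + (u - u0)) by ring. eapply Rle_lt_trans; [apply Rabs_triang|]. lra. }
    pose proof (Rabs_pos (v - u0)).
    apply (Agree (Rabs (u - u0) + 2) (Rabs (v - u0) + 1)); try apply HF; lra.
  - apply HF; [lra|]. assert (Rabs (u - u0) < Rabs (u - u0) + 2) by lra. apply Rabs_def2 in H0. lra.
Qed.
End Glue.

(** * The global regularized solution *)

Section Global.
Context (Q0 : C -> Prop) (E : C -> R -> R) (B A1 A2 : C -> R) (HD : smooth_data Q0 E B A1 A2).
Context (N : R) (va vb VA VB t kap : R -> R) (HK : KS Q0 E B N va vb VA VB t kap).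

Let T : Type := ((R * R) * (R * R))%type.
Let px (f : R -> T) u := fst (fst (f u)).
Let py (f : R -> T) u := snd (fst (f u)).
Let px1 (f : R -> T) u := fst (snd (f u)).
Let py1 (f : R -> T) u := snd (snd (f u)).
Let P (f : R -> T) u := lift_at E B N va vb t kap (px f) (py f) (px1 f) (py1 f) u.
Let opp (w : T) : T := ((- fst (fst w), - snd (fst w)), (- fst (snd w), - snd (snd w))).

Lemma lift_germ f g u : locally u (fun v : R => f v = g v) -> P f u -> P g u.
Proof.
  intros H (L1 & L2 & L3 & L4 & L5 & L6). pose proof (locally_singleton _ _ H) as Hu. cbv beta in Hu.
  assert (X : px g u = px f u /\ py g u = py f u /\ px1 g u = px1 f u /\ py1 g u = py1 f u)
    by (unfold px, py, px1, py1; now rewrite Hu).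
  destruct X as (X1 & X2 & X3 & X4). unfold P, lift_at. rewrite X1, X2, X3, X4.
  split; [|split; [|split; [|split; [|split]]]]; auto.
  - apply is_derive_ext_loc with (2 := L1). apply filter_imp with (2 := H). intros v Hv. unfold px. now rewrite Hv.
  - apply is_derive_ext_loc with (2 := L2). apply filter_imp with (2 := H). intros v Hv. unfold py. now rewrite Hv.
  - apply is_derive_ext_loc with (2 := L3). apply filter_imp with (2 := H). intros v Hv. unfold px1. now rewrite Hv.
  - apply is_derive_ext_loc with (2 := L4). apply filter_imp with (2 := H). intros v Hv. unfold py1. now rewrite Hv.
Qed.

Lemma qsq_opp x y : qsq (- x) (- y) = qsq x y.
Proof. unfold qsq. f_equal; ring. Qed.

Lemma lift_opp f u : P f u -> P (fun v => opp (f v)) u.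
Proof.
  intros (L1 & L2 & L3 & L4 & L5 & L6). unfold P, lift_at, px, py, px1, py1, opp; simpl fst; simpl snd.
  fold (px f u) (py f u) (px1 f u) (py1 f u).
  rewrite qsq_opp.
  split; [|split; [|split; [|split; [|split]]]].
  - apply (@der_opp (px f)). exact L1.
  - apply (@der_opp (py f)). exact L2.
  - eapply is_derive_eq; [apply (@der_opp (px1 f)); exact L3|]. field. pose proof (ks_N HK). lra.
  - eapply is_derive_eq; [apply (@der_opp (py1 f)); exact L4|]. field. pose proof (ks_N HK). lra.
  - exact L5.
  - replace ((- px1 f u) ^ 2) with (px1 f u ^ 2) by ring. replace ((- py1 f u) ^ 2) with (py1 f u ^ 2) by ring.
    replace ((- px f u) ^ 2) with (px f u ^ 2) by ring. replace ((- py f u) ^ 2) with (py f u ^ 2) by ring. exact L6.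
Qed.

Lemma lift_unique a b f g : (forall u, a < u < b -> P f u) -> (forall u, a < u < b -> P g u) ->
  (forall u, a < u < b -> g u = f u) \/ (forall u, a < u < b -> g u = opp (f u)).
Proof.
  intros Hf Hg. set (D := fun u => a < u < b).
  assert (HO : open D).
  { intros u Hu. unfold D in Hu. apply locally_R. exists (Rmin (u - a) (b - u)). split; [apply Rmin_pos; lra|].
    intros v Hv.
    pose proof (Rmin_l (u - a) (b - u)). pose proof (Rmin_r (u - a) (b - u)). apply Rabs_def2 in Hv. unfold D. lra. }
  destruct (sqrt_unique D (px f) (py f) (px g) (py g) (px1 f) (py1 f) (px1 g) (py1 g)) as [s [Hs K]]; auto.
  - intros u v w Hu Hv Hw. unfold D in *. lra.
  - intros u Hu. exact (proj1 (Hf u Hu)).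
  - intros u Hu. exact (proj1 (proj2 (Hf u Hu))).
  - intros u Hu. exact (proj1 (Hg u Hu)).
  - intros u Hu. exact (proj1 (proj2 (Hg u Hu))).
  - intros u Hu. destruct (Hf u Hu) as (_ & _ & L3 & L4 & _). destruct (Hg u Hu) as (_ & _ & M3 & M4 & _).
    split; [exact (der_cont L3)|]. split; [exact (der_cont L4)|]. split; [exact (der_cont M3)|exact (der_cont M4)].
  - intros u Hu. destruct (Hf u Hu) as (_ & _ & _ & _ & L5 & _). destruct (Hg u Hu) as (_ & _ & _ & _ & M5 & _).
    now rewrite L5, M5.
  - intros u Hu H0. destruct (Hf u Hu) as (_ & _ & _ & _ & _ & L6). rewrite H0 in L6. intros E0. rewrite E0 in L6.
    lra.
  - assert (K1 : forall u, D u -> px1 g u = s * px1 f u /\ py1 g u = s * py1 f u).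
    { intros u Hu. destruct (Hf u Hu) as (L1 & L2 & _). destruct (Hg u Hu) as (M1 & M2 & _). split.
      - rewrite <- (is_derive_unique _ _ _ M1). apply is_derive_unique.
        apply is_derive_ext_loc with (fun v => s * px f v).
        + apply filter_imp with (2 := HO u Hu). intros v Hv. symmetry. apply (K v Hv).
        + eapply is_derive_eq; [apply (der_mult (der_const s u) L1)|ring].
      - rewrite <- (is_derive_unique _ _ _ M2). apply is_derive_unique.
        apply is_derive_ext_loc with (fun v => s * py f v).
        + apply filter_imp with (2 := HO u Hu). intros v Hv. symmetry. apply (K v Hv).
        + eapply is_derive_eq; [apply (der_mult (der_const s u) L2)|ring]. }
    destruct Hs as [-> | ->]; [left|right]; intros u Hu; destruct (K u Hu) as [Ka Kb]; destruct (K1 u Hu) as [Kc Kd];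
      unfold px, py, px1, py1 in *;
      destruct (f u) as [[f1 f2] [f3 f4]]; destruct (g u) as [[g1 g2] [g3 g4]]; unfold opp; simpl in *;
        rewrite Ka, Kb, Kc, Kd; repeat f_equal; ring.
Qed.

Theorem KS_LC : exists s x y x1 y1, (s = 1 \/ s = -1) /\ LC Q0 E B N x y x1 y1 t kap /\ sign_periodic s x /\
  sign_periodic s y /\
  forall u, qsq (x u) (y u) = (va u, vb u).
Proof.
  (* At a time without collision z is nonzero, so a root is told from its opposite by its value
     there. *)
  assert (Hu0 : exists u0, rad va vb u0 <> 0).
  { destruct (proj1 (locally'_R _ _) (ks_isolated HK 0)) as [d [Hd K]]. exists (d / 2). apply K; [|lra].
    rewrite Rminus_0_r, Rabs_right; lra. }
  destruct Hu0 as [u0 Hu0].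
  assert (Inv : forall w, opp (opp w) = w) by (intros [[w1 w2] [w3 w4]]; unfold opp; simpl; repeat f_equal; ring).
  assert (Base : forall f, P f u0 -> f u0 <> opp (f u0)).
  { intros f (_ & _ & _ & _ & L5 & _) E0. apply Hu0. unfold rad. rewrite <- L5, Cmod_qsq.
    assert (px f u0 = 0 /\ py f u0 = 0) as [-> ->]; [|ring].
    unfold px, py. destruct (f u0) as [[f1 f2] [f3 f4]]. unfold opp in E0; simpl in E0. injection E0. intros. simpl.
    split; lra. }
  destruct (glue_global T opp P u0 lift_germ lift_opp Inv lift_unique) as [f Hf]; auto.
  { intros u. destruct (local_lift Q0 E B A1 A2 HD N va vb VA VB t kap HK u) as (d & x & y & x1 & y1 & Hd & K).
    exists d, (fun u => ((x u, y u), (x1 u, y1 u))). split; auto. }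
  (* The regularized data are 1-periodic except for t(u + 1) = t u + 1, which does not affect the
     derivatives of E. The shifted root is thus another root, and [sqrt_unique] produces the sign
     s. *)
  assert (Hsh : forall u, P (fun v => f (v + 1)) u).
  { intros u. destruct (Hf (u + 1)) as (L1 & L2 & L3 & L4 & L5 & L6). destruct (ks_per HK u) as (Pa & Pb & Pt & Pk).
    rewrite Pa, Pb in L5. rewrite Pk in L6.
    pose proof (ks_U HK u) as HU.
    assert (W1 : d_1 E (va u, vb u) (t (u + 1)) = d_1 E (va u, vb u) (t u)) by (rewrite Pt; now apply (d_1_per HD)).
    assert (W2 : d_2 E (va u, vb u) (t (u + 1)) = d_2 E (va u, vb u) (t u)) by (rewrite Pt; now apply (d_2_per HD)).
    unfold P, lift_at. change (px (fun v => f (v + 1)) u) with (px f (u + 1)).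
    change (py (fun v => f (v + 1)) u) with (py f (u + 1)).
    change (px1 (fun v => f (v + 1)) u) with (px1 f (u + 1)).
    change (py1 (fun v => f (v + 1)) u) with (py1 f (u + 1)).
    rewrite L5 in *. rewrite Pk, W1, W2 in L3, L4.
    split; [exact (shift_derive _ _ _ L1)|]. split; [exact (shift_derive _ _ _ L2)|].
    split; [exact (shift_derive _ _ _ L3)|]. split; [exact (shift_derive _ _ _ L4)|]. split; auto. }
  assert (Hs : exists s, (s = 1 \/ s = -1) /\ sign_periodic s (px f) /\ sign_periodic s (py f)).
  { destruct (sqrt_unique (fun _ => True) (px f) (py f) (fun u => px f (u + 1)) (fun u => py f (u + 1)) (px1 f)
      (py1 f) (fun u => px1 f (u + 1)) (fun u => py1 f (u + 1))) as [s [Hs K]]; auto using open_true.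
    - intros u _. exact (proj1 (Hf u)).
    - intros u _. exact (proj1 (proj2 (Hf u))).
    - intros u _. exact (proj1 (Hsh u)).
    - intros u _. exact (proj1 (proj2 (Hsh u))).
    - intros u _. destruct (Hf u) as (_ & _ & L3 & L4 & _). destruct (Hsh u) as (_ & _ & M3 & M4 & _).
      split; [exact (der_cont L3)|]. split; [exact (der_cont L4)|]. split; [exact (der_cont M3)|exact (der_cont M4)].
    - intros u _. destruct (Hf u) as (_ & _ & _ & _ & L5 & _). destruct (Hsh u) as (_ & _ & _ & _ & M5 & _).
      rewrite L5. symmetry. exact M5.
    - intros u _ H0. destruct (Hf u) as (_ & _ & _ & _ & _ & L6). rewrite H0 in L6. intros E0. rewrite E0 in L6. lra.
    - exists s. split; auto. split; intros u; apply (K u I). }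
  destruct Hs as [s [Hs [Sx Sy]]]. exists s, (px f), (py f), (px1 f), (py1 f).
  split; auto. split; [|split; [auto|split; [auto|]]].
  - constructor.
    + apply (ks_N HK).
    + intros u. destruct (Hf u) as (_ & _ & _ & _ & L5 & _). rewrite L5. apply (ks_U HK).
    + intros u. exact (proj1 (Hf u)).
    + intros u. exact (proj1 (proj2 (Hf u))).
    + intros u. exact (proj1 (proj2 (proj2 (Hf u)))).
    + intros u. exact (proj1 (proj2 (proj2 (proj2 (Hf u))))).
    + intros u. destruct (Hf u) as (_ & _ & _ & _ & L5 & _). rewrite <- Cmod_qsq, L5. exact (ks_t HK u).
    + apply (ks_t0 HK).
    + intros u. apply (ks_per HK u).
    + intros u. destruct (Hf u) as (L1 & L2 & _ & _ & L5 & _). apply (is_derive_eq (ks_kap HK u)).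
      assert (EA : VA u = 2 * (px f u * px1 f u - py f u * py1 f u)).
      { rewrite <- (is_derive_unique _ _ _ (ks_va HK u)). apply is_derive_unique.
        apply is_derive_ext with (fun v => px f v ^ 2 - py f v ^ 2).
        - intros v. destruct (Hf v) as (_ & _ & _ & _ & M5 & _). exact (f_equal Re M5).
        - eapply is_derive_eq; [apply (der_minus (der_pow2 L1) (der_pow2 L2))|ring]. }
      assert (EB : VB u = 2 * (px f u * py1 f u + px1 f u * py f u)).
      { rewrite <- (is_derive_unique _ _ _ (ks_vb HK u)). apply is_derive_unique.
        apply is_derive_ext with (fun v => 2 * (px f v * py f v)).
        - intros v. destruct (Hf v) as (_ & _ & _ & _ & M5 & _). exact (f_equal Im M5).
        - eapply is_derive_eq; [apply (der_mult (der_const 2 u) (der_mult L1 L2))|ring]. }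
      rewrite L5, EA, EB. reflexivity.
    + intros u. exact (proj2 (proj2 (proj2 (proj2 (proj2 (Hf u)))))).
  - intros u. exact (proj1 (proj2 (proj2 (proj2 (proj2 (Hf u)))))).
Qed.
End Global.

(** * The involution and the winding number *)

Lemma sq_neg z : sq (neg z) = sq z.
Proof. apply FunctionalExtensionality.functional_extensionality. intros t. rewrite !sq_xy. unfold neg.
destruct (z t). simpl. f_equal; ring. Qed.
Lemma Cmod_neg z t : Cmod (neg z t) = Cmod (z t).
Proof. apply Cmod_opp. Qed.
Lemma L2norm_neg z : L2norm (neg z) = L2norm z.
Proof. unfold L2norm, inner. f_equal. apply RInt_ext_all. intros t. unfold neg. destruct (z t). simpl. ring. Qed.
Lemma t_neg z : t_ (neg z) = t_ z.
Proof.
  apply FunctionalExtensionality.functional_extensionality. intros t. unfold t_. rewrite L2norm_neg. f_equal.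
  apply RInt_ext_all. intros u. now rewrite Cmod_neg.
Qed.
Lemma Cderive_neg z : Cderive (neg z) = neg (Cderive z).
Proof.
  apply FunctionalExtensionality.functional_extensionality. intros t. unfold Cderive, neg. apply C_eq; simpl.
  - apply (Derive_opp (fun s => Re (z s))).
  - apply (Derive_opp (fun s => Im (z s))).
Qed.
Lemma calF_neg E A1 A2 z : calF E A1 A2 (neg z) = calF E A1 A2 z.
Proof.
  unfold calF. rewrite Cderive_neg, sq_neg, !L2norm_neg. f_equal. unfold calE. rewrite L2norm_neg, sq_neg, t_neg.
  f_equal. apply RInt_ext_all. intros t. now rewrite Cmod_neg.
Qed.
Lemma Sigma_neg z : Sigma (neg z) = Sigma z.
Proof. unfold Sigma, tau_. now rewrite sq_neg, t_neg. Qed.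
Lemma smooth_neg z : smooth z -> smooth (neg z).
Proof.
  intros H t n. destruct (H t n) as [H1 H2]. split.
  - apply (ex_derive_n_opp (fun s => Re (z s))), H1.
  - apply (ex_derive_n_opp (fun s => Im (z s))), H2.
Qed.
Lemma loop_neg Q0 z : loop Q0 z -> loop Q0 (neg z).
Proof. intros (H1 & H2 & H3). split; [now apply smooth_neg|]. split; [now rewrite sq_neg|now rewrite L2norm_neg]. Qed.
Lemma periodic_neg z : periodic z -> periodic (neg z).
Proof. intros H t. unfold neg. now rewrite H. Qed.
Lemma antiperiodic_neg z : antiperiodic z -> antiperiodic (neg z).
Proof. intros H t. unfold neg. now rewrite H. Qed.

Lemma sign_periodic_neg s (z : R -> C) : sign_periodic s (fun t => Re (z t)) /\
  sign_periodic s (fun t => Im (z t)) -> sign_periodic s (fun t => Re (neg z t)) /\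
  sign_periodic s (fun t => Im (neg z t)).
Proof.
  intros [H1 H2]. split; intros t; unfold neg; [specialize (H1 t)|specialize (H2 t)]; cbv beta in *; simpl;
    unfold Re, Im in *; lra.
Qed.

(** The functional is even, so its derivative at -z along zeta is its derivative at z along -zeta,
    again an admissible direction. *)
Lemma critical_neg Q0 E A1 A2 s z : critical Q0 E A1 A2 s z -> critical Q0 E A1 A2 s (neg z).
Proof.
  intros (Hl & Px & Py & Hd). destruct (sign_periodic_neg s z (conj Px Py)) as [Px' Py'].
  split; [now apply loop_neg|]. split; [exact Px'|]. split; [exact Py'|]. intros zeta Hz Qx Qy.
  destruct (sign_periodic_neg s zeta (conj Qx Qy)) as [Qx' Qy'].
  unfold is_differential. apply is_derive_ext with
    (f := fun r => calF E A1 A2 (fun tau => z tau + RtoC r * neg zeta tau)%C).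
  - intros r. rewrite <- calF_neg. f_equal. apply FunctionalExtensionality.functional_extensionality. intros t.
    unfold neg. ring.
  - apply Hd; auto. now apply smooth_neg.
Qed.

Lemma cos_sin_Zpi (k : Z) : sin (IZR k * PI) = 0 /\ (Z.Even k -> cos (IZR k * PI) = 1) /\
  (Z.Odd k -> cos (IZR k * PI) = -1).
Proof.
  assert (S : forall j : Z, sin (IZR j * PI) = 0) by (intros j; apply sin_eq_0_1; now exists j).
  assert (C2 : forall j : Z, cos (2 * (IZR j * PI)) = 1) by (intros j; rewrite cos_2a_sin, S; ring).
  split; [apply S|]. split; intros [j ->].
  - rewrite mult_IZR, Rmult_assoc. apply C2.
  - rewrite plus_IZR, mult_IZR. replace ((2 * IZR j + 1) * PI) with (2 * (IZR j * PI) + PI) by ring.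
    rewrite neg_cos, C2. ring.
Qed.

Section Final.
Context {Q0 : C -> Prop} {E : C -> R -> R} {B A1 A2 : C -> R} (HD : smooth_data Q0 E B A1 A2).

Lemma Sigma_surj q : collisional_solution Q0 E B q -> exists s z, (s = 1 \/ s = -1) /\ critical Q0 E A1 A2 s z /\
  Sigma z = q.
Proof.
  intros Hq. destruct (collisional_KS HD Hq) as (N & VA & VB & t & kap & g & HK & G1 & G2).
  destruct (KS_LC Q0 E B A1 A2 HD N _ _ VA VB t kap HK) as (s & x & y & x1 & y1 & Hs & H & Px & Py & EQ).
  exists s, (fun u => (x u, y u)). split; auto. split; [apply (LC_critical HD s N x y x1 y1 t kap Hs H Px Py)|].
  assert (Gp : forall v, g (v + 1) = g v + 1).
  { intros v. rewrite <- (G1 (g v + 1)). f_equal. rewrite (lc_t1 H), G2. reflexivity. }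
  apply FunctionalExtensionality.functional_extensionality. intros v.
  rewrite (Sigma_eq HD s N (fun u => (x u, y u)) x1 y1 t kap g Hs H Px Py G1 G2 Gp v). simpl Re; simpl Im.
  rewrite EQ, G2. now destruct (q v).
Qed.

(** z and |q|^(1/2) exp(i theta / 2) are square roots of the same q, so the real function Re (z conj
    exp(i theta / 2)) equals |z| or -|z| and has no zero. One period multiplies it by s (-1)^k,
    which must therefore be 1. *)
Lemma winding_parity s z k : s = 1 \/ s = -1 -> critical Q0 E A1 A2 s z -> (forall t, Sigma z t <> 0) ->
  winding_number (Sigma z) k ->
  s * cos (IZR k * PI) = 1.
Proof.
  intros Hs Hc Hnz (theta & Ct & Ht & Hw).
  destruct (critical_LC HD s z Hs Hc) as [kap H]. destruct Hc as (_ & Px & Py & _).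
  destruct (LC_inverse H) as (g & G1 & G2 & Gc & Gp & G0).
  pose proof (Sigma_eq HD s _ z _ _ _ _ g Hs H Px Py G1 G2 Gp) as HS.
  set (x := fun t => Re (z t)) in *. set (y := fun t => Im (z t)) in *. set (t := tm x y) in *.
  assert (EQ : forall u, qsq (x u) (y u) = Sigma z (t u)) by (intros u; rewrite HS, G1; reflexivity).
  pose (f u := x u * cos (theta (t u) / 2) + y u * sin (theta (t u) / 2)).
  assert (NZ : forall u, f u <> 0).
  { intros u. pose (m := sqrt (Cmod (Sigma z (t u)))).
    assert (Hm : 0 < Cmod (Sigma z (t u))) by (apply Cmod_gt_0, Hnz).
    assert (Hm2 : m ^ 2 = Cmod (Sigma z (t u))) by (apply pow2_sqrt; lra).
    assert (Hm0 : 0 < m) by now apply sqrt_lt_R0.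
    set (h := theta (t u) / 2). assert (Sc := sin2_cos2 h). unfold Rsqr in Sc.
    assert (Q : qsq (m * cos h) (m * sin h) = qsq (x u) (y u)).
    { rewrite EQ, Ht, <- Hm2. replace (theta (t u)) with (2 * h) by (unfold h; field). rewrite cos_2a, sin_2a.
      apply C_eq; simpl; ring. }
    destruct (qsq_inj _ _ _ _ Q) as [r [Hr [Ex Ey]]]. unfold f. fold h. rewrite Ex, Ey.
    replace (r * (m * cos h) * cos h + r * (m * sin h) * sin h)
      with (r * m * (sin h * sin h + cos h * cos h)) by ring. rewrite Sc. destruct Hr as [-> | ->]; lra. }
  assert (Cf : forall u, continuous f u).
  { intros u. assert (continuous x u) by exact (der_cont (lc_x H u)).
    assert (continuous y u) by exact (der_cont (lc_y H u)).
    assert (Ch : continuous (fun u => theta (t u) / 2) u).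
    { unfold Rdiv. apply cont_mult; [|cont]. apply (continuous_comp t theta); [apply (LC_time_cont H)|apply Ct]. }
    unfold f. apply cont_plus; apply cont_mult; auto;
      [apply (continuous_comp (fun u => theta (t u) / 2) cos)|apply
      (continuous_comp (fun u => theta (t u) / 2) sin)]; auto; [apply continuous_cos|apply continuous_sin]. }
  destruct (cos_sin_Zpi k) as (Sk & Ce & Co). set (c := cos (IZR k * PI)) in *.
  assert (Hc : c = 1 \/ c = -1) by (destruct (Z.Even_or_Odd k); [left|right]; auto).
  assert (F1 : f 1 = s * c * f 0).
  { unfold f. rewrite <- (Rplus_0_l 1). rewrite (Px 0), (Py 0), (lc_t1 H), Hw.
    replace ((theta (t 0) + 2 * PI * IZR k) / 2) with (theta (t 0) / 2 + IZR k * PI) by field.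
    rewrite cos_plus, sin_plus, Sk. fold c. ring. }
  assert (Hsc : s * c = 1 \/ s * c = -1) by (destruct Hs as [-> | ->]; destruct Hc as [-> | ->]; lra).
  destruct Hsc as [|Hsc]; auto. exfalso. rewrite Hsc in F1.
  assert (CP : forall a, 0 <= a <= 1 -> continuity_pt f a) by (intros a _; apply continuous_continuity_pt, Cf).
  destruct (Rtotal_order (f 0) 0) as [L|[L|L]].
  - destruct (IVT_interv f 0 1 CP ltac:(lra) L ltac:(lra)) as [w [_ K]]. now apply (NZ w).
  - now apply (NZ 0).
  - destruct (IVT_interv (fun u => - f u) 0 1) as [w [_ K]]; try lra.
    + intros a Ha. apply continuity_pt_opp. auto.
    + apply (NZ w). lra.
Qed.
End Final.

(* The sign in the relation between A and B is the one for which the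
   Euler-Lagrange equation of calF, where A enters with a minus sign, is the
   stated equation of motion: dA = - B dq1 /\ dq2. *)
Theorem theorem7p1 (Q0 : C -> Prop) (E : C -> R -> R) (B A1 A2 : C -> R)
    (HQ0 : open Q0) (H0 : Q0 0)
    (HE : smooth_over Q0 E) (HEper : forall q t, Q0 q -> E q (t + 1) = E q t)
    (HB : smooth_over Q0 (static B))
    (HA1 : smooth_over Q0 (static A1)) (HA2 : smooth_over Q0 (static A2))
    (HdA : forall q, Q0 q ->
       d_1 (static A2) q 0 - d_2 (static A1) q 0 = - B q) :
  (forall z, (untwisted_loop Q0 z -> untwisted_loop Q0 (neg z)) /\
             (twisted_loop Q0 z -> twisted_loop Q0 (neg z)) /\
             calF E A1 A2 (neg z) = calF E A1 A2 z)
  /\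
  induces_bijection_mod_I Sigma (crit Q0 E A1 A2) (collisional_solution Q0 E B)
  /\
  (induces_bijection_mod_I Sigma
     (crit_untwisted Q0 E A1 A2) (even_solution Q0 E B A1 A2) /\
   induces_bijection_mod_I Sigma
     (crit_twisted Q0 E A1 A2) (odd_solution Q0 E B A1 A2) /\
   (forall q k, collisional_solution Q0 E B q -> (forall t, q t <> 0) ->
      winding_number q k ->
      (even_solution Q0 E B A1 A2 q <-> Z.Even k) /\
      (odd_solution Q0 E B A1 A2 q <-> Z.Odd k)))
  /\
  (forall z, crit Q0 E A1 A2 z ->
     forall tau, 0 <= tau < 1 -> delay_equation E B z tau).
Proof.
  assert (HD : smooth_data Q0 E B A1 A2) by (constructor; assumption).
  assert (CR : forall z, crit Q0 E A1 A2 z <-> exists s, (s = 1 \/ s = -1) /\ critical Q0 E A1 A2 s z).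
  { intros z. unfold crit. rewrite crit_untwisted_iff, crit_twisted_iff. split.
    - intros [K|K]; [exists 1|exists (-1)]; auto.
    - intros [s [[-> | ->] K]]; auto. }
  split; [|split; [|split; [split; [|split]|]]].
  - intros z. split; [|split; [|apply calF_neg]]; intros [Hl Hp]; (split; [now apply loop_neg|]);
      [now apply periodic_neg|now apply antiperiodic_neg].
  - split; [|split; [|split]].
    + intros z Hz. split; [|apply Sigma_neg]. apply CR in Hz. destruct Hz as [s [Hs K]]. apply CR. exists s.
      split; auto. now apply critical_neg.
    + intros z Hz. apply CR in Hz. destruct Hz as [s [Hs K]]. exact (Sigma_collisional HD s z Hs K).
    + intros z w Hz Hw. apply CR in Hz. apply CR in Hw. destruct Hz as [s [Hs K]]. destruct Hw as [s' [Hs' K']].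
      exact (Sigma_inj HD s s' z w Hs Hs' K K').
    + intros q Hq. destruct (Sigma_surj HD q Hq) as (s & z & Hs & K & Eq). exists z. split; auto. apply CR.
      now exists s.
  - split; [|split; [|split]].
    + intros z Hz. split; [|apply Sigma_neg]. rewrite crit_untwisted_iff in *. now apply critical_neg.
    + intros z Hz. split; [|now exists z]. apply crit_untwisted_iff in Hz.
      exact (Sigma_collisional HD 1 z (or_introl eq_refl) Hz).
    + intros z w Hz Hw. apply crit_untwisted_iff in Hz. apply crit_untwisted_iff in Hw.
      exact (Sigma_inj HD 1 1 z w (or_introl eq_refl) (or_introl eq_refl) Hz Hw).
    + intros q [_ Hq]. exact Hq.
  - split; [|split; [|split]].
    + intros z Hz. split; [|apply Sigma_neg]. rewrite crit_twisted_iff in *. now apply critical_neg.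
    + intros z Hz. split; [|now exists z]. apply crit_twisted_iff in Hz.
      exact (Sigma_collisional HD (-1) z (or_intror eq_refl) Hz).
    + intros z w Hz Hw. apply crit_twisted_iff in Hz. apply crit_twisted_iff in Hw.
      exact (Sigma_inj HD (-1) (-1) z w (or_intror eq_refl) (or_intror eq_refl) Hz Hw).
    + intros q [_ Hq]. exact Hq.
  - intros q k Hq Hnz Hw. destruct (cos_sin_Zpi k) as (_ & Ce & Co).
    (* Every preimage of q has the sign s = (-1)^k, so the parity of k decides which of the two loop
       spaces contains it. *)
    assert (W : forall s z, s = 1 \/ s = -1 -> critical Q0 E A1 A2 s z -> Sigma z = q -> s * cos (IZR k * PI) = 1).
    { intros s z Hs K <-. exact (winding_parity HD s z k Hs K Hnz Hw). }
    destruct (Sigma_surj HD q Hq) as (s & z & Hs & K & Eq).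
    split; split.
    + intros [_ [w [Hcw Ew]]]. apply crit_untwisted_iff in Hcw. pose proof (W 1 w (or_introl eq_refl) Hcw Ew) as W1.
      destruct (Z.Even_or_Odd k) as [|Ho]; auto. rewrite (Co Ho) in W1. lra.
    + intros He. split; auto. pose proof (W s z Hs K Eq) as W1. rewrite (Ce He) in W1. assert (s = 1) by lra. subst s.
      exists z. split; auto. now apply crit_untwisted_iff.
    + intros [_ [w [Hcw Ew]]]. apply crit_twisted_iff in Hcw. pose proof (W (-1) w (or_intror eq_refl) Hcw Ew) as W1.
      destruct (Z.Even_or_Odd k) as [He|]; auto. rewrite (Ce He) in W1. lra.
    + intros Ho. split; auto. pose proof (W s z Hs K Eq) as W1. rewrite (Co Ho) in W1. assert (s = -1) by lra.
      subst s.
      exists z. split; auto. now apply crit_twisted_iff.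
  (* On [0,1) the delay equation is directly the vanishing of the defects. *)
  - intros z Hz tau Htau. apply CR in Hz. destruct Hz as [s [Hs (Hl & Px & Py & Hd)]].
    pose proof (proj1 (critical_defects HD s z Hs Hl Px Py) Hd tau ltac:(lra)) as K.
    destruct Hl as (H1 & H2 & H3). apply (delay_xy Q0 E B z tau HE H2 H1 H3). exact K.
Qed.
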